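(* Let $\varphi:M=N_T\times_f N_\theta\to\bar M$ be an isometric immersion from a warped product semi-slant submanifold into a nearly trans-Sasakian manifold $(\bar M,\phi,\xi,\eta,g)$ of type $(\alpha,\beta)$ such that $\xi$ is tangent to $N_T$, and let $h$ be its second fundamental form. Then: (i) $$\tfrac12\|h\|^2\ \ge\ \bar\tau(TM)-\bar\tau(TN_T)-\bar\tau(TN_\theta)-\frac{n_2\,\Delta f}{f},$$ where $n_2$ is the dimension of $N_\theta$; (ii) if the equality sign in (i) holds identically, then $N_T$ and $N_\theta$ are totally geodesic and totally umbilical submanifolds in $\bar M$, respectively.
   Context: An almost contact metric manifold is a $(2m+1)$-dimensional smooth manifold $\bar M$ with a $(1,1)$-tensor field $\phi$, a vector field $\xi$, a $1$-form $\eta$ and a Riemannian metric $g$ satisfying $\phi^2=-I+\eta\otimes\xi$, $\phi\xi=0$, $\eta\circ\phi=0$, $\eta(\xi)=1$, $\eta(X)=g(X,\xi)$ and $g(\phi X,\phi Y)=g(X,Y)-\eta(X)\eta(Y)$ for all vector fields $X,Y$ on $\bar M$. Let $\bar\nabla$ be the Levi-Civita connection of $g$. The structure is nearly trans-Sasakian of type $(\alpha,\beta)$ ($\alpha,\beta$ smooth functions on $\bar M$) if for all vector fields $X,Y$ on $\bar M$ $$(\bar\nabla_X\phi)Y+(\bar\nabla_Y\phi)X=\alpha\big(2g(X,Y)\xi-\eta(Y)X-\eta(X)Y\big)-\beta\big(\eta(Y)\phi X+\eta(X)\phi Y\big).$$ For Riemannian manifolds $(N_1,g_1)$, $(N_2,g_2)$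 and a positive differentiable function $f$ on $N_1$, the warped product $N_1\times_f N_2$ is the product manifold $N_1\times N_2$ with the metric $\|X\|^2=\|\pi_{1\star}X\|^2+(f\circ\pi_1)^2\|\pi_{2\star}X\|^2$, where $\pi_1,\pi_2$ are the projections; $f$ is identified with $f\circ\pi_1$. A warped product semi-slant submanifold of type $N_T\times_f N_\theta$ is a submanifold $M$ of $\bar M$, with $\xi$ tangent to $M$, which with the induced metric is a warped product $N_T\times_f N_\theta$ such that: $N_T$ is an invariant submanifold ($\phi(TN_T)\subseteq TN_T$), and $N_\theta$ is a proper slant submanifold with slant angle $\theta\in(0,\pi/2)$, i.e. for every nonzero vector $Z$ tangent to $N_\theta$ and not proportional to $\xi$, the angle between $\phi Z$ and the tangent space of $N_\theta$ is the constant $\theta$. ''$\xi$ is tangent to $N_T$'' means that along $M$ the vector field $\xi$ lies in the subbundle of $TM$ tangent to the factor $N_T$. The second fundamental form $h$ is defined by $\bar\nabla_XY=\nabla_XY+h(X,Y)$ for $X,Y$ tangent to $M$, with $\nabla$ the Levi-Civita connection of $M$, and $\|h\|^2=\sum_{i,j=1}^n g(h(e_i,e_j),h(e_i,e_j))$ for a local orthonormal frame $e_1,\dots,e_n$ of $TM$, $n=\dim M$. For a $k$-dimensional subspace $\Pi$ of $T_x\bar M$ with orthonormal basis $e_1,\dots,e_k$, $\bar\tau(\Pi)=\sum_{1\le i<j\le k}\bar K(e_i\wedge e_j)$, where $\bar K$ is the sectional curvature of $\bar M$; $\bar\tau(TM),\bar\tau(TN_T),\bar\tau(TN_\theta)$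 are the functions on $M$ obtained by taking $\Pi$ to be the tangent space of $M$, and the subspaces of it tangent to $N_T$ and to $N_\theta$, at each point. The Laplacian has the sign convention $\Delta\psi=\sum_i\big((\nabla_{e_i}e_i)\psi-e_ie_i\psi\big)$; for the warping function $f$, a function on $N_T$, $\Delta f$ is the Laplacian on $N_T$, the sum being over a local orthonormal frame $e_1,\dots,e_{n_1}$ of $N_T$, $n_1=\dim N_T$. A submanifold is totally geodesic if its second fundamental form vanishes, and totally umbilical if its second fundamental form satisfies $h(X,Y)=g(X,Y)H$ with $H$ its mean curvature vector. *)

(* Defs.v *)
From HB Require Import structures.
From mathcomp Require Import all_boot all_order all_algebra.
From mathcomp Require Import all_classical all_reals all_analysis.
From mathcomp Require Import ring.

Set Implicit Arguments.
Unset Strict Implicit.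
Unset Printing Implicit Defensive.

Import Order.TTheory GRing.Theory Num.Theory numFieldNormedType.Exports.

Local Open Scope classical_set_scope.
Local Open Scope ring_scope.

(* Vectors are row vectors: a linear map with matrix A sends v to v *m A, a   *)
(* bilinear form with matrix B has the value v *m B *m w^T on (v, w).         *)
Definition bil (R : realType) n (B : 'M[R]_n) (v w : 'rV[R]_n) : R :=
  (v *m B *m w^T) 0 0.

Lemma bilC (R : realType) n (B : 'M[R]_n) (v w : 'rV[R]_n) :
  B^T = B -> bil B v w = bil B w v.
Proof.
move=> sB; rewrite /bil.
have -> : v *m B *m w^T = (w *m B *m v^T)^T.
  by rewrite !trmx_mul trmxK sB mulmxA.
by rewrite mxE.
Qed.

Section Smooth.
Variables (R : realType) (n : nat) (V : normedModType R).

Fixpoint Ck (k : nat) (U : set 'rV[R]_n) (f : 'rV[R]_n -> V) : Prop :=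
  match k with
  | 0%N => forall u, U u -> {for u, continuous f}
  | k'.+1 => (forall u, U u -> differentiable f u) /\
             (forall v, Ck k' U (fun u => 'D_v f u))
  end.

Definition smooth_on (U : set 'rV[R]_n) (f : 'rV[R]_n -> V) : Prop :=
  forall k, Ck k U f.

End Smooth.

(* Riemannian geometry on an open subset of R^n, for a metric u |-> G u.      *)
Section Local.
Variables (R : realType) (n : nat) (G : 'rV[R]_n -> 'M[R]_n).
Implicit Types u v w z : 'rV[R]_n.

(* christoffel u v w has the components Gamma^k_(ij) v^i w^j at u, with       *)
(*   Gamma^k_(ij) = (d_i g_jl + d_j g_il - d_l g_ij) g^(lk) / 2.              *)
Definition christoffel u v w : 'rV[R]_n :=
  2^-1 *: (w *m 'D_v G u + v *m 'D_w G u
           - \row_l bil ('D_(delta_mx 0 l) G u) v w) *m invmx (G u).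

(* nabla_v nabla_w z - nabla_w nabla_v z for v, w, z extended to fields that  *)
(* are constant in the coordinates, so that [v, w] = 0.                       *)
Definition riemann u v w z : 'rV[R]_n :=
  'D_v (fun q => christoffel q w z) u - 'D_w (fun q => christoffel q v z) u
  + christoffel u v (christoffel u w z) - christoffel u w (christoffel u v z).

Lemma christoffel_torsion_free u v w :
  (forall z, ('D_z G u)^T = 'D_z G u) ->
  christoffel u v w = christoffel u w v.
Proof.
move=> sD; rewrite /christoffel.
have -> : \row_l bil ('D_(delta_mx 0 l) G u) v w
           = \row_l bil ('D_(delta_mx 0 l) G u) w v.
  by apply/rowP=> l; rewrite !mxE bilC.
by move: (w *m _) (v *m _) => A B; rewrite (addrC A).
Qed.

Lemma christoffel_metric u v w z :
  differentiable G u -> G u \in unitmx -> (G u)^T = G u ->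
  (forall z, ('D_z G u)^T = 'D_z G u) ->
  bil ('D_z G u) v w =
  bil (G u) (christoffel u z v) w + bil (G u) v (christoffel u z w).
Proof.
move=> dG uG sG sD; rewrite (bilC v (christoffel u z w) sG).
have rowE a b c : (\row_l bil ('D_(delta_mx 0 l) G u) a b *m c^T) 0 0
    = bil ('D_c G u) a b.
  rewrite {2}(row_sum_delta c) deriveE // linear_sum /bil mulmx_sumr mulmx_suml.
  rewrite summxE mxE; apply: eq_bigr => l _.
  rewrite linearZ -deriveE //= -scalemxAr -scalemxAl [RHS]mxE mulrC.
  by rewrite [c^T l 0]mxE [(\row__ _) 0 l]mxE.
have cE a b : bil (G u) (christoffel u z a) b =
    2^-1 * (bil ('D_z G u) a b + bil ('D_a G u) z b - bil ('D_b G u) z a).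
  rewrite {1}/bil /christoffel mulmxKV // -scalemxAl mxE; congr (_ * _).
  by rewrite mulmxBl mulmxDl [LHS]mxE [X in X + _]mxE [X in _ + X]mxE rowE.
rewrite (cE v w) (cE w v).
have aux (a a' b c : R) : a' = a ->
    a = 2^-1 * (a + b - c) + 2^-1 * (a' + c - b) by move=> ->; field.
by apply: aux; apply: bilC.
Qed.

End Local.

Section Manifold.
Variable R : realType.

Record chart (T : topologicalType) (n : nat) := Chart {
  cdom : set T;
  cimg : set 'rV[R]_n;
  cfwd : T -> 'rV[R]_n;
  cinv : 'rV[R]_n -> T }.

Definition is_chart (T : topologicalType) n (c : chart T n) : Prop :=
  [/\ open (cdom c) /\ open (cimg c),
      forall x, cdom c x -> cimg c (cfwd c x) /\ cinv c (cfwd c x) = x,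
      forall u, cimg c u -> cdom c (cinv c u) /\ cfwd c (cinv c u) = u,
      forall x, cdom c x -> {for x, continuous (cfwd c)}
    & forall u, cimg c u -> {for u, continuous (cinv c)}].

(* The atlas is indexed by the points: chart_at x is a chart around x. The    *)
(* tangent space at x is 'rV_n, a vector being given by its components in     *)
(* chart_at x; its components in another chart come from the transition maps. *)
Record manifold (n : nat) := Manifold {
  pt :> topologicalType;
  chart_at : pt -> chart pt n }.

Definition coord n (M : manifold n) (x : M) : 'rV[R]_n := cfwd (chart_at x) x.

Definition point n (M : manifold n) (x : M) : 'rV[R]_n -> M :=
  cinv (chart_at x).

Definition transition n (M : manifold n) (x y : M) : 'rV[R]_n -> 'rV[R]_n :=
  cfwd (chart_at y) \o point x.

Definition smooth_manifold n (M : manifold n) : Prop :=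
  [/\ hausdorff_space M, @second_countable M,
      forall x : M, is_chart (chart_at x) /\ cdom (chart_at x) x
    & forall x y : M,
        smooth_on [set u | cimg (chart_at x) u /\ cdom (chart_at y) (point x u)]
                  (transition x y)].

Definition prod_chart (T1 T2 : topologicalType) n1 n2
    (c1 : chart T1 n1) (c2 : chart T2 n2) : chart (T1 * T2)%type (n1 + n2) :=
  @Chart (T1 * T2)%type (n1 + n2)
    (cdom c1 `*` cdom c2)
    [set u | cimg c1 (lsubmx u) /\ cimg c2 (rsubmx u)]
    (fun x => row_mx (cfwd c1 x.1) (cfwd c2 x.2))
    (fun u => (cinv c1 (lsubmx u), cinv c2 (rsubmx u))).

Definition prod_manifold n1 n2 (N1 : manifold n1) (N2 : manifold n2) :
    manifold (n1 + n2) :=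
  @Manifold (n1 + n2) (N1 * N2)%type
    (fun x => prod_chart (chart_at x.1) (chart_at x.2)).

Section Tensors.
Variables (n : nat) (M : manifold n).

Definition sfield := M -> R.
Definition vfield := M -> 'rV[R]_n.
Definition form1 := M -> 'cV[R]_n.   (* eta(v) = (v *m eta) 0 0 *)
Definition endo := M -> 'M[R]_n.     (* phi v = v *m phi *)
Definition metric := M -> 'M[R]_n.   (* g(v, w) = bil g v w *)

(* Components in chart_at x, as functions of the coordinates u. *)
Definition fun_loc (f : sfield) (x : M) (u : 'rV[R]_n) : R := f (point x u).

Definition vfield_loc (X : vfield) (x : M) (u : 'rV[R]_n) : 'rV[R]_n :=
  let y := point x u in X y *m jacobian (transition y x) (coord y).

Definition form1_loc (eta : form1) (x : M) (u : 'rV[R]_n) : 'cV[R]_n :=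
  let y := point x u in jacobian (transition x y) u *m eta y.

Definition endo_loc (P : endo) (x : M) (u : 'rV[R]_n) : 'M[R]_n :=
  let y := point x u in
  jacobian (transition x y) u *m P y *m jacobian (transition y x) (coord y).

Definition metric_loc (g : metric) (x : M) (u : 'rV[R]_n) : 'M[R]_n :=
  let y := point x u in
  jacobian (transition x y) u *m g y *m (jacobian (transition x y) u)^T.

Definition smooth_fun (f : sfield) : Prop :=
  forall x, smooth_on (cimg (chart_at x)) (fun_loc f x).

Definition smooth_vfield_on (U : set M) (X : vfield) : Prop :=
  forall x,
    smooth_on [set u | cimg (chart_at x) u /\ U (point x u)] (vfield_loc X x).

Definition smooth_form1 (eta : form1) : Prop :=
  forall x, smooth_on (cimg (chart_at x)) (form1_loc eta x).

Definition smooth_endo (P : endo) : Prop :=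
  forall x, smooth_on (cimg (chart_at x)) (endo_loc P x).

Definition riemannian_metric (g : metric) : Prop :=
  [/\ forall x, (g x)^T = g x,
      forall x v, v != 0 -> 0 < bil (g x) v v
    & forall x, smooth_on (cimg (chart_at x)) (metric_loc g x)].

Definition vder (X : vfield) (f : sfield) : sfield :=
  fun x => 'D_(X x) (fun_loc f x) (coord x).

(* Levi-Civita connection of g: see christoffel_torsion_free and              *)
(* christoffel_metric.                                                        *)
Definition nabla (g : metric) (X Y : vfield) : vfield := fun x =>
  'D_(X x) (vfield_loc Y x) (coord x)
  + christoffel (metric_loc g x) (coord x) (X x) (Y x).

Definition app_endo (P : endo) (X : vfield) : vfield := fun x => X x *m P x.

(* (nabla_X P) Y *)
Definition nabla_endo (g : metric) (P : endo) (X Y : vfield) : vfield :=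
  fun x => nabla g X (app_endo P Y) x - app_endo P (nabla g X Y) x.

Definition curvature (g : metric) (x : M) (u v w : 'rV[R]_n) : 'rV[R]_n :=
  riemann (metric_loc g x) (coord x) u v w.

Definition sectional (g : metric) (x : M) (u v : 'rV[R]_n) : R :=
  bil (g x) (curvature g x u v v) u
  / (bil (g x) u u * bil (g x) v v - bil (g x) u v ^+ 2).

End Tensors.

Arguments sfield {n} M.
Arguments vfield {n} M.
Arguments form1 {n} M.
Arguments endo {n} M.
Arguments metric {n} M.

(* The rows of E form an orthonormal basis of the row space of W. *)
Definition orthonormal_basis n (B : 'M[R]_n) l (W : 'M[R]_(l, n))
    k (E : 'M[R]_(k, n)) : Prop :=
  E *m B *m E^T = 1%:M /\ (E :=: W)%MS.

(* tau, sqnorm_sff and mean_curvature do not depend on the basis chosen here. *)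
Definition onb n (B : 'M[R]_n) l (W : 'M[R]_(l, n)) k : 'M[R]_(k, n) :=
  xget 0 [set E | orthonormal_basis B W E].

Definition tau n (M : manifold n) (g : metric M) (x : M)
    l (W : 'M[R]_(l, n)) : R :=
  let E := onb (g x) W (\rank W) in
  \sum_(i < \rank W) \sum_(j < \rank W | (i < j)%N)
     sectional g x (row i E) (row j E).

Definition local_orthonormal_frame n (M : manifold n) (g : metric M) (x : M)
    (E : 'I_n -> vfield M) : Prop :=
  exists U : set M, [/\ open U, U x, forall i, smooth_vfield_on U (E i)
    & forall y, U y -> forall i j, bil (g y) (E i y) (E j y) = (i == j)%:R].

(* The value at x does not depend on the local orthonormal frame E around x.  *)
Definition laplacian n (M : manifold n) (g : metric M) (E : 'I_n -> vfield M)
    (f : sfield M) (x : M) : R :=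
  \sum_(i < n) (vder (nabla g (E i) (E i)) f x - vder (E i) (vder (E i) f) x).

Section Maps.
Variables (n : nat) (N : manifold n) (k : nat) (M : manifold k).
Variable F : N -> M.

Definition map_loc (x : N) : 'rV[R]_n -> 'rV[R]_k :=
  cfwd (chart_at (F x)) \o F \o point x.

Definition smooth_map : Prop :=
  continuous F /\
  forall x, smooth_on
    [set u | cimg (chart_at x) u /\ cdom (chart_at (F x)) (F (point x u))]
    (map_loc x).

(* dF_x sends v to v *m mdiff x. *)
Definition mdiff (x : N) : 'M[R]_(n, k) := jacobian (map_loc x) (coord x).

Definition pullback (g : metric M) : metric N :=
  fun x => mdiff x *m g (F x) *m (mdiff x)^T.

Definition isometric_immersion (gN : metric N) (gM : metric M) : Prop :=
  [/\ smooth_map, forall x, row_free (mdiff x)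
    & forall x, gN x = pullback gM x].

(* Gauss formula: h(u, v) = nablabar_u (dF V) - dF (nabla_u V), with V the    *)
(* extension of v that is constant in the coordinates of chart_at x.          *)
Definition second_fundamental_form (gN : metric N) (gM : metric M)
    (x : N) (u v : 'rV[R]_n) : 'rV[R]_k :=
  'D_u (fun q => 'D_v (map_loc x) q) (coord x)
  + christoffel (metric_loc gM (F x)) (coord (F x)) (u *m mdiff x) (v *m mdiff x)
  - christoffel (metric_loc gN x) (coord x) u v *m mdiff x.

Definition sqnorm_sff (gN : metric N) (gM : metric M) (x : N) : R :=
  let E := onb (gN x) 1%:M n in
  let h i j := second_fundamental_form gN gM x (row i E) (row j E) in
  \sum_(i < n) \sum_(j < n) bil (gM (F x)) (h i j) (h i j).

Definition mean_curvature (gN : metric N) (gM : metric M) (x : N) : 'rV[R]_k :=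
  let E := onb (gN x) 1%:M n in
  n%:R^-1 *:
    \sum_(i < n) second_fundamental_form gN gM x (row i E) (row i E).

Definition totally_geodesic (gM : metric M) : Prop :=
  forall x u v, second_fundamental_form (pullback gM) gM x u v = 0.

Definition totally_umbilical (gM : metric M) : Prop :=
  let gN := pullback gM in
  forall x u v, second_fundamental_form gN gM x u v =
    bil (gN x) u v *: mean_curvature gN gM x.

End Maps.

Section AlmostContact.
Variables (m : nat) (M : manifold (2 * m).+1).
Variables (phi : endo M) (xi : vfield M) (eta : form1 M) (g : metric M).

Definition almost_contact_metric : Prop :=
  [/\ [/\ smooth_manifold M, riemannian_metric g, smooth_endo phi,
          smooth_vfield_on setT xi & smooth_form1 eta],
      forall x, phi x *m phi x = - 1%:M + eta x *m xi x,
      forall x, xi x *m phi x = 0 /\ phi x *m eta x = 0,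
      forall x, (xi x *m eta x) 0 0 = 1
              /\ (forall v, (v *m eta x) 0 0 = bil (g x) v (xi x))
    & forall x v w, bil (g x) (v *m phi x) (w *m phi x) =
        bil (g x) v w - (v *m eta x) 0 0 * (w *m eta x) 0 0].

Definition nearly_trans_sasakian (alpha beta : sfield M) : Prop :=
  [/\ almost_contact_metric, smooth_fun alpha, smooth_fun beta
    & forall (U : set M) (X Y : vfield M), open U ->
        smooth_vfield_on U X -> smooth_vfield_on U Y ->
        forall x, U x ->
        let e (Z : vfield M) := (Z x *m eta x) 0 0 in
        nabla_endo g phi X Y x + nabla_endo g phi Y X x =
          alpha x *: ((2 * bil (g x) (X x) (Y x)) *: xi x
                      - e Y *: X x - e X *: Y x)
          - beta x *: (e Y *: app_endo phi X x + e X *: app_endo phi Y x)].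

End AlmostContact.

Definition warped_metric n1 n2 (N1 : manifold n1) (N2 : manifold n2)
    (f : sfield N1) (g1 : metric N1) (g2 : metric N2) :
    metric (prod_manifold N1 N2) :=
  fun x => block_mx (g1 x.1) 0 0 (f x.1 ^+ 2 *: g2 x.2).

(* The angle between v and the row space of W is that between v and its       *)
(* orthogonal projection w.                                                   *)
Definition angle_with n (B : 'M[R]_n) (v : 'rV[R]_n) l (W : 'M[R]_(l, n))
    (theta : R) : Prop :=
  exists w : 'rV[R]_n,
    [/\ (w <= W)%MS, forall z : 'rV[R]_n, (z <= W)%MS -> bil B (v - w) z = 0
      & theta = acos (Num.sqrt (bil B w w) / Num.sqrt (bil B v v))].

Section SemiSlant.
Variables (m : nat) (Mbar : manifold (2 * m).+1).
Variables (phi : endo Mbar) (xi : vfield Mbar) (gbar : metric Mbar).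
Variables (n1 n2 : nat) (NT : manifold n1) (Nth : manifold n2).
Let M := prod_manifold NT Nth.
Variable iota : M -> Mbar.

Definition TM (x : M) : 'M[R]_(n1 + n2, (2 * m).+1) := mdiff iota x.
Definition TNT (x : M) : 'M[R]_(n1, (2 * m).+1) := usubmx (TM x).
Definition TNth (x : M) : 'M[R]_(n2, (2 * m).+1) := dsubmx (TM x).

Definition invariant_factor : Prop :=
  forall x, (TNT x *m phi (iota x) <= TNT x)%MS.

Definition proper_slant_factor (theta : R) : Prop :=
  0 < theta < pi / 2 /\
  forall (x : M) (Z : 'rV[R]_(2 * m).+1),
    (Z <= TNth x)%MS -> Z != 0 -> (~ exists c : R, Z = c *: xi (iota x)) ->
    angle_with (gbar (iota x)) (Z *m phi (iota x)) (TNth x) theta.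

Definition warped_product_semi_slant (g1 : metric NT) (g2 : metric Nth)
    (f : sfield NT) (theta : R) : Prop :=
  [/\ [/\ smooth_manifold NT, smooth_manifold Nth,
          riemannian_metric g1 & riemannian_metric g2],
      smooth_fun f /\ (forall p, 0 < f p),
      isometric_immersion iota (warped_metric f g1 g2) gbar,
      forall x, (xi (iota x) <= TM x)%MS
    & invariant_factor /\ proper_slant_factor theta].

Definition leafT (q : Nth) : NT -> Mbar := fun p => iota (p, q).
Definition leafth (p : NT) : Nth -> Mbar := fun q => iota (p, q).

End SemiSlant.

End Manifold.

Arguments sfield {R n} M.
Arguments vfield {R n} M.
Arguments form1 {R n} M.
Arguments endo {R n} M.
Arguments metric {R n} M.

(* Main.v *)
Require Import Defs.
From HB Require Import structures.
From mathcomp Require Import all_boot all_order all_algebra.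
From mathcomp Require Import all_classical all_reals all_analysis.
From mathcomp Require Import ring lra zify.
(* Imported last, so that [point] is the inverse of a chart. *)
Require Import Defs.

(** Let e_i and w_a be orthonormal frames of N_T and N_theta. The difference
    tau(TM) - tau(TN_T) - tau(TN_theta) is the sum over i, a of the mixed
    sectional curvatures of the ambient manifold on e_i and w_a. By the Gauss
    equation each of them is the sectional curvature of M on the same plane plus
    |h(e_i, w_a)|^2 - <h(e_i, e_i), h(w_a, w_a)>. In a warped product the mixed
    sectional curvature is - Hess f (e_i, e_i) / f, so the intrinsic terms add up
    to n_2 (Laplacian of f) / f. Hence the right-hand side of the inequality is
    the sum of the |h(e_i, w_a)|^2 minus <tr_T h, tr_theta h>, and everything
    rests on the vanishing of tr_T h, the trace of h over the invariant factor.

    That vanishing is where the contact structure enters. The leaves of N_T are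
    totally geodesic in M and phi-invariant; differentiating phi X along X, for X
    tangent to N_T, and using that the identity at X = Y of a nearly
    trans-Sasakian manifold has its right-hand side tangent to N_T (because xi
    is), one finds that h(X, phi X) - phi h(X, X) is tangent to N_T. It is also
    normal to M, so h(X, phi X) = phi h(X, X) ([sff_invariant],
    [second_form_invariant]). Polarising this against xi and using
    phi^2 = - 1 + eta (x) xi gives h(X, xi) = 0 and
    h(phi X, phi X) = - h(X, X), and the trace over N_T is opposite to itself
    ([trace_sff_zero]).

    The two sides of the inequality therefore differ by half of
    sum |h(e_i, e_j)|^2 + sum |h(w_a, w_b)|^2 ([gap_identity]). This is
    nonnegative, and if it vanishes then h vanishes on each factor. The leaf of
    N_T is then totally geodesic in the ambient manifold since it is so in M, and
    the leaf of N_theta is totally umbilical since its second fundamental form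
    in M is - <.,.> grad f / f.

    All computations take place in one chart of M and one chart of the ambient
    manifold around a point. There the immersion is a map P between open sets and
    the metric of M is J G J^T, with J the Jacobian of P and G the ambient metric
    along P ([metric_loc_pullback]). The Gauss equation ([gauss]) comes from
    the covariant derivative of fields along P ([cov]), whose commutator is the
    ambient curvature ([cov_commutator]). *)

Set Implicit Arguments.
Unset Strict Implicit.
Unset Printing Implicit Defensive.

Import Order.TTheory GRing.Theory Num.Theory numFieldNormedType.Exports.

Local Open Scope classical_set_scope.
Local Open Scope ring_scope.

(** * Directional derivatives of matrix-valued functions *)

Section Calculus.
Context {R : realType} {V : normedModType R}.

(** The differential is chosen among the linear maps satisfying a condition on
    the germ of the function; its uniqueness makes the condition transferable. *)
Lemma near_eq_differentiable (W : normedModType R) (f g : V -> W) (a : V) :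
  (\near a, f a = g a) -> differentiable f a -> differentiable g a.
Proof.
move=> fg df; have [cdf /eqaddoP fE] := (diff_locallyP _ _).1 df.
have fga : f a = g a by exact: nbhs_singleton fg.
have gE : g \o shift a = cst (g a) + 'd f a +o_ 0 id.
  apply/eqaddoP => e e0; have := fE e e0; apply: filter_app.
  have : \forall x \near (0 : V), f (x + a) = g (x + a).
    by move: fg; rewrite (near_shift 0 a) /= subr0.
  apply: filter_app; near=> x => /= fgx.
  by rewrite -![(_ + _ : _ -> _) _]/(_ + _) -![(- _ : _ -> _) _]/(- _) /= fgx fga.
apply/diff_locallyP; rewrite (diff_unique cdf gE); split => //.
Unshelve. all: by end_near. Qed.

Lemma open_near_eq (W : Type) (U : set V) (f g : V -> W) (u : V) :
  open U -> U u -> (forall q, U q -> f q = g q) -> \near u, f u = g u.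
Proof.
move=> oU Uu fg; have : nbhs u U by exact: open_nbhs_nbhs.
by apply: filterS.
Qed.

Lemma differentiable_mx m n (A : V -> 'M[R]_(m, n)) u :
  differentiable A u <-> forall i j, differentiable (fun q => A q i j) u.
Proof.
split=> [dA i j|dA].
  exact: (differentiable_comp dA (differentiable_coord (A u) i j)).
have -> : A = \sum_i \sum_j (fun q => A q i j *: delta_mx i j).
  rewrite funeqE => q; rewrite [LHS]matrix_sum_delta fct_sumE.
  by apply: eq_bigr => i _; rewrite fct_sumE.
apply: differentiable_sum => i; apply: differentiable_sum => j.
exact: differentiableZl.
Qed.

Lemma derive_entry m n (A : V -> 'M[R]_(m, n)) u v i j :
  differentiable A u -> 'D_v A u i j = 'D_v (fun q => A q i j) u.
Proof. by move=> dA; rewrite derive_mx ?mxE//; exact: diff_derivable. Qed.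

Lemma differentiable_bigsum (W : normedModType R) I (r : seq I) (P : pred I) (f : I -> V -> W) u :
  (forall i, P i -> differentiable (f i) u) ->
  differentiable (fun q => \sum_(i <- r | P i) f i q) u.
Proof.
move=> df; rewrite (_ : (fun q => _) = \sum_(i <- r | P i) f i); last first.
  by rewrite funeqE => q; rewrite fct_sumE.
by elim/big_ind : _ => // g h; apply: differentiableD.
Qed.

Lemma derive_bigsum (W : normedModType R) I (r : seq I) (P : pred I) (f : I -> V -> W) u v :
  (forall i, P i -> differentiable (f i) u) ->
  'D_v (fun q => \sum_(i <- r | P i) f i q) u = \sum_(i <- r | P i) 'D_v (f i) u.
Proof.
move=> df; rewrite (_ : (fun q => _) = \sum_(i <- r | P i) f i); last first.
  by rewrite funeqE => q; rewrite fct_sumE.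
suff [] : differentiable (\sum_(i <- r | P i) f i) u /\
  'D_v (\sum_(i <- r | P i) f i) u = \sum_(i <- r | P i) 'D_v (f i) u by [].
elim/big_rec2 : _ => [|i g h Pi [dh hE]].
  by split; [exact: differentiable_cst|rewrite (derive_cst (0 : W))].
split; first by apply: differentiableD => //; exact: df.
by rewrite deriveD ?hE //; apply: diff_derivable => //; exact: df.
Qed.

Lemma differentiable_mulmx m n p (A : V -> 'M[R]_(m, n)) (B : V -> 'M[R]_(n, p)) u :
  differentiable A u -> differentiable B u ->
  differentiable (fun q => A q *m B q) u.
Proof.
move=> /differentiable_mx dA /differentiable_mx dB; apply/differentiable_mx=> i j.
rewrite (_ : (fun q => _) = fun q => \sum_k A q i k * B q k j); last first.
  by rewrite funeqE => q; rewrite mxE.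
by apply: differentiable_bigsum => k _; apply: differentiableM.
Qed.

Lemma derive_mulmx m n p (A : V -> 'M[R]_(m, n)) (B : V -> 'M[R]_(n, p)) u v :
  differentiable A u -> differentiable B u ->
  'D_v (fun q => A q *m B q) u = 'D_v A u *m B u + A u *m 'D_v B u.
Proof.
move=> dA dB; apply/matrixP => i j.
rewrite derive_entry; last exact: differentiable_mulmx.
rewrite (_ : (fun q => _) = fun q => \sum_k A q i k * B q k j); last first.
  by rewrite funeqE => q; rewrite mxE.
have dA' := (differentiable_mx A u).1 dA; have dB' := (differentiable_mx B u).1 dB.
rewrite derive_bigsum; last by move=> k _; apply: differentiableM.
rewrite !mxE -big_split; apply: eq_bigr => k _ /=.
rewrite (deriveM (diff_derivable (dA' i k)) (diff_derivable (dB' k j))).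
rewrite !derive_entry // addrC; congr (_ + _); exact: mulrC.
Qed.

Lemma differentiable_trmx m n (A : V -> 'M[R]_(m, n)) u :
  differentiable A u -> differentiable (fun q => (A q)^T) u.
Proof.
move=> /differentiable_mx dA; apply/differentiable_mx=> i j.
by under eq_fun do rewrite mxE; exact: dA.
Qed.

Lemma derive_trmx m n (A : V -> 'M[R]_(m, n)) u v :
  differentiable A u -> 'D_v (fun q => (A q)^T) u = ('D_v A u)^T.
Proof.
move=> dA; apply/matrixP => i j.
rewrite derive_entry; last exact: differentiable_trmx.
by under eq_fun do rewrite mxE; rewrite mxE derive_entry.
Qed.

Lemma differentiable_addfun (W : normedModType R) (f g : V -> W) u :
  differentiable f u -> differentiable g u ->
  differentiable (fun q => f q + g q) u.
Proof. exact: differentiableD. Qed.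

Lemma derive_addfun (W : normedModType R) (f g : V -> W) u v :
  differentiable f u -> differentiable g u ->
  'D_v (fun q => f q + g q) u = 'D_v f u + 'D_v g u.
Proof. by move=> df dg; apply: deriveD; exact: diff_derivable. Qed.

Lemma derive_subfun (W : normedModType R) (f g : V -> W) u v :
  differentiable f u -> differentiable g u ->
  'D_v (fun q => f q - g q) u = 'D_v f u - 'D_v g u.
Proof. by move=> df dg; apply: deriveB; exact: diff_derivable. Qed.

Lemma derive_mulfun (f g : V -> R) u v :
  differentiable f u -> differentiable g u ->
  'D_v (fun q => f q * g q) u = 'D_v f u * g u + f u * 'D_v g u.
Proof.
move=> df dg; have := @deriveM _ _ f g u v (diff_derivable df) (diff_derivable dg).
by rewrite addrC (mulrC ('D_v f u)).
Qed.

Lemma derive_scalefun m n (f : V -> R) (A : V -> 'M[R]_(m, n)) u v :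
  differentiable f u -> differentiable A u ->
  'D_v (fun q => f q *: A q) u = 'D_v f u *: A u + f u *: 'D_v A u.
Proof.
move=> df dA; have dA' := (differentiable_mx A u).1 dA.
have dfA i j : differentiable (fun q => (f q *: A q) i j) u.
  by under eq_fun do rewrite mxE; exact: differentiableM.
apply/matrixP => i j; rewrite derive_entry; last exact/differentiable_mx.
under eq_fun do rewrite mxE.
by rewrite derive_mulfun // !mxE derive_entry.
Qed.

Lemma derive_compfun (W Z : normedModType R) (g : V -> W) (f : W -> Z) u v :
  differentiable g u -> differentiable f (g u) ->
  'D_v (fun q => f (g q)) u = 'D_('D_v g u) f (g u).
Proof.
move=> dg df; rewrite (deriveE v (differentiable_comp dg df)).
by rewrite diff_comp //= !deriveE.
Qed.

Lemma derive_bil n (B : V -> 'M[R]_n) (X Y : V -> 'rV[R]_n) u v :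
  differentiable B u -> differentiable X u -> differentiable Y u ->
  'D_v (fun q => bil (B q) (X q) (Y q)) u =
  bil ('D_v B u) (X u) (Y u) + bil (B u) ('D_v X u) (Y u) + bil (B u) (X u) ('D_v Y u).
Proof.
move=> dB dX dY; rewrite /bil.
have dXB := differentiable_mulmx dX dB; have dYT := differentiable_trmx dY.
rewrite -derive_entry; last exact: differentiable_mulmx.
rewrite derive_mulmx // derive_mulmx // derive_trmx // mulmxDl.
by rewrite [LHS]mxE [in LHS]mxE (addrC ((_ *m _) 0 0)).
Qed.

End Calculus.

(** * Stability of smoothness *)

Section SmoothClosure.
Context {R : realType} {n : nat}.
Implicit Types (U : set 'rV[R]_n).

Lemma Ck_eq k (W : normedModType R) U (f g : 'rV[R]_n -> W) : open U ->
  (forall u, U u -> f u = g u) -> Ck k U f -> Ck k U g.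
Proof.
move=> oU; elim: k f g => [|k IH] f g fg /=.
  move=> cf u Uu; rewrite /prop_for /continuous_at -(fg u Uu).
  exact: (cvg_trans (near_eq_cvg (F := nbhs u) (open_near_eq oU Uu fg)) (cf u Uu)).
move=> [df DfC]; split=> [u Uu|v].
  by apply: (near_eq_differentiable (f := f)); [exact: (open_near_eq oU Uu fg)|exact: df].
apply: IH (DfC v) => u Uu; apply: near_eq_derive; exact: (open_near_eq oU Uu fg).
Qed.

Lemma Ck_pred k (W : normedModType R) U (f : 'rV[R]_n -> W) : Ck k.+1 U f -> Ck k U f.
Proof.
elim: k f => [|k IH] f [df DfC].
  by move=> u Uu; apply: differentiable_continuous; exact: df.
by split=> // v; apply: IH.
Qed.

Lemma Ck_cst k (W : normedModType R) U (c : W) : Ck k U (fun=> c).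
Proof.
elim: k W c => [|k IH] W c /=; first by move=> u _; exact: cst_continuous.
split=> [u _|v]; first exact: differentiable_cst.
by under eq_fun do rewrite (derive_cst c); apply: IH.
Qed.

Lemma Ck_add k (W : normedModType R) U (f g : 'rV[R]_n -> W) : open U ->
  Ck k U f -> Ck k U g -> Ck k U (fun u => f u + g u).
Proof.
move=> oU; elim: k f g => [|k IH] f g /=.
  by move=> cf cg u Uu; exact: (continuousD (cf u Uu) (cg u Uu)).
move=> [df Df] [dg Dg]; split=> [u Uu|v].
  by apply: differentiable_addfun; [exact: df|exact: dg].
apply: (Ck_eq oU) (IH _ _ (Df v) (Dg v)) => u Uu /=.
by rewrite derive_addfun //; [exact: df|exact: dg].
Qed.

Lemma Ck_mul k U (f g : 'rV[R]_n -> R) : open U ->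
  Ck k U f -> Ck k U g -> Ck k U (fun u => f u * g u).
Proof.
move=> oU; elim: k f g => [|k IH] f g /=.
  by move=> cf cg u Uu; exact: (continuousM (cf u Uu) (cg u Uu)).
move=> [df Df] [dg Dg]; split=> [u Uu|v].
  by apply: differentiableM; [exact: df|exact: dg].
have cf : Ck k U f by exact: Ck_pred.
have cg : Ck k U g by exact: Ck_pred.
apply: (Ck_eq oU) (Ck_add oU (IH _ _ (Df v) cg) (IH _ _ cf (Dg v))) => u Uu /=.
by rewrite derive_mulfun //; [exact: df|exact: dg].
Qed.

Lemma Ck_inv k U (f : 'rV[R]_n -> R) : open U -> (forall u, U u -> f u != 0) ->
  Ck k U f -> Ck k U (fun u => (f u)^-1).
Proof.
move=> oU f0; elim: k => [|k IH].
  by move=> cf u Uu; exact: (continuousV (f0 u Uu) (cf u Uu)).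
move=> Cf; have [df Df] := Cf; split=> [u Uu|v].
  by apply: differentiableV; [exact: df|exact: f0].
have iC : Ck k U (fun u => (f u)^-1) by apply/IH/Ck_pred.
have := Ck_mul oU (Ck_mul oU iC iC) (Ck_mul oU (Ck_cst k U (-1 : R)) (Df v)).
apply: (Ck_eq oU) => u Uu /=.
rewrite (@deriveV _ _ f); [|exact: f0|by apply: diff_derivable; exact: df].
by rewrite mulN1r mulrN -expr2 exprVn scaleNr.
Qed.

Lemma Ck_sum k (W : normedModType R) U I (r : seq I) (P : pred I) (f : I -> 'rV[R]_n -> W) : open U ->
  (forall i, P i -> Ck k U (f i)) -> Ck k U (fun u => \sum_(i <- r | P i) f i u).
Proof.
move=> oU Cf; elim: r => [|i r IH].
  by under eq_fun do rewrite big_nil; exact: Ck_cst.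
under eq_fun do rewrite big_cons; case: (boolP (P i)) => // Pi.
by apply: Ck_add => //; exact: Cf.
Qed.

Lemma Ck_prod k U I (r : seq I) (P : pred I) (f : I -> 'rV[R]_n -> R) : open U ->
  (forall i, P i -> Ck k U (f i)) -> Ck k U (fun u => \prod_(i <- r | P i) f i u).
Proof.
move=> oU Cf; elim: r => [|i r IH].
  by under eq_fun do rewrite big_nil; exact: Ck_cst.
under eq_fun do rewrite big_cons; case: (boolP (P i)) => // Pi.
by apply: Ck_mul => //; exact: Cf.
Qed.

Lemma continuous_mx (T : topologicalType) p q (A : T -> 'M[R]_(p, q)) u :
  {for u, continuous A} <-> forall i j, {for u, continuous (fun x => A x i j)}.
Proof.
split=> [cA i j|cA].
  exact: (@continuous_comp _ _ _ A (fun M : 'M[R]_(p, q) => M i j) u cA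
    (@coord_continuous _ _ _ _ _ _)).
apply/cvgrPdist_lt => e e0; near=> x.
rewrite [ltLHS]/Num.Def.normr/= mx_normrE.
apply: bigmax_lt => //= i _; rewrite !mxE.
move: i; near: x; apply: filter_forall => /= i.
exact: ((cvgrPdist_lt _ _).1 (cA i.1 i.2) e e0).
Unshelve. all: by end_near. Qed.

Lemma Ck_mx k U p q (A : 'rV[R]_n -> 'M[R]_(p, q)) : open U ->
  Ck k U A <-> forall i j, Ck k U (fun u => A u i j).
Proof.
move=> oU; elim: k A => [|k IH] A /=.
  split=> [cA i j u Uu|cA u Uu]; first by apply: (continuous_mx _ _).1; exact: cA.
  by apply/continuous_mx => i j; exact: cA.
split=> [[dA DA] i j|cA].
  split=> [u Uu|v]; first by apply: (differentiable_mx _ _).1; exact: dA.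
  apply: (Ck_eq oU) ((IH _).1 (DA v) i j) => u Uu.
  by rewrite derive_entry //; exact: dA.
have dA u : U u -> differentiable A u.
  by move=> Uu; apply/differentiable_mx => i j; have [d _] := cA i j; exact: d.
split=> // v; apply/IH => i j; have [_ /(_ v)] := cA i j.
by apply: (Ck_eq oU) => u Uu; rewrite derive_entry //; exact: dA.
Qed.

End SmoothClosure.

Section CkComp.
Context {R : realType} {n p : nat}.

Lemma derive_linear_comb (f : 'rV[R]_p -> R) (w u : 'rV[R]_p) :
  differentiable f u -> 'D_w f u = \sum_i w 0 i * 'D_(delta_mx 0 i) f u.
Proof.
move=> df; rewrite deriveE // {1}(row_sum_delta w) linear_sum.
by apply: eq_bigr => i _; rewrite linearZ deriveE.
Qed.

(** By the chain rule a derivative of f o g is a sum of products of a derivative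
    of a component of g with (a partial derivative of f) o g, of lower order. *)
Lemma Ck_comp_scalar k (U : set 'rV[R]_n) (W : set 'rV[R]_p) (g : 'rV[R]_n -> 'rV[R]_p)
    (f : 'rV[R]_p -> R) : open U ->
  (forall u, U u -> W (g u)) -> Ck k U g -> Ck k W f -> Ck k U (fun u => f (g u)).
Proof.
move=> oU UW; elim: k f => [|k IH] f.
  move=> cg cf u Uu; exact: (continuous_comp (cg u Uu) (cf (g u) (UW u Uu))).
move=> Cg [df Df]; have [dg Dg] := Cg; split=> [u Uu|v].
  by apply: differentiable_comp; [exact: dg|apply: df; exact: UW].
have C i : Ck k U (fun u => ('D_v g u) 0 i * 'D_(delta_mx 0 i) f (g u)).
  apply: Ck_mul => //; first exact: (Ck_mx k ('D_v g) oU).1 (Dg v) 0 i.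
  exact: (IH ('D_(delta_mx 0 i) f) (Ck_pred Cg) (Df _)).
apply: (Ck_eq oU) (Ck_sum (index_enum _) (P := xpredT) oU (fun i _ => C i)) => u Uu.
rewrite (derive_compfun _ (dg u Uu) (df (g u) (UW u Uu))).
by rewrite derive_linear_comb //; apply: df; exact: UW.
Qed.

Lemma Ck_coord k (U : set 'rV[R]_n) i j : open U -> Ck k U (fun u => u i j : R).
Proof.
case: k => [|k] oU; first by move=> u _; exact: coord_continuous.
split=> [u Uu|v]; first exact: differentiable_coord.
have E (u : 'rV[R]_n) : 'D_v (fun q : 'rV[R]_n => q i j : R) u = v i j.
  by rewrite -(@derive_entry _ _ _ _ id) ?derive_id.
by under eq_fun do rewrite E; exact: Ck_cst.
Qed.

End CkComp.

Section Smooth.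
Context {R : realType} {n : nat} {U : set 'rV[R]_n} (oU : open U).

Lemma smooth_eq (W : normedModType R) (f g : 'rV[R]_n -> W) :
  (forall u, U u -> f u = g u) -> smooth_on U f -> smooth_on U g.
Proof. by move=> fg sf k; apply: (Ck_eq oU fg (sf k)). Qed.

Lemma smooth_diff (W : normedModType R) (f : 'rV[R]_n -> W) u :
  smooth_on U f -> U u -> differentiable f u.
Proof. by move=> /(_ 1%N) [df _]; exact: df. Qed.

Lemma smooth_derive (W : normedModType R) (f : 'rV[R]_n -> W) v :
  smooth_on U f -> smooth_on U ('D_v f).
Proof. by move=> sf k; have [_ /(_ v)] := sf k.+1. Qed.

Lemma smooth_cst (W : normedModType R) (c : W) : smooth_on U (fun=> c).
Proof. by move=> k; exact: Ck_cst. Qed.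

Lemma smooth_add (W : normedModType R) (f g : 'rV[R]_n -> W) :
  smooth_on U f -> smooth_on U g -> smooth_on U (fun u => f u + g u).
Proof. by move=> sf sg k; exact: Ck_add. Qed.

Lemma smooth_mul (f g : 'rV[R]_n -> R) :
  smooth_on U f -> smooth_on U g -> smooth_on U (fun u => f u * g u).
Proof. by move=> sf sg k; exact: Ck_mul. Qed.

Lemma smooth_inv (f : 'rV[R]_n -> R) : (forall u, U u -> f u != 0) ->
  smooth_on U f -> smooth_on U (fun u => (f u)^-1).
Proof. by move=> f0 sf k; exact: Ck_inv. Qed.

Lemma smooth_sum (W : normedModType R) I (r : seq I) (P : pred I) (f : I -> 'rV[R]_n -> W) :
  (forall i, smooth_on U (f i)) -> smooth_on U (fun u => \sum_(i <- r | P i) f i u).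
Proof. by move=> sf k; apply: Ck_sum => // i _; exact: sf. Qed.

Lemma smooth_prod I (r : seq I) (P : pred I) (f : I -> 'rV[R]_n -> R) :
  (forall i, smooth_on U (f i)) -> smooth_on U (fun u => \prod_(i <- r | P i) f i u).
Proof. by move=> sf k; apply: Ck_prod => // i _; exact: sf. Qed.

Lemma smooth_mx p q (A : 'rV[R]_n -> 'M[R]_(p, q)) :
  smooth_on U A <-> forall i j, smooth_on U (fun u => A u i j).
Proof.
split=> [sA i j k|sA k]; first exact: (Ck_mx k A oU).1 (sA k) i j.
by apply/(Ck_mx k A oU) => i j; exact: sA.
Qed.

Lemma smooth_entry p q (A : 'rV[R]_n -> 'M[R]_(p, q)) i j :
  smooth_on U A -> smooth_on U (fun u => A u i j).
Proof. by move=> /smooth_mx. Qed.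

Lemma smooth_coord i j : smooth_on U (fun u => u i j : R).
Proof. by move=> k; exact: Ck_coord. Qed.

Lemma smooth_id : smooth_on U (@id 'rV[R]_n).
Proof. by apply/smooth_mx => i j; exact: smooth_coord. Qed.

Lemma smooth_scale p q (f : 'rV[R]_n -> R) (A : 'rV[R]_n -> 'M[R]_(p, q)) :
  smooth_on U f -> smooth_on U A -> smooth_on U (fun u => f u *: A u).
Proof.
move=> sf sA; apply/smooth_mx => i j; under eq_fun do rewrite mxE.
by apply: smooth_mul => //; exact: smooth_entry.
Qed.

Lemma smooth_opp p q (A : 'rV[R]_n -> 'M[R]_(p, q)) :
  smooth_on U A -> smooth_on U (fun u => - A u).
Proof.
move=> sA; under eq_fun do rewrite -scaleN1r.
by apply: smooth_scale => //; exact: smooth_cst.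
Qed.

Lemma smooth_sub p q (A B : 'rV[R]_n -> 'M[R]_(p, q)) :
  smooth_on U A -> smooth_on U B -> smooth_on U (fun u => A u - B u).
Proof. by move=> sA sB; apply: smooth_add => //; exact: smooth_opp. Qed.

Lemma smooth_mulmx p q r (A : 'rV[R]_n -> 'M[R]_(p, q)) (B : 'rV[R]_n -> 'M[R]_(q, r)) :
  smooth_on U A -> smooth_on U B -> smooth_on U (fun u => A u *m B u).
Proof.
move=> sA sB; apply/smooth_mx => i j; under eq_fun do rewrite mxE.
by apply: smooth_sum => k; apply: smooth_mul; exact: smooth_entry.
Qed.

Lemma smooth_trmx p q (A : 'rV[R]_n -> 'M[R]_(p, q)) :
  smooth_on U A -> smooth_on U (fun u => (A u)^T).
Proof.
by move=> sA; apply/smooth_mx => i j; under eq_fun do rewrite mxE; exact: smooth_entry.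
Qed.

Lemma smooth_bil p (B : 'rV[R]_n -> 'M[R]_p) (X Y : 'rV[R]_n -> 'rV[R]_p) :
  smooth_on U B -> smooth_on U X -> smooth_on U Y ->
  smooth_on U (fun u => bil (B u) (X u) (Y u)).
Proof.
move=> sB sX sY; apply: (smooth_entry (A := fun u => X u *m B u *m (Y u)^T)).
by apply: smooth_mulmx; [exact: smooth_mulmx|exact: smooth_trmx].
Qed.

Lemma smooth_det p (A : 'rV[R]_n -> 'M[R]_p) :
  smooth_on U A -> smooth_on U (fun u => \det (A u)).
Proof.
move=> sA; rewrite /determinant; apply: smooth_sum => s.
apply: smooth_mul; first exact: smooth_cst.
by apply: smooth_prod => i; exact: smooth_entry.
Qed.

(** Cramer's rule expresses the inverse by determinants. *)
Lemma smooth_invmx p (A : 'rV[R]_n -> 'M[R]_p) : (forall u, U u -> A u \in unitmx) ->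
  smooth_on U A -> smooth_on U (fun u => invmx (A u)).
Proof.
move=> uA sA; apply: (@smooth_eq _ (fun u => (\det (A u))^-1 *: \adj (A u))).
  by move=> u Uu; rewrite /invmx uA.
apply: smooth_scale.
  apply: smooth_inv; last exact: smooth_det.
  by move=> u /uA; rewrite unitmxE unitfE.
apply/smooth_mx => i j; under eq_fun do rewrite mxE /cofactor.
apply: smooth_mul; first exact: smooth_cst.
apply: smooth_det; apply/smooth_mx => k l.
by under eq_fun do rewrite !mxE; exact: smooth_entry.
Qed.

Lemma smooth_comp_scalar p (W : set 'rV[R]_p) (g : 'rV[R]_n -> 'rV[R]_p) (f : 'rV[R]_p -> R) :
  (forall u, U u -> W (g u)) -> smooth_on U g -> smooth_on W f -> smooth_on U (fun u => f (g u)).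
Proof. by move=> UW sg sf k; exact: (Ck_comp_scalar oU UW). Qed.

End Smooth.

Lemma smooth_comp (R : realType) n p (U : set 'rV[R]_n) (W : set 'rV[R]_p) q r (g : 'rV[R]_n -> 'rV[R]_p)
    (f : 'rV[R]_p -> 'M[R]_(q, r)) : open U -> open W ->
  (forall u, U u -> W (g u)) -> smooth_on U g -> smooth_on W f -> smooth_on U (fun u => f (g u)).
Proof.
move=> oU oW UW sg sf; apply/(smooth_mx oU) => i j.
by apply: (smooth_comp_scalar oU UW sg (f := fun y => f y i j)); exact: smooth_entry.
Qed.

(** * Symmetry of second derivatives *)

Section Schwarz.
Context {R : realType} {n : nat}.

Lemma MVT_line (f : 'rV[R]_n -> R) (a v : 'rV[R]_n) (h : R) : 0 < h ->
  (forall t, 0 <= t <= h -> differentiable f (a + t *: v)) ->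
  exists2 c, 0 < c < h & f (a + h *: v) - f a = h * 'D_v f (a + c *: v).
Proof.
move=> h0 df; pose g t := f (a + t *: v).
have dl t : differentiable (fun t : R => a + t *: v) t.
  by apply: differentiable_addfun; [exact: differentiable_cst|exact: differentiableZl].
have Dl t : 'D_1 (fun t : R => a + t *: v) t = v.
  rewrite derive_addfun; [|exact: differentiable_cst|exact: differentiableZl].
  by rewrite (derive_cst a) add0r deriveE ?diffZl //= diff_val scale1r.
have gd t : 0 <= t <= h -> differentiable g t.
  by move=> th; apply: (differentiable_comp (dl t)); exact: df.
have [||c] := @MVT R g (fun t => 'D_v f (a + t *: v)) 0 h h0.
- move=> t; rewrite in_itv /= => /andP[t0 th]; have tt : 0 <= t <= h by rewrite !ltW.
  split; first exact/diff_derivable/gd.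
  by rewrite derive_compfun ?Dl //; exact: df.
- by apply/continuous_in_subspaceT => t /set_mem; rewrite /= in_itv /= => tt; apply: differentiable_continuous; exact: gd.
- rewrite in_itv /= => c0h; rewrite /g scale0r addr0 subr0 => ->; exists c => //.
  by rewrite mulrC.
Qed.

(** By the mean value theorem along w and then along v, the mixed second
    difference is h^2 times a value of D_v D_w f at a point close to u. *)
Lemma second_difference (f : 'rV[R]_n -> R) (U : set 'rV[R]_n) (u v w : 'rV[R]_n) (e : R) :
  open U -> U u -> smooth_on U f -> 0 < e ->
  \forall h \near 0^'+,
    `|f (u + h *: w + h *: v) - f (u + h *: w) - (f (u + h *: v) - f u) - h ^+ 2 * 'D_v ('D_w f) u|
    <= e * h ^+ 2.
Proof.
move=> oU Uu sf e0.
have sw := smooth_derive w sf; have svw := smooth_derive v sw.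
have [r /= r0 rU] : nbhs_ball u [set q | U q /\ `|'D_v ('D_w f) u - 'D_v ('D_w f) q| < e].
  apply/nbhs_ballP; apply: filterI; first exact: open_nbhs_nbhs.
  exact: (cvgrPdist_lt _ _).1 (differentiable_continuous (smooth_diff svw Uu)) e e0.
have inB s t h : 0 <= s <= h -> 0 <= t <= h -> h * (`|v| + `|w|) < r ->
    ball u r (u + s *: w + t *: v).
  move=> /andP[s0 sh] /andP[t0 th] hr; rewrite -ball_normE /=.
  rewrite -addrA opprD addNKr normrN.
  apply: le_lt_trans hr; apply: (le_trans (ler_normD _ _)).
  by rewrite !normrZ !ger0_norm // addrC mulrDr lerD // ler_wpM2r.
have k0 : 0 < r / (`|v| + `|w| + 1) by rewrite divr_gt0 // ltr_wpDl // addr_ge0.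
near=> h.
have h0 : 0 < h by near: h; exact: nbhs_right_gt.
have hr : h * (`|v| + `|w|) < r.
  have : h < r / (`|v| + `|w| + 1) by near: h; exact: nbhs_right_lt.
  rewrite ltr_pdivlMr; last by rewrite ltr_wpDl // addr_ge0.
  by apply: le_lt_trans; rewrite ler_wpM2l ?(ltW h0) // lerDl ler01.
pose g q := f (q + h *: v) - f q.
have sub t (B : 'rV[R]_n) : differentiable (fun q : 'rV[R]_n => q + B) t.
  by apply: differentiable_addfun => //; exact: differentiable_cst.
have dg t : 0 <= t <= h -> differentiable (fun q => f (q + h *: v)) (u + t *: w) /\ differentiable f (u + t *: w).
  move=> th; split.
    apply: (differentiable_comp (sub _ _)); apply: (smooth_diff sf).
    by have [] := rU _ (inB t h h th _ hr); rewrite ?lexx ?ltW.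
  apply: (smooth_diff sf); rewrite -[_ + _]addr0 -(scale0r v).
  by have [] := rU _ (inB t 0 h th _ hr); rewrite ?lexx ?ltW.
have [c /andP[c0 ch] gc] := @MVT_line g u w h h0 (fun t th => differentiableB (dg t th).1 (dg t th).2).
have cc : 0 <= c <= h by rewrite !ltW.
have [|d /andP[d0 dh] fd] := @MVT_line ('D_w f) (u + c *: w) v h h0.
  move=> t th; apply: (smooth_diff sw).
  by have [] := rU _ (inB c t h cc th hr).
have gE : 'D_w g (u + c *: w) = h * 'D_v ('D_w f) (u + c *: w + d *: v).
  rewrite -fd /g derive_subfun; [|exact: (dg c cc).1|exact: (dg c cc).2].
  rewrite (derive_compfun (g := fun q => q + h *: v) (f := f)) //; last first.
    apply: (smooth_diff sf).
    by have [] := rU _ (inB c h h cc _ hr); rewrite ?lexx ?ltW.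
  rewrite derive_addfun; [|by []|exact: differentiable_cst].
  by rewrite (derive_cst (h *: v)) addr0 derive_id.
have -> : f (u + h *: w + h *: v) - f (u + h *: w) - (f (u + h *: v) - f u) = h * (h * 'D_v ('D_w f) (u + c *: w + d *: v)).
  by rewrite -gE -gc.
rewrite mulrA -expr2 -mulrBr normrM ger0_norm ?sqr_ge0 // mulrC ler_wpM2r ?sqr_ge0 //.
have dd : 0 <= d <= h by rewrite !ltW.
have [_ /ltW] := rU _ (inB c d h cc dd hr).
by move: ('D_v ('D_w f) u) ('D_v ('D_w f) _) => x y; rewrite distrC.
Unshelve. all: by end_near. Qed.

(** The second difference is symmetric in v and w, so both iterated derivatives
    are its limit after division by h^2. *)
Lemma schwarz_scalar (f : 'rV[R]_n -> R) (U : set 'rV[R]_n) (u v w : 'rV[R]_n) :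
  open U -> U u -> smooth_on U f -> 'D_v ('D_w f) u = 'D_w ('D_v f) u.
Proof.
move=> oU Uu sf; apply/eqP; rewrite -subr_eq0 -normr_le0; apply/ler_addgt0Pl => e e0.
rewrite addr0; have e2 : 0 < e / 2 by rewrite divr_gt0.
have A0 := @second_difference f U u v w (e / 2) oU Uu sf e2.
have B0 := @second_difference f U u w v (e / 2) oU Uu sf e2.
have F := @filterI _ _ (at_right_proper_filter (0 : R)) _ _ (@filterI _ _ (at_right_proper_filter (0 : R)) _ _ (nbhs_right_gt (0 : R)) A0) B0.
have [h [[h0 A] B]] := filter_ex F.
have {}h0 : 0 < h by [].
have h2 : 0 < h ^+ 2 by rewrite exprn_gt0.
have aux (x1 x2 x3 x4 a b d k : R) : 0 < d -> `|x1 - x2 - (x3 - x4) - d * a| <= k / 2 * d ->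
    `|x1 - x3 - (x2 - x4) - d * b| <= k / 2 * d -> `|a - b| <= k.
  move=> d0 Ha Hb; rewrite -(ler_pM2l d0) -{1}(ger0_norm (ltW d0)) -normrM.
  apply: le_trans (_ : _ <= k / 2 * d + k / 2 * d) _; last by rewrite -mulrDl -splitr mulrC.
  have -> : d * (a - b) = (x1 - x3 - (x2 - x4) - d * b) - (x1 - x2 - (x3 - x4) - d * a) by ring.
  by apply: le_trans (ler_normB _ _) _; rewrite addrC lerD.
by apply: (aux _ _ _ _ _ _ _ _ h2 A); rewrite (addrAC u).
Qed.

End Schwarz.

(** * Locked forms of the differential operators *)

Fact der_key : unit. Proof. exact: tt. Qed.

Section Sealed.
Context {R : realType}.

(** Comparing two distinct derivatives, connections or curvatures must not unfold
    the limits inside them: the operators are locked, and their rules restated. *)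
Definition der_def (V W : normedModType R) (v : V) (f : V -> W) (u : V) : W := 'D_v f u.
Definition der (V W : normedModType R) := locked_with der_key (@der_def V W).
Lemma derE (V W : normedModType R) (v : V) (f : V -> W) : der v f = 'D_v f.
Proof. by rewrite /der unlock. Qed.
Lemma derxE (V W : normedModType R) (v u : V) (f : V -> W) : der v f u = derive f u v.
Proof. by rewrite derE. Qed.

Definition chr_def n := @christoffel R n.
Definition chr n := locked_with der_key (@chr_def n).
Lemma chrE n (G : 'rV[R]_n -> 'M[R]_n) : chr G = christoffel G.
Proof. by rewrite /chr unlock. Qed.

Definition rie_def n := @riemann R n.
Definition rie n := locked_with der_key (@rie_def n).
Lemma rieE n (G : 'rV[R]_n -> 'M[R]_n) : rie G = riemann G.
Proof. by rewrite /rie unlock. Qed.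

Definition jac_def n p (f : 'rV[R]_n -> 'rV[R]_p) := jacobian f.
Definition jac n p := locked_with der_key (@jac_def n p).
Lemma jacE n p (f : 'rV[R]_n -> 'rV[R]_p) : jac f = jacobian f.
Proof. by rewrite /jac unlock. Qed.

Section Rules.
Context {V : normedModType R}.
Implicit Types u v : V.

Lemma der_cst (W : normedModType R) (c : W) u v : der v (fun=> c) u = 0.
Proof. by rewrite derE; exact: derive_cst. Qed.

Lemma der_id u v : der v id u = v.
Proof. by rewrite derE; exact: derive_id. Qed.

Lemma der_eq (W : normedModType R) (U : set V) (f g : V -> W) u v :
  open U -> U u -> (forall q, U q -> f q = g q) -> der v f u = der v g u.
Proof. by move=> oU Uu fg; rewrite !derE; exact: near_eq_derive (open_near_eq oU Uu fg). Qed.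

Lemma der_addf (W : normedModType R) (f g : V -> W) u v :
  differentiable f u -> differentiable g u ->
  der v (fun q => f q + g q) u = der v f u + der v g u.
Proof. by rewrite !derE; exact: derive_addfun. Qed.

Lemma der_mul (f g : V -> R) u v :
  differentiable f u -> differentiable g u ->
  der v (fun q => f q * g q) u = der v f u * g u + f u * der v g u.
Proof. by rewrite !derE; exact: derive_mulfun. Qed.

Lemma der_scale m n (f : V -> R) (A : V -> 'M[R]_(m, n)) u v :
  differentiable f u -> differentiable A u ->
  der v (fun q => f q *: A q) u = der v f u *: A u + f u *: der v A u.
Proof. by rewrite !derE; exact: derive_scalefun. Qed.

Lemma der_scalec (W : normedModType R) a (f : V -> W) u v :
  differentiable f u -> der v (fun q => a *: f q) u = a *: der v f u.
Proof. by move=> df; rewrite !derE; apply: deriveZ; exact: diff_derivable. Qed.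

Lemma der_mulmx m n p (A : V -> 'M[R]_(m, n)) (B : V -> 'M[R]_(n, p)) u v :
  differentiable A u -> differentiable B u ->
  der v (fun q => A q *m B q) u = der v A u *m B u + A u *m der v B u.
Proof. by rewrite !derE; exact: derive_mulmx. Qed.

Lemma der_trmx m n (A : V -> 'M[R]_(m, n)) u v :
  differentiable A u -> der v (fun q => (A q)^T) u = (der v A u)^T.
Proof. by rewrite !derE; exact: derive_trmx. Qed.

Lemma der_entry m n (A : V -> 'M[R]_(m, n)) u v i j :
  differentiable A u -> der v A u i j = der v (fun q => A q i j) u.
Proof. by rewrite !derE; exact: derive_entry. Qed.

Lemma der_bigsum (W : normedModType R) I (r : seq I) (P : pred I) (f : I -> V -> W) u v :
  (forall i, P i -> differentiable (f i) u) ->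
  der v (fun q => \sum_(i <- r | P i) f i q) u = \sum_(i <- r | P i) der v (f i) u.
Proof.
by move=> df; rewrite !derE derive_bigsum //; apply: eq_bigr => i _; rewrite derE.
Qed.

Lemma der_comp (W Z : normedModType R) (g : V -> W) (f : W -> Z) u v :
  differentiable g u -> differentiable f (g u) ->
  der v (fun q => f (g q)) u = der (der v g u) f (g u).
Proof. by rewrite !derE; exact: derive_compfun. Qed.

Lemma der_bil n (B : V -> 'M[R]_n) (X Y : V -> 'rV[R]_n) u v :
  differentiable B u -> differentiable X u -> differentiable Y u ->
  der v (fun q => bil (B q) (X q) (Y q)) u =
  bil (der v B u) (X u) (Y u) + bil (B u) (der v X u) (Y u) + bil (B u) (X u) (der v Y u).
Proof. by rewrite !derE; exact: derive_bil. Qed.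

Lemma der_linear (W : normedModType R) (f : V -> W) a v w u : differentiable f u ->
  der (a *: v + w) f u = a *: der v f u + der w f u.
Proof. by move=> df; rewrite !derE !deriveE // linearP. Qed.
End Rules.

Lemma der_jac n p (f : 'rV[R]_n -> 'rV[R]_p) u v :
  differentiable f u -> der v f u = v *m jac f u.
Proof. by move=> df; rewrite derE jacE deriveEjacobian. Qed.

Lemma der_sum_delta n (W : normedModType R) (f : 'rV[R]_n -> W) u v :
  differentiable f u -> der v f u = \sum_i v 0 i *: der (delta_mx 0 i) f u.
Proof.
move=> df; rewrite derE deriveE // {1}(row_sum_delta v) linear_sum.
by apply: eq_bigr => i _; rewrite linearZ derE deriveE.
Qed.

Lemma smooth_der n (U : set 'rV[R]_n) (W : normedModType R) (f : 'rV[R]_n -> W) v :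
  smooth_on U f -> smooth_on U (der v f).
Proof. by move=> sf; rewrite derE; exact: smooth_derive. Qed.

Lemma schwarz n p q (A : 'rV[R]_n -> 'M[R]_(p, q)) (U : set 'rV[R]_n) (u v w : 'rV[R]_n) :
  open U -> U u -> smooth_on U A -> der v (der w A) u = der w (der v A) u.
Proof.
move=> oU Uu sA; apply/matrixP => i j.
have sij := smooth_entry oU i j sA.
have E z y : der y (der z A) u i j = der y (der z (fun u => A u i j)) u.
  rewrite der_entry; last exact: smooth_diff (smooth_der z sA) Uu.
  apply: (der_eq _ oU Uu) => x Ux.
  by rewrite der_entry //; exact: smooth_diff sA Ux.
rewrite (E w v) (E v w) !derE; exact: (schwarz_scalar v w oU Uu sij).
Qed.

Lemma schwarz_fun n (f : 'rV[R]_n -> R) (U : set 'rV[R]_n) (u v w : 'rV[R]_n) :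
  open U -> U u -> smooth_on U f -> der v (der w f) u = der w (der v f) u.
Proof. by move=> oU Uu sf; rewrite !derE; exact: (schwarz_scalar v w oU Uu sf). Qed.

End Sealed.

(** * Bilinear forms *)

Section Bil.
Context {R : realType} {n : nat}.
Implicit Types (B : 'M[R]_n) (v w : 'rV[R]_n).

Lemma bilDl B v v' w : bil B (v + v') w = bil B v w + bil B v' w.
Proof. by rewrite /bil !mulmxDl mxE. Qed.
Lemma bilDr B v w w' : bil B v (w + w') = bil B v w + bil B v w'.
Proof. by rewrite /bil linearD mulmxDr mxE. Qed.
Lemma bilZl B a v w : bil B (a *: v) w = a * bil B v w.
Proof. by rewrite /bil -!scalemxAl mxE. Qed.
Lemma bilZr B a v w : bil B v (a *: w) = a * bil B v w.
Proof. by rewrite /bil linearZ /= -scalemxAr mxE. Qed.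
Lemma bilNl B v w : bil B (- v) w = - bil B v w.
Proof. by rewrite -scaleN1r bilZl mulN1r. Qed.
Lemma bilNr B v w : bil B v (- w) = - bil B v w.
Proof. by rewrite -scaleN1r bilZr mulN1r. Qed.
Lemma bilBl B v v' w : bil B (v - v') w = bil B v w - bil B v' w.
Proof. by rewrite bilDl bilNl. Qed.
Lemma bil0l B w : bil B 0 w = 0.
Proof. by rewrite /bil !mul0mx mxE. Qed.
Lemma bil0r B w : bil B w 0 = 0.
Proof. by rewrite /bil trmx0 mulmx0 mxE. Qed.
Lemma bil_sumr B I (r : seq I) (P : pred I) (F : I -> 'rV[R]_n) w :
  bil B w (\sum_(i <- r | P i) F i) = \sum_(i <- r | P i) bil B w (F i).
Proof. by rewrite /bil linear_sum mulmx_sumr summxE. Qed.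
Lemma bil_mul p (J : 'M[R]_(p, n)) B x y :
  bil (J *m B *m J^T) x y = bil B (x *m J) (y *m J).
Proof. by rewrite /bil trmx_mul !mulmxA. Qed.

Lemma posdef_unitmx B : (forall v, v != 0 -> 0 < bil B v v) -> B \in unitmx.
Proof.
move=> pB; rewrite -row_free_unit -kermx_eq0; apply/eqP/row_matrixP => i.
rewrite row0; apply/eqP; apply: contraT => /pB.
have /sub_kermxP k0 : (row i (kermx B) <= kermx B)%MS by exact: row_sub.
by rewrite /bil k0 mul0mx mxE ltxx.
Qed.
End Bil.

(** * The Levi-Civita connection in coordinates *)

Section LocalGeometry.
Context {R : realType}.

(** Nondegeneracy is what raising an index takes. *)
Definition metric_on n (U : set 'rV[R]_n) (g : 'rV[R]_n -> 'M[R]_n) :=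
  [/\ open U, smooth_on U g, forall u, U u -> (g u)^T = g u
    & forall u, U u -> g u \in unitmx].

Section Christoffel.
Context {n : nat} {W : set 'rV[R]_n} {G : 'rV[R]_n -> 'M[R]_n} (mG : metric_on W G).
Implicit Types y v w z : 'rV[R]_n.

Let oW : open W. Proof. by case: mG. Qed.
Let sG : smooth_on W G. Proof. by case: mG. Qed.
Let dG y : W y -> differentiable G y. Proof. exact: smooth_diff. Qed.
Let symG y : W y -> (G y)^T = G y. Proof. by case: mG => _ _ + _; apply. Qed.
Let unitG y : W y -> G y \in unitmx. Proof. by case: mG => _ _ _; apply. Qed.

Lemma der_metric_sym y : W y -> forall z, (der z G y)^T = der z G y.
Proof.
move=> Wy z; rewrite -der_trmx; last exact: dG.
exact: (der_eq _ oW Wy).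
Qed.

Lemma chrC y v w : W y -> chr G y v w = chr G y w v.
Proof.
move=> Wy; rewrite chrE; apply: christoffel_torsion_free => z.
by have := der_metric_sym Wy z; rewrite derE.
Qed.

Lemma chr_compat y v w z : W y ->
  bil (der z G y) v w = bil (G y) (chr G y z v) w + bil (G y) v (chr G y z w).
Proof.
move=> Wy; rewrite chrE derE.
apply: christoffel_metric; [exact: dG|exact: unitG|exact: symG|move=> t].
by have := der_metric_sym Wy t; rewrite derE.
Qed.

(** Torsion-freeness and compatibility determine the connection: Koszul. *)
Lemma koszul y v w z : W y ->
  bil (G y) (chr G y v w) z =
  2^-1 * (bil (der v G y) w z + bil (der w G y) v z - bil (der z G y) v w).
Proof.
move=> Wy; rewrite !chr_compat //.
rewrite (chrC w v) // (chrC z v) // (chrC z w) //.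
rewrite (bilC w (chr G y v z)) ?(bilC v (chr G y w z)) ?symG //.
by field.
Qed.

(** A vector is known by its products: identities for the connection are proved
    by pairing both sides with an arbitrary vector and using [koszul]. *)
Lemma bil_inj y v w : W y -> (forall z, bil (G y) v z = bil (G y) w z) -> v = w.
Proof.
move=> Wy H; apply: (can_inj (mulmxK (unitG Wy))); apply/rowP => j.
by have := H (delta_mx 0 j); rewrite /bil trmx_delta -!colE !mxE.
Qed.

Lemma chr_linear_r y v a w w' : W y ->
  chr G y v (a *: w + w') = a *: chr G y v w + chr G y v w'.
Proof.
move=> Wy; apply: (bil_inj Wy) => z.
rewrite bilDl bilZl !koszul // der_linear; last exact: dG.
have bilDm B C t s : bil (a *: B + C) t s = a * bil B t s + bil C t s.
  by rewrite /bil mulmxDr mulmxDl -scalemxAr -scalemxAl [LHS]mxE [X in X + _]mxE.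
by rewrite bilDm !(bilDl, bilZl, bilDr, bilZr); ring.
Qed.

Lemma chr_linear_l y v a w w' : W y ->
  chr G y (a *: w + w') v = a *: chr G y w v + chr G y w' v.
Proof. by move=> Wy; rewrite !(chrC _ v) // chr_linear_r. Qed.

Lemma chrDl y v v' w : W y -> chr G y (v + v') w = chr G y v w + chr G y v' w.
Proof. by move=> Wy; rewrite -{1}[v]scale1r chr_linear_l // scale1r. Qed.
Lemma chrDr y v w w' : W y -> chr G y v (w + w') = chr G y v w + chr G y v w'.
Proof. by move=> Wy; rewrite -{1}[w]scale1r chr_linear_r // scale1r. Qed.
Lemma chr0l y w : W y -> chr G y 0 w = 0.
Proof.
by move=> Wy; apply: (@addrI _ (chr G y 0 w)); rewrite -chrDl // !addr0.
Qed.
Lemma chrZl y a v w : W y -> chr G y (a *: v) w = a *: chr G y v w.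
Proof. by move=> Wy; rewrite -[a *: v]addr0 chr_linear_l // chr0l // addr0. Qed.
Lemma chrZr y a v w : W y -> chr G y v (a *: w) = a *: chr G y v w.
Proof. by move=> Wy; rewrite chrC // chrZl // chrC. Qed.

(** Reduces the derivative of the connection along moving arguments to that of
    its finitely many components. *)
Lemma chr_sum_delta y v w : W y ->
  chr G y v w = \sum_i \sum_j (v 0 i * w 0 j) *: chr G y (delta_mx 0 i) (delta_mx 0 j).
Proof.
move=> Wy.
have suml I (r : seq I) (F : I -> 'rV[R]_n) x :
    chr G y (\sum_(i <- r) F i) x = \sum_(i <- r) chr G y (F i) x.
  elim: r => [|i r IH]; first by rewrite !big_nil chr0l.
  by rewrite !big_cons chrDl // IH.
have sumr I (r : seq I) (F : I -> 'rV[R]_n) x :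
    chr G y x (\sum_(i <- r) F i) = \sum_(i <- r) chr G y x (F i).
  by rewrite chrC // suml; apply: eq_bigr => i _; rewrite chrC.
rewrite {1}(row_sum_delta v) suml; apply: eq_bigr => i _.
rewrite chrZl // {1}(row_sum_delta w) sumr scaler_sumr; apply: eq_bigr => j _.
by rewrite chrZr // scalerA.
Qed.

Lemma smooth_chr_cst v w : smooth_on W (fun y => chr G y v w).
Proof.
rewrite chrE /christoffel.
apply: smooth_mulmx => //; last exact: smooth_invmx.
apply: smooth_scale => //; first exact: smooth_cst.
apply: smooth_sub => //.
  apply: smooth_add => //; apply: smooth_mulmx => //; first [exact: smooth_cst|exact: smooth_derive].
apply/smooth_mx => // i j; under eq_fun do rewrite mxE.
by apply: smooth_bil => //; first [exact: smooth_cst|exact: smooth_derive].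
Qed.

Section AlongMap.
Context {m : nat} {U : set 'rV[R]_m} (oU : open U) {P : 'rV[R]_m -> 'rV[R]_n}.
Context (UW : forall u, U u -> W (P u)) (sP : smooth_on U P).
Implicit Types X Y : 'rV[R]_m -> 'rV[R]_n.

Lemma smooth_chr X Y : smooth_on U X -> smooth_on U Y ->
  smooth_on U (fun u => chr G (P u) (X u) (Y u)).
Proof.
move=> sX sY; apply: (smooth_eq oU (f := fun u =>
  \sum_i \sum_j (X u 0 i * Y u 0 j) *: chr G (P u) (delta_mx 0 i) (delta_mx 0 j))).
  by move=> u /UW Wu; rewrite -chr_sum_delta.
apply: smooth_sum => // i; apply: smooth_sum => // j; apply: smooth_scale => //.
  by apply: smooth_mul => //; exact: smooth_entry.
exact: (smooth_comp oU oW UW sP (smooth_chr_cst _ _)).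
Qed.

Lemma der_chr X Y u (v : 'rV[R]_m) : smooth_on U X -> smooth_on U Y -> U u ->
  der v (fun q => chr G (P q) (X q) (Y q)) u =
  der (der v P u) (fun y => chr G y (X u) (Y u)) (P u)
  + chr G (P u) (der v X u) (Y u) + chr G (P u) (X u) (der v Y u).
Proof.
move=> sX sY Uu; have Wu := UW Uu.
pose C i j y := chr G y (delta_mx 0 i) (delta_mx 0 j).
have dC i j y : W y -> differentiable (C i j) y.
  exact: smooth_diff (smooth_chr_cst _ _).
have dP : differentiable P u := smooth_diff sP Uu.
have dX := smooth_diff sX Uu; have dY := smooth_diff sY Uu.
have dCP i j : differentiable (fun q => C i j (P q)) u.
  by apply: (differentiable_comp dP); exact: dC.
have dXi i : differentiable (fun q => X q 0 i) u by exact: (differentiable_mx X u).1.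
have dYi i : differentiable (fun q => Y q 0 i) u by exact: (differentiable_mx Y u).1.
have dXY i j : differentiable (fun q => X q 0 i * Y q 0 j) u by exact: differentiableM.
have dsc m' p' (f : 'rV[R]_m' -> R) (A : 'rV[R]_m' -> 'rV[R]_p') q : differentiable f q -> differentiable A q ->
    differentiable (fun q => f q *: A q) q.
  move=> df /differentiable_mx dA; apply/differentiable_mx => i j.
  by under eq_fun do rewrite mxE; exact: differentiableM.
rewrite (@der_eq _ _ _ U _ (fun q => \sum_i \sum_j (X q 0 i * Y q 0 j) *: C i j (P q))) //; last first.
  by move=> q Uq; rewrite chr_sum_delta //; exact: UW.
rewrite der_bigsum; last by move=> i _; apply: differentiable_bigsum => j _; exact: dsc.
rewrite (@der_eq _ _ _ W _ (fun y => \sum_i \sum_j (X u 0 i * Y u 0 j) *: C i j y)) //; last first.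
  by move=> y Wy; rewrite chr_sum_delta.
rewrite der_bigsum; last first.
  by move=> i _; apply: differentiable_bigsum => j _; apply: dsc; [exact: differentiable_cst|exact: dC].
rewrite (chr_sum_delta (der v X u)) // (chr_sum_delta (X u)) // -!big_split.
apply: eq_bigr => i _ /=; rewrite der_bigsum; last by move=> j _; exact: dsc.
rewrite der_bigsum; last by move=> j _; apply: dsc; [exact: differentiable_cst|exact: dC].
rewrite -!big_split; apply: eq_bigr => j _ /=.
rewrite der_scale // der_mul // der_comp; [|by []|exact: dC].
rewrite der_scale; [|exact: differentiable_cst|exact: dC].
rewrite der_cst scale0r add0r !der_entry // [LHS]addrC scalerDl /C.
by rewrite addrA.
Qed.

End AlongMap.
End Christoffel.
End LocalGeometry.

(** * Fields along a map, curvature and the Gauss equation *)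

Section Cov.
Context {R : realType} {n : nat} {W : set 'rV[R]_n} {G : 'rV[R]_n -> 'M[R]_n} (mG : metric_on W G).
Context {m : nat} {U : set 'rV[R]_m} (oU : open U) {P : 'rV[R]_m -> 'rV[R]_n}.
Context (UW : forall u, U u -> W (P u)) (sP : smooth_on U P).
Implicit Types (X Y Z : 'rV[R]_m -> 'rV[R]_n) (u v w : 'rV[R]_m).

Let oW : open W. Proof. by case: mG. Qed.
Let sG : smooth_on W G. Proof. by case: mG. Qed.
Let symG y : W y -> (G y)^T = G y. Proof. by case: mG => _ _ + _; apply. Qed.

(** Covariant derivative of a field Y along the map P, in the direction v. *)
Definition cov v Y u := der v Y u + chr G (P u) (der v P u) (Y u).

Lemma smooth_cov v Y : smooth_on U Y -> smooth_on U (cov v Y).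
Proof.
move=> sY; apply: smooth_add => //; first exact: smooth_der.
by apply: (smooth_chr mG oU UW sP) => //; exact: smooth_der.
Qed.

Let sGP : smooth_on U (fun u => G (P u)).
Proof. exact: (smooth_comp oU oW UW sP sG). Qed.

Lemma cov_compat v X Y u : smooth_on U X -> smooth_on U Y -> U u ->
  der v (fun q => bil (G (P q)) (X q) (Y q)) u =
  bil (G (P u)) (cov v X u) (Y u) + bil (G (P u)) (X u) (cov v Y u).
Proof.
move=> sX sY Uu; have Wu := UW Uu.
have dG : differentiable G (P u) by exact: smooth_diff sG Wu.
rewrite der_bil; [|exact: smooth_diff sGP Uu|exact: smooth_diff sX Uu|exact: smooth_diff sY Uu].
rewrite der_comp //; last exact: smooth_diff sP Uu.
by rewrite (chr_compat mG) // !bilDl !bilDr; ring.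
Qed.

(** Torsion-freeness along P: coordinate fields of the source commute. *)
Lemma cov_derC v w u : U u -> cov v (der w P) u = cov w (der v P) u.
Proof.
move=> Uu; rewrite /cov (schwarz _ _ oU Uu sP) (chrC mG) //; exact: UW.
Qed.

(** The second-order terms cancel by the symmetry of second derivatives of P and
    Y; what is left is the curvature at the image point. *)
Lemma cov_commutator v w Y u : smooth_on U Y -> U u ->
  cov v (cov w Y) u - cov w (cov v Y) u =
  rie G (P u) (der v P u) (der w P u) (Y u).
Proof.
move=> sY Uu; have Wu := UW Uu.
have E a b : cov a (cov b Y) u = der a (der b Y) u
    + der (der a P u) (fun y => chr G y (der b P u) (Y u)) (P u)
    + chr G (P u) (der a (der b P) u) (Y u) + chr G (P u) (der b P u) (der a Y u)
    + chr G (P u) (der a P u) (der b Y u)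
    + chr G (P u) (der a P u) (chr G (P u) (der b P u) (Y u)).
  rewrite {1}/cov {2}/cov (chrDr mG) //.
  rewrite (_ : der a (cov b Y) u = der a (der b Y) u + der a (fun q => chr G (P q) (der b P q) (Y q)) u).
    by rewrite (der_chr mG oU UW sP _ (smooth_der b sP)) // !addrA.
  exact: (der_addf a (smooth_diff (smooth_der b sY) Uu)
    (smooth_diff (smooth_chr mG oU UW sP (smooth_der b sP) sY) Uu)).
rewrite !E rieE /riemann -chrE -!derxE.
rewrite (schwarz v w oU Uu sP) (schwarz v w oU Uu sY).
move: (der w (der v Y) u) (chr _ _ (der w (der v P) u) _) => a b.
move: (chr _ _ (der v P u) (der w Y u)) (chr _ _ (der w P u) (der v Y u)) => c d.
move: (chr _ _ _ (chr _ _ (der w P u) _)) (chr _ _ _ (chr _ _ (der v P u) _)) => k l.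
move: (der (der v P u) _ _) (der (der w P u) _ _) => p q.
by apply/rowP => i; rewrite !mxE; ring.
Qed.

(** Curvature through first derivatives of inner products only: this form can be
    compared between the source and the target of an isometric immersion. *)
Lemma riemann_along v w Y Z u : smooth_on U Y -> smooth_on U Z -> U u ->
  bil (G (P u)) (rie G (P u) (der v P u) (der w P u) (Y u)) (Z u) =
  der v (fun q => bil (G (P q)) (cov w Y q) (Z q)) u
  - bil (G (P u)) (cov w Y u) (cov v Z u)
  - der w (fun q => bil (G (P q)) (cov v Y q) (Z q)) u
  + bil (G (P u)) (cov v Y u) (cov w Z u).
Proof.
move=> sY sZ Uu; rewrite -cov_commutator // bilBl.
rewrite !cov_compat //; do ?exact: smooth_cov.
ring.
Qed.

End Cov.

Section RiemannLow.
Context {R : realType} {n : nat} {W : set 'rV[R]_n} {G : 'rV[R]_n -> 'M[R]_n} (mG : metric_on W G).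
Implicit Types (u v w z t : 'rV[R]_n).

(** The case of the identity map and of constant fields. *)
Lemma riemann_low u v w z t : W u ->
  bil (G u) (rie G u v w z) t =
  der v (fun q => bil (G q) (chr G q w z) t) u - bil (G u) (chr G u w z) (chr G u v t)
  - der w (fun q => bil (G q) (chr G q v z) t) u + bil (G u) (chr G u v z) (chr G u w t).
Proof.
move=> Wu; have oW : open W by case: mG.
have := @riemann_along _ _ _ _ mG _ _ oW id (fun _ => id) (smooth_id oW) v w (fun=> z) (fun=> t) u
  (smooth_cst _) (smooth_cst _) Wu.
have E a b : cov (G := G) (P := id) a (fun=> b) = fun q => chr G q a b.
  by apply/funext => q; rewrite /cov der_cst der_id add0r.
by rewrite !der_id !E.
Qed.

(** Since D_w <z, z> = 2 <nabla_w z, z>, the derivative terms of [riemann_low] are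
    second derivatives of <z, z>, which are symmetric in v and w. *)
Lemma riemann_skew u v w z : W u -> bil (G u) (rie G u v w z) z = 0.
Proof.
move=> Wu; have [oW sG sym _] := mG.
have H a q : W q -> bil (G q) (chr G q a z) z = 2^-1 * der a (fun q => bil (G q) z z) q.
  move=> Wq; have dG := smooth_diff sG Wq.
  rewrite (der_bil _ dG (differentiable_cst _ _) (differentiable_cst _ _)) !der_cst bil0l bil0r !addr0.
  rewrite (chr_compat mG) // (bilC z _ (sym q Wq)). by field.
have sz : smooth_on W (fun q => bil (G q) z z) by apply: smooth_bil => //; exact: smooth_cst.
have H' : forall a b, der a (fun q => bil (G q) (chr G q b z) z) u = 2^-1 * der a (der b (fun q => bil (G q) z z)) u.
  move=> c d.
  have -> := der_eq c oW Wu (H d).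
  rewrite der_mul; [|exact: differentiable_cst|exact: smooth_diff (smooth_der d sz) Wu].
  by rewrite der_cst mul0r add0r.
rewrite riemann_low // !H' (schwarz_fun v w oW Wu sz) (bilC _ (chr G u v z)) ?sym //; ring.
Qed.

Lemma riemann_antisym u v w z : rie G u v w z = - rie G u w v z.
Proof.
rewrite rieE /riemann -chrE -!derxE.
move: (der v _ _) (der w _ _) (chr _ _ _ _) (chr _ _ _ _) => a b c d.
by apply/rowP => i; rewrite !mxE; ring.
Qed.

End RiemannLow.

Section Gauss.
Context {R : realType} {n m : nat}.
Context {W : set 'rV[R]_n} {G : 'rV[R]_n -> 'M[R]_n} (mG : metric_on W G).
Context {U : set 'rV[R]_m} {g : 'rV[R]_m -> 'M[R]_m} (mg : metric_on U g).
Context {P : 'rV[R]_m -> 'rV[R]_n} (UW : forall u, U u -> W (P u)) (sP : smooth_on U P).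
Context (gE : forall u, U u -> g u = jac P u *m G (P u) *m (jac P u)^T).
Implicit Types (u v w z : 'rV[R]_m).

Let oU : open U. Proof. by case: mg. Qed.

(** Gauss formula: the second fundamental form as a difference of the ambient and
    of the intrinsic covariant derivatives of a coordinate field. *)
Definition sff u v w := cov (G := G) (P := P) v (der w P) u - chr g u v w *m jac P u.

Let dP u v : U u -> der v P u = v *m jac P u.
Proof. by move=> Uu; apply: der_jac; exact: smooth_diff sP Uu. Qed.

Lemma sffC u v w : U u -> sff u v w = sff u w v.
Proof.
by move=> Uu; rewrite /sff (cov_derC mG oU UW sP) // (chrC mg).
Qed.

Lemma bil_pull u v w : U u -> bil (g u) v w = bil (G (P u)) (v *m jac P u) (w *m jac P u).
Proof. by move=> Uu; rewrite gE // bil_mul. Qed.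

(** Both connections are torsion free and metric, hence agree tangentially. *)
Lemma cov_tangent u v w z : U u ->
  bil (G (P u)) (cov (G := G) (P := P) v (der w P) u) (z *m jac P u) = bil (g u) (chr g u v w) z.
Proof.
move=> Uu; rewrite (koszul mg) //.
have [_ sg symg _] := mg; have [_ _ symG _] := mG.
have H a b c : bil (der a g u) b c =
    bil (G (P u)) (cov (G := G) (P := P) a (der b P) u) (c *m jac P u)
    + bil (G (P u)) (cov (G := G) (P := P) a (der c P) u) (b *m jac P u).
  have -> : bil (der a g u) b c = der a (fun q => bil (g q) b c) u.
    rewrite (der_bil _ (smooth_diff sg Uu) (differentiable_cst _ _) (differentiable_cst _ _)).
    by rewrite !der_cst bil0l bil0r !addr0.
  rewrite (@der_eq _ _ _ U _ (fun q => bil (G (P q)) (der b P q) (der c P q))) //; last first.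
    by move=> q Uq; rewrite bil_pull // !dP.
  rewrite (cov_compat mG oU UW sP); [|exact: smooth_der|exact: smooth_der|by []].
  by rewrite (bilC (der b P u)) ?symG //; [rewrite !dP|exact: UW].
rewrite !H (cov_derC mG oU UW sP w v) // (cov_derC mG oU UW sP z v) // (cov_derC mG oU UW sP z w) //.
by field.
Qed.

Lemma sff_normal u v w z : U u -> bil (G (P u)) (sff u v w) (z *m jac P u) = 0.
Proof.
by move=> Uu; rewrite /sff bilBl cov_tangent // bil_pull // subrr.
Qed.

Lemma cov_split u v w : cov (G := G) (P := P) v (der w P) u = chr g u v w *m jac P u + sff u v w.
Proof. by rewrite /sff addrC subrK. Qed.

Lemma bil_cov u v w v' w' : U u ->
  bil (G (P u)) (cov (G := G) (P := P) v (der w P) u) (cov (G := G) (P := P) v' (der w' P) u) =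
  bil (g u) (chr g u v w) (chr g u v' w') + bil (G (P u)) (sff u v w) (sff u v' w').
Proof.
move=> Uu; have [_ _ symG _] := mG.
have N1 := sff_normal v w (chr g u v' w') Uu.
have N2 := sff_normal v' w' (chr g u v w) Uu.
rewrite !cov_split bil_pull //; move: N1 N2; move: (sff u v w) (sff u v' w') => s s' N1 N2.
rewrite bilDl !bilDr N1 (bilC _ s') ?N2 ?addr0 ?add0r //.
by apply: symG; exact: UW.
Qed.

(** [riemann_along] and [riemann_low] have the same derivative terms, by
    [cov_tangent]; the remaining products differ by those of the normal parts. *)
Lemma gauss u v w : U u ->
  bil (G (P u)) (rie G (P u) (v *m jac P u) (w *m jac P u) (w *m jac P u)) (v *m jac P u) =
  bil (g u) (rie g u v w w) v
  - bil (G (P u)) (sff u w w) (sff u v v) + bil (G (P u)) (sff u v w) (sff u v w).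
Proof.
move=> Uu; rewrite -!dP //.
rewrite (riemann_along mG oU UW sP _ _ (smooth_der w sP) (smooth_der v sP) Uu).
have E a b c : der a (fun q => bil (G (P q)) (cov (G := G) (P := P) b (der w P) q) (der c P q)) u
    = der a (fun q => bil (g q) (chr g q b w) c) u.
  by apply: (der_eq _ oU Uu) => q Uq; rewrite dP // cov_tangent.
rewrite !E (cov_derC mG oU UW sP w v) // !bil_cov // (riemann_low mg) //.
by rewrite (chrC mg w v) //; ring.
Qed.

End Gauss.

(** * Connection and curvature of a warped product *)

Section Warped.
Context {R : realType} {n1 n2 : nat}.
Context {U1 : set 'rV[R]_n1} {g1 : 'rV[R]_n1 -> 'M[R]_n1} (mg1 : metric_on U1 g1).
Context {U2 : set 'rV[R]_n2} {g2 : 'rV[R]_n2 -> 'M[R]_n2} (mg2 : metric_on U2 g2).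
Context {F : 'rV[R]_n1 -> R} (sF : smooth_on U1 F) (F0 : forall p, U1 p -> F p != 0).
Context {U : set 'rV[R]_(n1 + n2)} {G : 'rV[R]_(n1 + n2) -> 'M[R]_(n1 + n2)} (mG : metric_on U G).
Context (U12 : forall u, U u -> U1 (lsubmx u) /\ U2 (rsubmx u)).
Context (GE : forall u, U u ->
  G u = block_mx (g1 (lsubmx u)) 0 0 (F (lsubmx u) ^+ 2 *: g2 (rsubmx u))).
Implicit Types (u : 'rV[R]_(n1 + n2)) (v : 'rV[R]_n1) (w : 'rV[R]_n2).

Let oU : open U. Proof. by case: mG. Qed.

Lemma bil_block (A : 'M[R]_n1) (B : 'M[R]_n2) v v' w w' :
  bil (block_mx A 0 0 B) (row_mx v w) (row_mx v' w') = bil A v v' + bil B w w'.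
Proof.
rewrite /bil mul_row_block !mulmx0 addr0 add0r tr_row_mx mul_row_col.
by rewrite [LHS]mxE.
Qed.

Lemma bil_scale n (A : 'M[R]_n) a (x y : 'rV[R]_n) : bil (a *: A) x y = a * bil A x y.
Proof. by rewrite /bil -scalemxAr -scalemxAl mxE. Qed.

Lemma warpedE u v w v' w' : U u ->
  bil (G u) (row_mx v w) (row_mx v' w') =
  bil (g1 (lsubmx u)) v v' + F (lsubmx u) ^+ 2 * bil (g2 (rsubmx u)) w w'.
Proof. by move=> Uu; rewrite GE // bil_block bil_scale. Qed.

Lemma der_lsubmx (x u : 'rV[R]_(n1 + n2)) : der x lsubmx u = lsubmx x.
Proof.
rewrite derE deriveE; last exact: differentiable_lsubmx.
by rewrite (diff_lin _ (@continuous_lsubmx _ _ _ _)).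
Qed.

Lemma der_rsubmx (x u : 'rV[R]_(n1 + n2)) : der x rsubmx u = rsubmx x.
Proof.
rewrite derE deriveE; last exact: differentiable_rsubmx.
by rewrite (diff_lin _ (@continuous_rsubmx _ _ _ _)).
Qed.

Let der_l (V : normedModType R) (f : 'rV[R]_n1 -> V) x u : U u -> smooth_on U1 f ->
  der x (fun q => f (lsubmx q)) u = der (lsubmx x) f (lsubmx u).
Proof.
move=> Uu sf; rewrite der_comp ?der_lsubmx //; first exact: differentiable_lsubmx.
exact: smooth_diff sf (U12 Uu).1.
Qed.

Let der_r (V : normedModType R) (f : 'rV[R]_n2 -> V) x u : U u -> smooth_on U2 f ->
  der x (fun q => f (rsubmx q)) u = der (rsubmx x) f (rsubmx u).
Proof.
move=> Uu sf; rewrite der_comp ?der_rsubmx //; first exact: differentiable_rsubmx.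
exact: smooth_diff sf (U12 Uu).2.
Qed.

Let diff_l (V : normedModType R) (f : 'rV[R]_n1 -> V) u : U u -> smooth_on U1 f ->
  differentiable (fun q : 'rV[R]_(n1 + n2) => f (lsubmx q)) u.
Proof.
move=> Uu sf; apply: differentiable_comp; first exact: differentiable_lsubmx.
exact: smooth_diff sf (U12 Uu).1.
Qed.

Let diff_r (V : normedModType R) (f : 'rV[R]_n2 -> V) u : U u -> smooth_on U2 f ->
  differentiable (fun q : 'rV[R]_(n1 + n2) => f (rsubmx q)) u.
Proof.
move=> Uu sf; apply: differentiable_comp; first exact: differentiable_rsubmx.
exact: smooth_diff sf (U12 Uu).2.
Qed.

Lemma der_bil_cst n (B : 'rV[R]_n -> 'M[R]_n) (q x y z : 'rV[R]_n) : differentiable B q ->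
  der x (fun q => bil (B q) y z) q = bil (der x B q) y z.
Proof.
move=> dB; rewrite (der_bil _ dB (differentiable_cst _ _) (differentiable_cst _ _)).
by rewrite !der_cst bil0l bil0r !addr0.
Qed.

Lemma der_warped u x v w v' w' : U u ->
  bil (der x G u) (row_mx v w) (row_mx v' w') =
  bil (der (lsubmx x) g1 (lsubmx u)) v v'
  + 2 * F (lsubmx u) * der (lsubmx x) F (lsubmx u) * bil (g2 (rsubmx u)) w w'
  + F (lsubmx u) ^+ 2 * bil (der (rsubmx x) g2 (rsubmx u)) w w'.
Proof.
move=> Uu; have [_ sG _ _] := mG; have [oU1 sg1 _ _] := mg1; have [oU2 sg2 _ _] := mg2.
have [U1u U2u] := U12 Uu.
rewrite -der_bil_cst; last exact: smooth_diff sG Uu.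
rewrite (der_eq _ oU Uu (fun q Uq => warpedE v w v' w' Uq)).
have s1 : smooth_on U1 (fun p => bil (g1 p) v v') by apply: smooth_bil => //; exact: smooth_cst.
have s2 : smooth_on U2 (fun p => bil (g2 p) w w') by apply: smooth_bil => //; exact: smooth_cst.
have sF2 : smooth_on U1 (fun p => F p ^+ 2) by apply: smooth_mul.
rewrite der_addf; [|exact: (diff_l Uu s1)|by apply: differentiableM; [exact: (diff_l Uu sF2)|exact: (diff_r Uu s2)]].
rewrite (der_l _ Uu s1) der_mul; [|exact: (diff_l Uu sF2)|exact: (diff_r Uu s2)].
rewrite (der_l _ Uu sF2) (der_r _ Uu s2) der_mul; do ?exact: smooth_diff sF U1u.
rewrite !der_bil_cst; [ring|exact: smooth_diff sg2 U2u|exact: smooth_diff sg1 U1u].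
Qed.

Definition grad p : 'rV[R]_n1 := (\row_j der (delta_mx 0 j) F p) *m invmx (g1 p).

Lemma bil_grad p v : U1 p -> bil (g1 p) (grad p) v = der v F p.
Proof.
move=> Up; have [_ _ _ ug1] := mg1; rewrite /bil /grad mulmxKV ?ug1 //.
rewrite (der_sum_delta _ (smooth_diff sF Up)) mxE; apply: eq_bigr => j _.
by rewrite !mxE mulrC.
Qed.

(* Levi-Civita coefficients are read off against an arbitrary vector x. *)
Ltac solve_koszul Uu :=
  let x := fresh "x" in
  have [U1u U2u] := U12 Uu;
  apply: (bil_inj mG Uu) => x; rewrite -(hsubmxK x) (koszul mG) // ?bilZl !der_warped //
    !row_mxKl !row_mxKr ?warpedE //.

Lemma chr_warped_hh u v v' : U u ->
  chr G u (row_mx v 0) (row_mx v' 0) = row_mx (chr g1 (lsubmx u) v v') 0.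
Proof.
move=> Uu; solve_koszul Uu.
rewrite (koszul mg1) // !(bil0l, bil0r); ring.
Qed.

Lemma chr_warped_vv u w w' : U u ->
  chr G u (row_mx 0 w) (row_mx 0 w') =
  row_mx (- (F (lsubmx u) * bil (g2 (rsubmx u)) w w') *: grad (lsubmx u))
         (chr g2 (rsubmx u) w w').
Proof.
move=> Uu; solve_koszul Uu.
have z0 : der 0 F (lsubmx u) = 0 by rewrite derE derive0.
rewrite (koszul mg2) // bilZl bil_grad // !(bil0l, bil0r) z0; by field.
Qed.

Lemma chr_warped_hv u v w : U u ->
  chr G u (row_mx v 0) (row_mx 0 w) = (der v F (lsubmx u) / F (lsubmx u)) *: row_mx 0 w.
Proof.
move=> Uu; solve_koszul Uu.
have z0 : der 0 F (lsubmx u) = 0 by rewrite derE derive0.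
have zg1 : der 0 g1 (lsubmx u) = 0 by rewrite derE derive0.
have zg2 : der 0 g2 (rsubmx u) = 0 by rewrite derE derive0.
have b0 k (r s : 'rV[R]_k) : bil 0 r s = 0 by rewrite /bil mulmx0 mul0mx mxE.
rewrite !(bil0l, bil0r) z0 zg1 zg2 !b0; have := F0 U1u => FN0; by field.
Qed.

(** The curvature of a plane spanned by a horizontal v and a vertical w is carried
    by the Hessian of F: up to the sign and the factor F, it is Hess F (v, v) |w|^2. *)
Lemma curvature_warped u v w : U u ->
  bil (G u) (rie G u (row_mx v 0) (row_mx 0 w) (row_mx 0 w)) (row_mx v 0) =
  - F (lsubmx u) * (der v (der v F) (lsubmx u) - der (chr g1 (lsubmx u) v v) F (lsubmx u))
    * bil (g2 (rsubmx u)) w w.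
Proof.
move=> Uu; have [U1u U2u] := U12 Uu; have [_ _ sy1 _] := mg1; have [_ sg2 _ _] := mg2.
rewrite (riemann_low mG) //.
have A q : U q -> bil (G q) (chr G q (row_mx 0 w) (row_mx 0 w)) (row_mx v 0) =
    - (F (lsubmx q) * der v F (lsubmx q)) * bil (g2 (rsubmx q)) w w.
  move=> Uq; have [U1q _] := U12 Uq.
  by rewrite chr_warped_vv // warpedE // bilZl bil_grad // bil0r; ring.
have B q : U q -> bil (G q) (chr G q (row_mx v 0) (row_mx 0 w)) (row_mx v 0) = 0.
  by move=> Uq; rewrite chr_warped_hv // bilZl warpedE // bil0l bil0r; ring.
rewrite (der_eq _ oU Uu A) (der_eq _ oU Uu B) der_cst.
rewrite (chrC mG (row_mx 0 w) (row_mx v 0)) // chr_warped_hv // bilZl bilZr chr_warped_vv // chr_warped_hh // !warpedE //.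
rewrite bilZl bil_grad // !(bil0l, bil0r).
have s1 : smooth_on U1 (fun p => - (F p * der v F p)).
  have [oU1 _ _ _] := mg1.
  apply: (smooth_eq oU1 (f := fun p => (-1) * (F p * der v F p))); first by move=> p _; rewrite mulN1r.
  apply: smooth_mul => //; first exact: smooth_cst.
  by apply: smooth_mul => //; exact: smooth_der.
have s2 : smooth_on U2 (fun p => bil (g2 p) w w).
  by have [oU2 _ _ _] := mg2; apply: smooth_bil => //; exact: smooth_cst.
rewrite der_mul; [|exact: (diff_l Uu s1)|exact: (diff_r Uu s2)].
rewrite (der_l _ Uu s1) (der_r _ Uu s2) row_mxKl row_mxKr.
have -> : der 0 (fun p => bil (g2 p) w w) (rsubmx u) = 0 by rewrite derE derive0.
have -> : der v (fun p => - (F p * der v F p)) (lsubmx u) =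
  - (der v F (lsubmx u) * der v F (lsubmx u) + F (lsubmx u) * der v (der v F) (lsubmx u)).
  have dF := smooth_diff sF U1u; have dvF := smooth_diff (smooth_der v sF) U1u.
  rewrite derE deriveN; last by apply: diff_derivable; exact: differentiableM.
  by rewrite -derxE der_mul.
have FN0 := F0 U1u; by field.
Qed.

End Warped.

(** * Algebraic symmetries of the curvature *)

Section RiemannLinear.
Context {R : realType} {n : nat} {W : set 'rV[R]_n} {G : 'rV[R]_n -> 'M[R]_n} (mG : metric_on W G).
Implicit Types (u v w z t : 'rV[R]_n).

Let riemE u v w z : rie G u v w z =
  der v (fun q => chr G q w z) u - der w (fun q => chr G q v z) u
  + chr G u v (chr G u w z) - chr G u w (chr G u v z).
Proof. by rewrite rieE /riemann -chrE -!derxE. Qed.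

Lemma riemann_linear1 u a v v' w z : W u ->
  rie G u (a *: v + v') w z = a *: rie G u v w z + rie G u v' w z.
Proof.
move=> Wu; have [oW _ _ _] := mG.
have dC x y : differentiable (fun q => chr G q x y) u.
  exact: smooth_diff (smooth_chr_cst mG x y) Wu.
rewrite !riemE der_linear //.
rewrite (der_eq w oW Wu (fun q Wq => chr_linear_l mG z a v v' Wq)).
have dZ : differentiable (fun q => a *: chr G q v z) u by exact: differentiableZ.
rewrite (der_addf w dZ) // (der_scalec a w (dC v z)).
rewrite !(chr_linear_l mG) // !(chr_linear_r mG) //.
by apply/rowP => i; rewrite !mxE; ring.
Qed.

Lemma riemann_linear3 u v w a z z' : W u ->
  rie G u v w (a *: z + z') = a *: rie G u v w z + rie G u v w z'.
Proof.
move=> Wu; have [oW _ _ _] := mG.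
have dC x y : differentiable (fun q => chr G q x y) u.
  exact: smooth_diff (smooth_chr_cst mG x y) Wu.
rewrite !riemE.
have H x y : der x (fun q => chr G q y (a *: z + z')) u =
    a *: der x (fun q => chr G q y z) u + der x (fun q => chr G q y z') u.
  rewrite (der_eq x oW Wu (fun q Wq => chr_linear_r mG y a z z' Wq)).
  have dZ : differentiable (fun q => a *: chr G q y z) u by exact: differentiableZ.
  by rewrite (der_addf x dZ) // (der_scalec a x (dC y z)).
rewrite !H !(chr_linear_r mG) //.
by apply/rowP => i; rewrite !mxE; ring.
Qed.

Lemma riemann_skew2 u v w z t : W u ->
  bil (G u) (rie G u v w z) t = - bil (G u) (rie G u v w t) z.
Proof.
move=> Wu; have := riemann_skew mG v w (z + t) Wu.
rewrite -{1}[z]scale1r riemann_linear3 // scale1r bilDl !bilDr.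
rewrite !(riemann_skew mG) // add0r addr0 => /eqP; rewrite addr_eq0 => /eqP ->.
by [].
Qed.

(** The curvature is antisymmetric in the first pair of vectors and, by
    [riemann_skew], in the second. *)
Lemma riemann_pair u v w : W u ->
  bil (G u) (rie G u v w w) v = bil (G u) (rie G u w v v) w.
Proof. by move=> Wu; rewrite riemann_antisym bilNl riemann_skew2 // opprK. Qed.

End RiemannLinear.

(** * Orthonormal bases *)

Section Orthonormal.
Context {R : realType}.

(** An orthonormal family of fewer than n vectors is extended by a normalised
    vector of the kernel of the products with its members. *)
Lemma orthonormal_rows n (B : 'M[R]_n) : B^T = B -> (forall v, v != 0 -> 0 < bil B v v) ->
  forall k, (k <= n)%N -> exists E : 'M[R]_(k, n), E *m B *m E^T = 1%:M.
Proof.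
move=> sB pB; elim=> [|k IH] kn.
  by exists 0; apply/matrixP => -[].
have [E EE] := IH (ltnW kn).
pose K := kermx (B *m E^T).
have [i Ki] : exists i, row i K != 0.
  apply/existsP; rewrite -negb_forall; apply/negP => /forallP K0.
  have : \rank K = 0%N.
    by apply/eqP; rewrite mxrank_eq0; apply/eqP/row_matrixP => i; rewrite row0; apply/eqP.
  rewrite mxrank_ker; have := rank_leq_col (B *m E^T); lia.
pose v := row i K; have vE : v *m B *m E^T = 0.
  by rewrite -mulmxA; apply/sub_kermxP; exact: row_sub.
have vv : 0 < bil B v v by exact: pB.
pose e := (Num.sqrt (bil B v v))^-1 *: v.
have eE : e *m B *m E^T = 0 by rewrite /e -!scalemxAl vE scaler0.
have Ee : E *m B *m e^T = 0.
  by apply: trmx_inj; rewrite !trmx_mul trmxK sB trmx0 mulmxA.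
have ee : e *m B *m e^T = 1%:M.
  apply/matrixP => a b; rewrite !ord1 -[LHS]/(bil B e e) bilZl bilZr mxE eqxx mulrA -expr2 exprVn.
  by rewrite sqr_sqrtr ?ltW // mulVf // gt_eqF.
rewrite -addn1; exists (col_mx E e).
rewrite mul_col_mx tr_col_mx mul_col_row EE eE Ee ee.
by rewrite -scalar_mx_block.
Qed.

Lemma orthonormal_exists n (B : 'M[R]_n) : B^T = B -> (forall v, v != 0 -> 0 < bil B v v) ->
  exists E : 'M[R]_n, E *m B *m E^T = 1%:M.
Proof. by move=> sB pB; exact: orthonormal_rows. Qed.

Lemma orthonormal_unit n (B E : 'M[R]_n) : E *m B *m E^T = 1%:M -> E \in unitmx.
Proof. by move=> H; have [] := mulmx1_unit (etrans (mulmxA _ _ _) H). Qed.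

Lemma orthonormal_bil k n (B : 'M[R]_n) (E : 'M[R]_(k, n)) i j : E *m B *m E^T = 1%:M ->
  bil B (row i E) (row j E) = (i == j)%:R.
Proof.
move=> EE; rewrite !rowE -bil_mul EE /bil mulmx1 trmx_delta mul_delta_mx_cond.
by case: (i == j); rewrite ?mulr1n ?mulr0n mxE ?eqxx.
Qed.

Lemma onb_orthonormal n (B : 'M[R]_n) l (W : 'M[R]_(l, n)) k (E : 'M[R]_(k, n)) :
  orthonormal_basis B W E -> orthonormal_basis B W (onb B W k).
Proof. by move=> H; rewrite /onb; apply: (xgetPex 0); exists E. Qed.

(** The matrix of change of basis is orthogonal. *)
Lemma trace_invariant n (B : 'M[R]_n) l (W : 'M[R]_(l, n)) k (E E' : 'M[R]_(k, n))
    (b : 'rV[R]_n -> 'rV[R]_n -> R) :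
  (forall a x y z, b (a *: x + y) z = a * b x z + b y z) ->
  (forall a x y z, b z (a *: x + y) = a * b z x + b z y) ->
  orthonormal_basis B W E -> orthonormal_basis B W E' ->
  \sum_i b (row i E') (row i E') = \sum_i b (row i E) (row i E).
Proof.
move=> bl br [EE sE] [EE' sE'].
have [Q E'E] : exists Q, E' = Q *m E by apply/submxP; rewrite sE -sE' submx_refl.
have QQ : Q^T *m Q = 1%:M.
  apply: mulmx1C; rewrite -EE' E'E trmx_mul !mulmxA -(mulmxA Q) -(mulmxA Q) EE.
  by rewrite mulmx1.
have b0l z : b 0 z = 0 by have := bl (-1) 0 0 z; rewrite scaler0 addr0 mulN1r addNr.
have b0r z : b z 0 = 0 by have := br (-1) 0 0 z; rewrite scaler0 addr0 mulN1r addNr.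
have bsl (c : 'I_k -> R) (F : 'I_k -> 'rV[R]_n) z : b (\sum_i c i *: F i) z = \sum_i c i * b (F i) z.
  by elim/big_rec2 : _ => [|i y x _ IH]; rewrite ?b0l // bl IH.
have bsr (c : 'I_k -> R) (F : 'I_k -> 'rV[R]_n) z : b z (\sum_i c i *: F i) = \sum_i c i * b z (F i).
  by elim/big_rec2 : _ => [|i y x _ IH]; rewrite ?b0r // br IH.
have rowE i : row i E' = \sum_j Q i j *: row j E.
  by rewrite E'E row_mul mulmx_sum_row; apply: eq_bigr => j _; rewrite mxE.
transitivity (\sum_i \sum_j \sum_l Q i j * Q i l * b (row j E) (row l E)).
  apply: eq_bigr => i _; rewrite rowE bsl; apply: eq_bigr => j _.
  by rewrite bsr mulr_sumr; apply: eq_bigr => h _; rewrite mulrA.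
rewrite exchange_big; apply: eq_bigr => j _; rewrite exchange_big (bigD1 j) //=.
have QE h : \sum_i Q i j * Q i h = (j == h)%:R.
  by move/matrixP: QQ => /(_ j h); rewrite !mxE => <-; apply: eq_bigr => i _; rewrite mxE.
rewrite -mulr_suml QE eqxx mul1r big1 ?addr0 // => h hj.
by rewrite -mulr_suml QE eq_sym (negbTE hj) mul0r.
Qed.

End Orthonormal.

(** * Jacobians and charts *)

Section Jac.
Context {R : realType}.

Lemma jac_eq n p (U : set 'rV[R]_n) (f g : 'rV[R]_n -> 'rV[R]_p) u :
  open U -> U u -> (forall q, U q -> f q = g q) -> differentiable f u -> jac f u = jac g u.
Proof.
move=> oU Uu fg df; apply/row_matrixP => i; rewrite !rowE -!der_jac //.
  exact: der_eq oU Uu fg.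
exact: near_eq_differentiable (open_near_eq oU Uu fg) df.
Qed.

Lemma jac_comp n p q (g : 'rV[R]_n -> 'rV[R]_p) (f : 'rV[R]_p -> 'rV[R]_q) u :
  differentiable g u -> differentiable f (g u) ->
  jac (fun x => f (g x)) u = jac g u *m jac f (g u).
Proof.
move=> dg df; apply/row_matrixP => i; rewrite !rowE mulmxA -!der_jac //.
  exact: (der_comp _ dg df).
exact: (differentiable_comp dg df).
Qed.

Lemma jac_id n (u : 'rV[R]_n) : jac id u = 1%:M.
Proof. by apply/row_matrixP => i; rewrite !rowE -der_jac // der_id mulmx1. Qed.

Lemma smooth_jac n p (U : set 'rV[R]_n) (f : 'rV[R]_n -> 'rV[R]_p) :
  open U -> smooth_on U f -> smooth_on U (jac f).
Proof.
move=> oU sf; apply/(smooth_mx oU) => i j.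
apply: (smooth_eq oU (f := fun u => der (delta_mx 0 i) f u 0 j)).
  move=> u Uu; rewrite der_jac; last exact: smooth_diff sf Uu.
  by rewrite -rowE mxE.
by apply: smooth_entry => //; exact: smooth_der.
Qed.

End Jac.

Section Charts.
Context {R : realType} {n : nat}.

(** The part of a smooth manifold that the local computations use; unlike
    [smooth_manifold] it is easily transported to products. *)
Definition atlas (M : manifold R n) : Prop :=
  (forall x : M, is_chart (chart_at x) /\ cdom (chart_at x) x) /\
  (forall x y : M, smooth_on [set u | cimg (chart_at x) u /\ cdom (chart_at y) (point x u)] (transition x y)).

Lemma smooth_manifold_atlas (M : manifold R n) : smooth_manifold M -> atlas M.
Proof. by case. Qed.

Lemma open_preimage (M : manifold R n) (x : M) (V : set M) : atlas M -> open V ->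
  open [set u | cimg (chart_at x) u /\ V (point x u)].
Proof.
move=> [aM _] oV; have [[[_ oI] _ _ _ ci] _] := aM x.
rewrite openE => u [Iu Vu]; apply: filterI; first exact: open_nbhs_nbhs.
by apply: (ci u Iu); exact: open_nbhs_nbhs.
Qed.

Context {M : manifold R n} (aM : atlas M).
Implicit Types (x y z : M) (u : 'rV[R]_n).

Definition overlap x y := [set u | cimg (chart_at x) u /\ cdom (chart_at y) (point x u)].

Lemma open_overlap x y : open (overlap x y).
Proof. by apply: open_preimage => //; have [[[]]] := aM.1 y. Qed.

Lemma open_cimg x : open (cimg (chart_at x)).
Proof. by have [[[]]] := aM.1 x. Qed.

Lemma smooth_transition x y : smooth_on (overlap x y) (transition x y).
Proof. exact: aM.2. Qed.

Lemma coord_cimg x : cimg (chart_at x) (coord x).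
Proof. by have [[_ H _ _ _] Dx] := aM.1 x; have [] := H x Dx. Qed.

Lemma point_coord x : point x (coord x) = x.
Proof. by have [[_ H _ _ _] Dx] := aM.1 x; have [] := H x Dx. Qed.

Lemma coord_overlap x y : cdom (chart_at y) x -> overlap x y (coord x).
Proof. by move=> yx; split; [exact: coord_cimg|rewrite point_coord]. Qed.

Lemma cdom_self x : cdom (chart_at x) x.
Proof. by have [] := aM.1 x. Qed.

Lemma cdom_point x u : cimg (chart_at x) u -> cdom (chart_at x) (point x u).
Proof. by have [[_ _ H _ _] _] := aM.1 x => /H[]. Qed.

Lemma cfwd_point x u : cimg (chart_at x) u -> cfwd (chart_at x) (point x u) = u.
Proof. by have [[_ _ H _ _] _] := aM.1 x => /H[]. Qed.

Lemma cimg_cfwd x y : cdom (chart_at x) y -> cimg (chart_at x) (cfwd (chart_at x) y).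
Proof. by have [[_ H _ _ _] _] := aM.1 x => /H[]. Qed.

Lemma point_cfwd x y : cdom (chart_at x) y -> point x (cfwd (chart_at x) y) = y.
Proof. by have [[_ H _ _ _] _] := aM.1 x => /H[]. Qed.

Lemma overlap_transition x y u : overlap x y u -> overlap y x (transition x y u).
Proof.
move=> [Iu Du]; split; first exact: cimg_cfwd.
by rewrite [point y _]point_cfwd //; exact: cdom_point.
Qed.

Lemma transition_chain x y z u : overlap x y u ->
  transition y z (transition x y u) = transition x z u.
Proof. by move=> [Iu Du]; rewrite /transition /= point_cfwd. Qed.

(** The cocycle relation of the tangent bundle. *)
Lemma jac_chain x y z u : overlap x y u -> overlap x z u ->
  jac (transition x z) u = jac (transition x y) u *m jac (transition y z) (transition x y u).
Proof.
move=> xyu xzu.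
have yzu : overlap y z (transition x y u).
  by split; [exact: cimg_cfwd xyu.2|rewrite [point y _]point_cfwd //; [exact: xzu.2|exact: xyu.2]].
have dxy := smooth_diff (smooth_transition x y) xyu.
have dyz := smooth_diff (smooth_transition y z) yzu.
rewrite -(jac_comp dxy dyz); symmetry.
apply: (jac_eq (@open_overlap x y) xyu); last exact: (differentiable_comp dxy dyz).
by move=> q xyq; rewrite transition_chain.
Qed.

Lemma jac_self x u : cimg (chart_at x) u -> jac (transition x x) u = 1%:M.
Proof.
move=> Iu; have xxu : overlap x x u by split=> //; exact: cdom_point.
rewrite -(jac_id u); apply: (jac_eq (@open_overlap x x) xxu).
  by move=> q [Iq _]; exact: cfwd_point.
exact: smooth_diff (smooth_transition x x) xxu.
Qed.

Lemma jac_inv x y u : overlap x y u ->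
  jac (transition x y) u *m jac (transition y x) (transition x y u) = 1%:M.
Proof.
move=> xyu; rewrite -jac_chain ?jac_self //; first exact: xyu.1.
by split; [exact: xyu.1|exact: cdom_point xyu.1].
Qed.

Lemma overlap_point x u : cimg (chart_at x) u -> overlap x (point x u) u.
Proof. by move=> Iu; split=> //; exact: cdom_self. Qed.

Lemma overlap_pointV x u : cimg (chart_at x) u -> overlap (point x u) x (coord (point x u)).
Proof. by move=> Iu; apply: coord_overlap; exact: cdom_point. Qed.

Lemma transition_point x u : cimg (chart_at x) u ->
  transition (point x u) x (coord (point x u)) = u.
Proof. by move=> Iu; rewrite /transition /= point_coord cfwd_point. Qed.

Lemma vfield_locE (X : vfield M) x u :
  vfield_loc X x u = X (point x u) *m jac (transition (point x u) x) (coord (point x u)).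
Proof. by rewrite jacE. Qed.

Lemma endo_locE (P : endo M) x u : endo_loc P x u =
  jac (transition x (point x u)) u *m P (point x u)
  *m jac (transition (point x u) x) (coord (point x u)).
Proof. by rewrite !jacE. Qed.

Lemma metric_locE (g : metric M) x u : metric_loc g x u =
  jac (transition x (point x u)) u *m g (point x u) *m (jac (transition x (point x u)) u)^T.
Proof. by rewrite !jacE. Qed.

Lemma metric_loc_coord (g : metric M) x : metric_loc g x (coord x) = g x.
Proof.
by rewrite metric_locE point_coord jac_self ?trmx1 ?mulmx1 ?mul1mx //; exact: coord_cimg.
Qed.

Lemma vfield_loc_coord (X : vfield M) x : vfield_loc X x (coord x) = X x.
Proof. by rewrite vfield_locE point_coord jac_self ?mulmx1 //; exact: coord_cimg. Qed.

Lemma endo_loc_coord (P : endo M) x : endo_loc P x (coord x) = P x.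
Proof.
by rewrite endo_locE point_coord jac_self ?mulmx1 ?mul1mx //; exact: coord_cimg.
Qed.

Lemma metric_on_loc (g : metric M) x : riemannian_metric g ->
  metric_on (cimg (chart_at x)) (metric_loc g x).
Proof.
move=> [sg pg smg]; split; [exact: open_cimg|exact: smg| |] => u Iu.
  by rewrite metric_locE !trmx_mul trmxK sg mulmxA.
have /mulmx1_unit [J1 _] := jac_inv (overlap_point Iu).
rewrite metric_locE !unitmx_mul unitmx_tr J1 andbT /=.
exact: posdef_unitmx (pg _).
Qed.

(** The vector field with constant components [a] in the chart around [y]. *)
Definition const_field y (a : 'rV[R]_n) : vfield M :=
  fun z => a *m jac (transition y z) (cfwd (chart_at y) z).

Lemma const_field_loc y a u : cimg (chart_at y) u -> vfield_loc (const_field y a) y u = a.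
Proof.
move=> Iu; rewrite vfield_locE /const_field cfwd_point // -mulmxA.
by rewrite (jac_inv (overlap_point Iu)) mulmx1.
Qed.

Lemma const_field_endo_loc (P : endo M) y a u : cimg (chart_at y) u ->
  vfield_loc (app_endo P (const_field y a)) y u = a *m endo_loc P y u.
Proof.
move=> Iu; rewrite vfield_locE /app_endo /const_field cfwd_point //.
by rewrite endo_locE !mulmxA.
Qed.

(** In another chart the components of this field are a derivative of the
    transition map, composed with the inverse transition. *)
Lemma const_field_smooth y a : smooth_vfield_on (cdom (chart_at y)) (const_field y a).
Proof.
move=> x; have oxy := @open_overlap x y; have oyx := @open_overlap y x.
apply: (smooth_eq oxy (f := fun u => der a (transition y x) (transition x y u))); last first.
  apply: (smooth_comp oxy oyx (@overlap_transition x y)); first exact: smooth_transition.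
  by apply: smooth_der; exact: smooth_transition.
move=> u xyu; have yxu := overlap_transition xyu.
rewrite der_jac; last exact: smooth_diff (smooth_transition y x) yxu.
rewrite vfield_locE /const_field -mulmxA; congr (_ *m _).
rewrite (@jac_chain y (point x u) x) // ?[in RHS]/transition /=.
  rewrite -[cfwd (chart_at y) (point x u)]/(transition x y u) transition_chain //.
by split; [exact: yxu.1|rewrite [point y _]point_cfwd; [exact: cdom_self|exact: xyu.2]].
Qed.

End Charts.

(** * Maps in charts, products of manifolds *)

Section MapLoc.
Context {R : realType} {n k : nat} {N : manifold R n} {M : manifold R k}.
Context (aN : atlas N) (aM : atlas M) {F : N -> M} (sF : smooth_map F).
Implicit Types (x z : N) (u : 'rV[R]_n).

Definition map_dom x := [set u | cimg (chart_at x) u /\ cdom (chart_at (F x)) (F (point x u))].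

Lemma open_map_dom x : open (map_dom x).
Proof.
have oc : open (F @^-1` cdom (chart_at (F x))).
  by apply: open_comp; [move=> z _; exact: sF.1|have [[[]]] := aM.1 (F x)].
exact: (@open_preimage _ _ N x _ aN oc).
Qed.

Lemma smooth_map_loc x : smooth_on (map_dom x) (map_loc F x).
Proof. exact: sF.2. Qed.

Lemma map_dom_coord x : map_dom x (coord x).
Proof. by split; [exact: coord_cimg|rewrite (point_coord aN); exact: cdom_self]. Qed.

Lemma map_loc_cimg x u : map_dom x u -> cimg (chart_at (F x)) (map_loc F x u).
Proof. by move=> [_]; exact: cimg_cfwd. Qed.

Lemma point_map_loc x u : map_dom x u -> point (F x) (map_loc F x u) = F (point x u).
Proof. by move=> [_]; exact: (point_cfwd aM). Qed.

Lemma map_loc_coord x : map_loc F x (coord x) = coord (F x).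
Proof. by rewrite /map_loc /= (point_coord aN). Qed.

Lemma mdiffE x : mdiff F x = jac (map_loc F x) (coord x).
Proof. by rewrite jacE. Qed.

(** Compares the Jacobian, at a point other than the centre, of the expression of
    F in the charts around x with the differential of F at that point. *)
Lemma jac_map_loc x u : map_dom x u -> let z := point x u in
  jac (map_loc F x) u = jac (transition x z) u *m mdiff F z
    *m jac (transition (F z) (F x)) (coord (F z)).
Proof.
move=> xu z; have [Iu Du] := xu.
have xzu : overlap x z u by exact: (overlap_point aN Iu).
have tE : transition x z u = coord z by [].
have FzD : overlap (F z) (F x) (coord (F z)) by exact: coord_overlap.
have dxz := smooth_diff (smooth_transition aN x z) xzu.
have dz := smooth_diff (smooth_map_loc z) (map_dom_coord z).
have dF := smooth_diff (smooth_transition aM (F z) (F x)) FzD.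
have dz' : differentiable (map_loc F z) (transition x z u) by rewrite tE.
have dF' : differentiable (transition (F z) (F x)) (map_loc F z (transition x z u)).
  by rewrite tE map_loc_coord.
rewrite mdiffE -tE -(jac_comp dxz dz') -map_loc_coord -tE.
have dc := differentiable_comp dxz dz'.
rewrite -(jac_comp dc dF'); symmetry.
have ozz := @open_map_dom z.
pose V := [set q | overlap x z q /\ map_dom z (transition x z q)].
have nV : nbhs u V.
  apply: filterI; first by apply: open_nbhs_nbhs; split => //; exact: open_overlap.
  apply: (differentiable_continuous dxz); apply: open_nbhs_nbhs; split => //.
  by rewrite tE; exact: map_dom_coord.
have [W [[oW Wu] WV]] : exists W, open_nbhs u W /\ W `<=` V.
  by move: nV; rewrite nbhsE => -[W oW WV]; exists W.
apply: (jac_eq oW Wu); last exact: (differentiable_comp dc dF').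
move=> q /WV[[Iq Dq] [_ Dzq]]; rewrite /map_loc /transition /=.
by move: Dzq; rewrite /= [point z _](point_cfwd aN Dq) => Dzq; rewrite [point (F z) _](point_cfwd aM Dzq).
Qed.

(** The pull-back holds in the charts around x on a whole neighbourhood, as needed
    to differentiate it. *)
Lemma metric_loc_pullback (gN : metric N) (gM : metric M) x u :
  (forall x, gN x = pullback F gM x) -> map_dom x u ->
  metric_loc gN x u =
  jac (map_loc F x) u *m metric_loc gM (F x) (map_loc F x u) *m (jac (map_loc F x) u)^T.
Proof.
move=> gE xu; have [Iu Du] := xu.
have FD : overlap (F (point x u)) (F x) (coord (F (point x u))) by exact: coord_overlap.
rewrite [in LHS](metric_locE gN) gE /pullback jac_map_loc // [in RHS](metric_locE gM) point_map_loc //.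
have I1 := jac_inv aM FD.
have E : transition (F (point x u)) (F x) (coord (F (point x u))) = map_loc F x u.
  by rewrite /transition /= (point_coord aM).
rewrite E in I1; move: I1.
move: (jac (transition (F (point x u)) _) _) (jac (transition (F x) _) _) => B C BC.
rewrite !trmx_mul !mulmxA -(mulmxA _ B C) BC mulmx1.
by rewrite -(mulmxA _ C^T B^T) -trmx_mul BC trmx1 mulmx1.
Qed.

Lemma jac_map_loc_endo (P : endo M) x u : map_dom x u -> let z := point x u in
  jac (map_loc F x) u *m endo_loc P (F x) (map_loc F x u) =
  jac (transition x z) u *m (mdiff F z *m P (F z)) *m jac (transition (F z) (F x)) (coord (F z)).
Proof.
move=> xu z; have [Iu Du] := xu.
have FD : overlap (F z) (F x) (coord (F z)) by exact: coord_overlap.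
have I1 := jac_inv aM FD.
have E : transition (F z) (F x) (coord (F z)) = map_loc F x u.
  by rewrite /transition /= (point_coord aM).
rewrite E in I1; move: I1.
rewrite jac_map_loc // endo_locE point_map_loc // -/z.
move: (jac (transition (F z) _) _) (jac (transition (F x) _) _) => B C BC.
by rewrite !mulmxA -(mulmxA _ B C) BC mulmx1.
Qed.

End MapLoc.

Section Product.
Context {R : realType} {n1 n2 : nat} {N1 : manifold R n1} {N2 : manifold R n2}.
Context (a1 : atlas N1) (a2 : atlas N2).
Let N := prod_manifold N1 N2.

Lemma row_mx_entry m p q (A : 'M[R]_(m, p)) (B : 'M[R]_(m, q)) i j :
  row_mx A B i j = match fintype.split j with inl a => A i a | inr b => B i b end.
Proof. by rewrite mxE. Qed.

Lemma continuous_row_mx (T : topologicalType) (f : T -> 'rV[R]_n1) (g : T -> 'rV[R]_n2) t :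
  {for t, continuous f} -> {for t, continuous g} ->
  {for t, continuous (fun t => row_mx (f t) (g t))}.
Proof.
move=> cf cg; apply/continuous_mx => i j; rewrite /prop_for.
under eq_fun do rewrite row_mx_entry.
by case: (fintype.split j) => a; [exact: (continuous_mx f t).1 cf _ _|exact: (continuous_mx g t).1 cg _ _].
Qed.

Lemma smooth_row_mx n (U : set 'rV[R]_n) (f : 'rV[R]_n -> 'rV[R]_n1) (g : 'rV[R]_n -> 'rV[R]_n2) :
  open U -> smooth_on U f -> smooth_on U g -> smooth_on U (fun t => row_mx (f t) (g t)).
Proof.
move=> oU sf sg; apply/(smooth_mx oU) => i j; under eq_fun do rewrite row_mx_entry.
by case: (fintype.split j) => a; exact: smooth_entry.
Qed.

Lemma smooth_lsubmx (U : set 'rV[R]_(n1 + n2)) : open U -> smooth_on U lsubmx.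
Proof.
move=> oU; apply/(smooth_mx oU) => i j; under eq_fun do rewrite mxE.
exact: smooth_coord.
Qed.

Lemma smooth_rsubmx (U : set 'rV[R]_(n1 + n2)) : open U -> smooth_on U rsubmx.
Proof.
move=> oU; apply/(smooth_mx oU) => i j; under eq_fun do rewrite mxE.
exact: smooth_coord.
Qed.

Lemma prod_chartP (x : N) : is_chart (chart_at x) /\ cdom (chart_at x) x.
Proof.
have [[[b1 i1] f1 v1 c1 d1] D1] := a1.1 x.1; have [[[b2 i2] f2 v2 c2 d2] D2] := a2.1 x.2.
split; last by split.
split.
- split.
    rewrite openE => -[a b] [Da Db]; exists (cdom (chart_at x.1), cdom (chart_at x.2)) => //.
    by split; apply: open_nbhs_nbhs.
  have -> : cimg (chart_at x) = (lsubmx @^-1` cimg (chart_at x.1)) `&` (rsubmx @^-1` cimg (chart_at x.2)) by [].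
  by apply: openI; apply: open_comp => // u _; [exact: continuous_lsubmx|exact: continuous_rsubmx].
- move=> y [] /f1[I1 E1] /f2[I2 E2] /=; rewrite !row_mxKl !row_mxKr E1 E2.
  by split; [split|case: (y)].
- move=> u [] /v1[I1 E1] /v2[I2 E2] /=; rewrite E1 E2 hsubmxK.
  by split; [split|].
- move=> y [] /c1 C1 /c2 C2; apply: continuous_row_mx.
    exact: (continuous_comp (@cvg_fst _ _ _ _ _) C1).
  exact: (continuous_comp (@cvg_snd _ _ _ _ _) C2).
- move=> u [] /d1 C1 /d2 C2.
  have K1 : {for u, continuous (fun u : 'rV[R]_(n1 + n2) => cinv (chart_at x.1) (lsubmx u))}.
    exact: (continuous_comp (@continuous_lsubmx _ _ _ _ u) C1).
  have K2 : {for u, continuous (fun u : 'rV[R]_(n1 + n2) => cinv (chart_at x.2) (rsubmx u))}.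
    exact: (continuous_comp (@continuous_rsubmx _ _ _ _ u) C2).
  exact: (cvg_pair K1 K2).
Qed.

Lemma transition_prod (x y : N) u :
  transition x y u = row_mx (transition x.1 y.1 (lsubmx u)) (transition x.2 y.2 (rsubmx u)).
Proof. by []. Qed.

Lemma prod_atlas : atlas N.
Proof.
split; first exact: prod_chartP.
move=> x y.
have oD : open [set u | cimg (chart_at x) u /\ cdom (chart_at y) (point x u)].
  have [[[b1 i1] f1 v1 c1 d1] D1] := prod_chartP x; have [[[b2 i2] f2 v2 c2 d2] D2] := prod_chartP y.
  rewrite openE => u [Iu Du]; apply: filterI; first exact: open_nbhs_nbhs.
  by apply: (d1 u Iu); exact: open_nbhs_nbhs.
apply: smooth_row_mx => //.
  apply: (smooth_comp (g := lsubmx) (f := transition x.1 y.1) oD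
    (@open_overlap _ _ _ a1 x.1 y.1) _ (smooth_lsubmx oD) (smooth_transition a1 _ _)).
  by move=> u [[I1 I2] [D1 D2]]; split.
apply: (smooth_comp (g := rsubmx) (f := transition x.2 y.2) oD
  (@open_overlap _ _ _ a2 x.2 y.2) _ (smooth_rsubmx oD) (smooth_transition a2 _ _)).
by move=> u [[I1 I2] [D1 D2]]; split.
Qed.

Lemma overlap_prod (x y : N) u :
  overlap x y u <-> overlap x.1 y.1 (lsubmx u) /\ overlap x.2 y.2 (rsubmx u).
Proof. by split=> [[[? ?] [? ?]]|[[? ?] [? ?]]]. Qed.

Lemma jac_prod (x y : N) u : overlap x y u ->
  jac (transition x y) u = block_mx (jac (transition x.1 y.1) (lsubmx u)) 0
                                    0 (jac (transition x.2 y.2) (rsubmx u)).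
Proof.
move=> xyu; have /overlap_prod[p1 p2] := xyu.
have d1 := smooth_diff (smooth_transition a1 x.1 y.1) p1.
have d2 := smooth_diff (smooth_transition a2 x.2 y.2) p2.
have d := smooth_diff (smooth_transition prod_atlas x y) xyu.
have dl : differentiable (lsubmx : 'rV[R]_(n1 + n2) -> 'rV[R]_n1) u by exact: differentiable_lsubmx.
have dr : differentiable (rsubmx : 'rV[R]_(n1 + n2) -> 'rV[R]_n2) u by exact: differentiable_rsubmx.
have c1 : differentiable (fun u : 'rV[R]_(n1 + n2) => transition x.1 y.1 (lsubmx u)) u.
  exact: differentiable_comp.
have c2 : differentiable (fun u : 'rV[R]_(n1 + n2) => transition x.2 y.2 (rsubmx u)) u.
  exact: differentiable_comp.
apply/row_matrixP => i; rewrite !rowE -der_jac // -[delta_mx 0 i]hsubmxK.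
move: (delta_mx 0 i) => v; rewrite mul_row_block !mulmx0 addr0 add0r hsubmxK.
rewrite -(der_jac _ d1) -(der_jac _ d2).
rewrite -(der_lsubmx v u) -(der_rsubmx v u) -(der_comp v dl d1) -(der_comp v dr d2).
apply/rowP => j; rewrite row_mx_entry der_entry //.
case: (splitP j) => a ja.
  rewrite der_entry //; congr (der v _ u); apply/funext => q.
  by rewrite transition_prod (_ : j = lshift n2 a) ?row_mxEl //; exact: val_inj.
rewrite der_entry //; congr (der v _ u); apply/funext => q.
by rewrite transition_prod (_ : j = rshift n1 a) ?row_mxEr //; exact: val_inj.
Qed.

Lemma metric_loc_warped (f : sfield N1) (g1 : metric N1) (g2 : metric N2) (x : N) u :
  cimg (chart_at x) u ->
  metric_loc (warped_metric f g1 g2) x u =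
  block_mx (metric_loc g1 x.1 (lsubmx u)) 0 0
    (fun_loc f x.1 (lsubmx u) ^+ 2 *: metric_loc g2 x.2 (rsubmx u)).
Proof.
move=> Iu; rewrite metric_locE jac_prod; last exact: (overlap_point prod_atlas).
rewrite !metric_locE /warped_metric.
rewrite tr_block_mx !mulmx_block !trmx0 !(mulmx0, mul0mx) !addr0 !add0r.
by rewrite -scalemxAr -scalemxAl !mul0mx.
Qed.

End Product.

(** * The second fundamental form on an invariant factor *)

Lemma row_mx_split (R : pzRingType) p q (v : 'rV[R]_p) (w : 'rV[R]_q) :
  row_mx v w = row_mx v 0 + row_mx 0 w.
Proof. by rewrite add_row_mx addr0 add0r. Qed.

Lemma der_mulmxc (R : realType) (V : normedModType R) m n p (c : 'M[R]_(m, n)) (B : V -> 'M[R]_(n, p)) u v :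
  differentiable B u -> der v (fun q => c *m B q) u = c *m der v B u.
Proof.
move=> dB; have dc : differentiable (fun _ : V => c) u by exact: differentiable_cst.
by rewrite (der_mulmx v dc dB) der_cst mul0mx add0r.
Qed.

Section SffLinear.
Context {R : realType} {n m : nat}.
Context {W : set 'rV[R]_n} {G : 'rV[R]_n -> 'M[R]_n} (mG : metric_on W G).
Context {U : set 'rV[R]_m} {g : 'rV[R]_m -> 'M[R]_m} (mg : metric_on U g).
Context {P : 'rV[R]_m -> 'rV[R]_n} (UW : forall u, U u -> W (P u)) (sP : smooth_on U P).
Implicit Types (u v w z : 'rV[R]_m).
Let sf := (sff (G := G) (g := g) (P := P)).

Lemma sff_linear_l u a v v' w : U u -> sf u (a *: v + v') w = a *: sf u v w + sf u v' w.
Proof.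
move=> Uu; have Wu := UW Uu; have dP := smooth_diff sP Uu.
have dwP := smooth_diff (smooth_der w sP) Uu.
rewrite /sf /sff /cov !der_linear // (chr_linear_l mG) // (chr_linear_l mg) //.
rewrite mulmxDl -scalemxAl.
move: (der v _ _) (der v' _ _) (chr G _ _ _) (chr G _ _ _) (_ *m _) (_ *m _) => x1 x2 x3 x4 x5 x6.
by apply/rowP => i; rewrite !mxE; ring.
Qed.

End SffLinear.

Section InvariantFactor.
Context {R : realType} {N n1 n2 : nat}.
Context {W : set 'rV[R]_N} {G : 'rV[R]_N -> 'M[R]_N} (mG : metric_on W G).
Context {U : set 'rV[R]_(n1 + n2)} {g : 'rV[R]_(n1 + n2) -> 'M[R]_(n1 + n2)} (mg : metric_on U g).
Context {P : 'rV[R]_(n1 + n2) -> 'rV[R]_N} (UW : forall u, U u -> W (P u)) (sP : smooth_on U P).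
Context (gE : forall u, U u -> g u = jac P u *m G (P u) *m (jac P u)^T).
Context {Q : 'rV[R]_N -> 'M[R]_N} (sQ : smooth_on W Q).
Let JT u := usubmx (jac P u).
Context (invQ : forall u, U u -> (JT u *m Q (P u) <= JT u)%MS).
Context (unitT : forall u, U u -> ulsubmx (g u) \in unitmx).
Context {u0 : 'rV[R]_(n1 + n2)} (Uu0 : U u0).
Context (orth : forall (v : 'rV[R]_n1) (w : 'rV[R]_n2), bil (g u0) (row_mx v 0) (row_mx 0 w) = 0).
Context (geod : forall v v' : 'rV[R]_n1, exists h, chr g u0 (row_mx v 0) (row_mx v' 0) = row_mx h 0).
Context (skewQ : forall x y, bil (G (P u0)) (x *m Q (P u0)) y = - bil (G (P u0)) x (y *m Q (P u0))).
(** [nabla_a Q] maps [a] into the invariant factor, for [a] tangent to it. *)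
Context (nearly : forall v : 'rV[R]_n1, let a := v *m JT u0 in exists k,
  a *m der a Q (P u0) + chr G (P u0) a (a *m Q (P u0)) - chr G (P u0) a a *m Q (P u0) = k *m JT u0).
Let sf := (sff (G := G) (g := g) (P := P) u0).
Let oU : open U. Proof. by case: mg. Qed.
Let oW : open W. Proof. by case: mG. Qed.

Let hJ u (v : 'rV[R]_n1) : row_mx v 0 *m jac P u = v *m JT u.
Proof. by rewrite -{1}[jac P u]vsubmxK mul_row_col mul0mx addr0. Qed.

Let sJT : smooth_on U JT.
Proof.
apply/(smooth_mx oU) => i j; under eq_fun do rewrite mxE.
by apply: smooth_entry => //; exact: smooth_jac.
Qed.

Let derP v u : U u -> der (row_mx v 0) P u = v *m JT u.
Proof. by move=> Uu; rewrite der_jac ?hJ //; exact: smooth_diff sP Uu. Qed.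

Let mT u : U u -> JT u *m G (P u) *m (JT u)^T = ulsubmx (g u).
Proof.
move=> Uu; rewrite gE // -{1 2}[jac P u]vsubmxK tr_col_mx.
by rewrite mul_col_mx mul_col_row block_mxKul.
Qed.

(** The field Q(dP V), V horizontal, is differentiated along V in two ways: as an
    image under Q, and as a combination of horizontal fields. The comparison shows
    that h(V, C) - Q h(V, V) is horizontal. As Q is skew, Q h(V, V) is
    orthogonal to horizontal vectors, which Q preserves; to vertical vectors it is
    orthogonal because it differs from h(V, C) by a horizontal vector. So the
    difference is tangent and normal, hence zero. *)
Lemma sff_invariant (v c : 'rV[R]_n1) : v *m JT u0 *m Q (P u0) = c *m JT u0 ->
  sf (row_mx v 0) (row_mx c 0) = sf (row_mx v 0) (row_mx v 0) *m Q (P u0).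
Proof.
move=> vc; have Wu := UW Uu0; have [_ sG _ uG] := mG.
pose V : 'rV[R]_(n1 + n2) := row_mx v 0.
pose pc u := v *m JT u *m Q (P u) *m G (P u) *m (JT u)^T *m invmx (ulsubmx (g u)).
have sQP : smooth_on U (fun u => Q (P u)) by exact: (smooth_comp oU oW UW sP sQ).
have sGP : smooth_on U (fun u => G (P u)) by exact: (smooth_comp oU oW UW sP sG).
have svJ : smooth_on U (fun u => v *m JT u) by apply: smooth_mulmx => //; exact: smooth_cst.
have sY : smooth_on U (fun u => v *m JT u *m Q (P u)) by exact: smooth_mulmx.
have spc : smooth_on U pc.
  apply: smooth_mulmx => //.
    by apply: smooth_mulmx => //; [exact: smooth_mulmx|exact: smooth_trmx].
  apply: smooth_invmx => //; apply/(smooth_mx oU) => i j.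
  by under eq_fun do rewrite !mxE; apply: smooth_entry => //; case: mg.
have proj x u : U u -> x *m JT u *m G (P u) *m (JT u)^T *m invmx (ulsubmx (g u)) = x.
  move=> Uu; rewrite -(mulmxA x (JT u)) -(mulmxA x _ (JT u)^T) mT //.
  by rewrite -(mulmxA x) mulmxV ?unitT // mulmx1.
have pcE u : U u -> v *m JT u *m Q (P u) = pc u *m JT u.
  move=> Uu; have /submxP[K KE] := invQ Uu.
  have vK : v *m JT u *m Q (P u) = v *m K *m JT u by rewrite -mulmxA KE mulmxA.
  by rewrite /pc vK proj.
have pc0 : pc u0 = c by rewrite /pc vc proj.
have dJT := smooth_diff sJT Uu0; have dpc := smooth_diff spc Uu0.
have dvJ := smooth_diff svJ Uu0; have dQP := smooth_diff sQP Uu0.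
have dP := smooth_diff sP Uu0; have dQ := smooth_diff sQ Wu.
(* The field Q(dP V) differentiated as an image under Q. *)
have E1 : cov (G := G) (P := P) V (fun u => v *m JT u *m Q (P u)) u0 =
    cov (G := G) (P := P) V (der V P) u0 *m Q (P u0)
    + (v *m JT u0 *m der (v *m JT u0) Q (P u0) + chr G (P u0) (v *m JT u0) (v *m JT u0 *m Q (P u0))
       - chr G (P u0) (v *m JT u0) (v *m JT u0) *m Q (P u0)).
  rewrite /cov der_mulmx // (der_comp _ dP dQ) derP // mulmxDl.
  have -> : der V (fun u => v *m JT u) u0 = der V (der V P) u0.
    by apply: (der_eq _ oU Uu0) => u Uu; rewrite derP.
  move: (der V (der V P) u0 *m _) (_ *m der _ _ _) (chr _ _ _ _) (chr _ _ _ _ *m _) => x1 x2 x3 x4.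
  by apply/rowP => i; rewrite !mxE; ring.
(* The same field as a combination of coordinate fields of the invariant factor. *)
have E2 : cov (G := G) (P := P) V (fun u => v *m JT u *m Q (P u)) u0 =
    der V pc u0 *m JT u0 + cov (G := G) (P := P) V (der (row_mx c 0) P) u0.
  rewrite /cov vc -(derP c Uu0) (der_eq _ oU Uu0 pcE) der_mulmx // pc0 -addrA.
  congr (_ + (_ + _)).
  rewrite (@der_eq _ _ _ U (der (row_mx c 0) P) (fun u => c *m JT u)) //; last by move=> u Uu; rewrite derP.
  by rewrite der_mulmxc.
have [k kE] := nearly v; rewrite kE in E1.
have [h1 h1E] := geod v c; have [h2 h2E] := geod v v.
have /submxP[K KE] := invQ Uu0.
move: E1; rewrite E2 (cov_split (g := g)) h1E hJ (cov_split (g := g)) h2E hJ.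
rewrite mulmxDl -(mulmxA h2) KE mulmxA -/sf => E.
pose k' := h2 *m K + k - der V pc u0 - h1.
have dE : sf V (row_mx c 0) - sf V V *m Q (P u0) = row_mx k' 0 *m jac P u0.
  rewrite hJ /k' [RHS]mulmxBl [X in _ = X - _]mulmxBl (mulmxDl (h2 *m K)).
  move: E; move: (sf _ _) (sf _ _ *m _) (h2 *m K *m _) (k *m _) (h1 *m _) (der V pc u0 *m _).
  by move=> x1 x2 x3 x4 x5 x6 /rowP E'; apply/rowP => i; have := E' i; rewrite !mxE; lra.
have [_ _ symg _] := mg.
have nml a b z : bil (G (P u0)) (sf a b) (z *m jac P u0) = 0.
  exact: (sff_normal mG mg UW sP gE).
have sff_Q_normal z : bil (G (P u0)) (sf V V *m Q (P u0)) (z *m jac P u0) = 0.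
  have -> : z = row_mx (lsubmx z) 0 + row_mx 0 (rsubmx z) by rewrite -row_mx_split hsubmxK.
  rewrite mulmxDl bilDr.
  have -> : bil (G (P u0)) (sf V V *m Q (P u0)) (row_mx (lsubmx z) 0 *m jac P u0) = 0.
    by rewrite hJ skewQ -mulmxA KE mulmxA -hJ nml oppr0.
  have -> : sf V V *m Q (P u0) = sf V (row_mx c 0) - row_mx k' 0 *m jac P u0.
    by rewrite -dE opprB addrC subrK.
  by rewrite bilBl nml -(bil_pull gE) // orth subrr addr0.
have k0 : row_mx k' 0 = 0 :> 'rV[R]_(n1 + n2).
  apply: (bil_inj mg Uu0) => z; rewrite bil0l (bil_pull gE) // -dE bilBl nml sff_Q_normal subrr //.
by apply/eqP; rewrite -subr_eq0 dE k0 mul0mx.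
Qed.

End InvariantFactor.

(** * Vanishing of the trace over the invariant factor *)

Section TraceZero.
Context {R : realType} {p N : nat} {B : 'M[R]_p} {H : 'rV[R]_p -> 'rV[R]_p -> 'rV[R]_N}.
Context (Hl : forall a v v' w, H (a *: v + v') w = a *: H v w + H v' w).
Context (HC : forall v w, H v w = H w v).
Context {Q : 'M[R]_N} {J : 'M[R]_p} {x0 : 'rV[R]_p} {e : 'rV[R]_p -> R}.
Context (HJ : forall v, H v (v *m J) = H v v *m Q).
Context (HQQ : forall v w, H v w *m Q *m Q = - H v w).
Context (x0J : x0 *m J = 0) (JJ : forall v, v *m J *m J = - v + e v *: x0).
Context (sB : B^T = B) (skewJ : forall v w, bil B (v *m J) w = - bil B v (w *m J)).

Lemma sym_bilinear_r a v v' w : H w (a *: v + v') = a *: H w v + H w v'.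
Proof. by rewrite !(HC w) Hl. Qed.
Lemma sym_bilinear0 w : H w 0 = 0.
Proof. by have := sym_bilinear_r (-1) 0 0 w; rewrite scaler0 addr0 scaleN1r addNr. Qed.
Lemma sym_bilinearD w v v' : H w (v + v') = H w v + H w v'.
Proof. by rewrite -{1}[v]scale1r sym_bilinear_r scale1r. Qed.
Lemma sym_bilinearZ w a v : H w (a *: v) = a *: H w v.
Proof. by rewrite -[a *: v]addr0 sym_bilinear_r sym_bilinear0 addr0. Qed.
Lemma sym_bilinearN w v : H w (- v) = - H w v.
Proof. by rewrite -scaleN1r sym_bilinearZ scaleN1r. Qed.

Let polar v w : H v (w *m J) + H w (v *m J) = 2 *: H v w *m Q.
Proof.
have HD u u' z : H (u + u') z = H u z + H u' z by rewrite !(HC _ z) sym_bilinearD.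
have := HJ (v + w); rewrite mulmxDl !HD !sym_bilinearD !mulmxDl (HC w v) !HJ.
rewrite -scalemxAl.
move: (H v v *m Q) (H w w *m Q) (H v w *m Q) (H v (w *m J)) (H w (v *m J)) => a b c d f /rowP E.
by apply/rowP => i; have := E i; rewrite !mxE; lra.
Qed.

Let Q_inj v w : H v w *m Q = 0 -> H v w = 0.
Proof. by move=> h; apply: oppr_inj; rewrite -HQQ h mul0mx oppr0. Qed.

(** Polarisation against the characteristic vector gives
    H(x0, v J) = 2 H(v, x0) Q; applied twice, it shows H(x0, v) = 4 H(x0, v). *)
Lemma sff_characteristic v : H v x0 = 0.
Proof.
have H00 : H x0 x0 = 0 by apply: Q_inj; rewrite -HJ x0J sym_bilinear0.
have P1 w : H x0 (w *m J) = 2 *: H w x0 *m Q by rewrite -polar x0J sym_bilinear0 add0r.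
have := P1 (v *m J); rewrite JJ sym_bilinearD sym_bilinearN sym_bilinearZ H00 scaler0 addr0.
rewrite (HC (v *m J)) P1 -!scalemxAl scalerA HQQ (HC x0).
move=> /rowP E; apply/rowP => i; have := E i; rewrite !mxE; lra.
Qed.

(** [HJ] at v J, where v J^2 = - v up to a multiple of x0, which H ignores;
    multiplication by Q is injective on the values of H. *)
Lemma sff_antiinvariant v : H (v *m J) (v *m J) = - H v v.
Proof.
have E : H (v *m J) (v *m J *m J) = - H v v *m Q.
  by rewrite JJ sym_bilinearD sym_bilinearN sym_bilinearZ sff_characteristic scaler0 addr0 HC HJ mulNmx.
have {}E : (H (v *m J) (v *m J) + H v v) *m Q = 0 by rewrite mulmxDl -HJ E mulNmx addNr.
apply/eqP; rewrite -addr_eq0; apply/eqP/oppr_inj.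
rewrite oppr0 opprD -!HQQ -!mulmxDl.
by rewrite E mul0mx.
Qed.

Lemma onb_expand (E : 'M[R]_p) x : E *m B *m E^T = 1%:M -> x = \sum_i bil B x (row i E) *: row i E.
Proof.
move=> EE; have := mulmx1C EE; rewrite mulmxA => EBE.
have BE : B *m E^T *m E = 1%:M by apply: mulmx1C; rewrite mulmxA.
rewrite -{1}[x]mulmx1 -BE 2!mulmxA mulmx_sum_row; apply: eq_bigr => i _; congr (_ *: _).
by rewrite /bil tr_row colE mulmxA -colE [RHS]mxE.
Qed.

(** Since J is skew, summing H(e_i J, e_i J) after expanding e_i J in the basis
    amounts to summing - H(e_i, e_i J^2) = H(e_i, e_i), while
    [sff_antiinvariant] gives the opposite of that sum. *)
Lemma trace_sff_zero (E : 'M[R]_p) : E *m B *m E^T = 1%:M ->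
  \sum_i H (row i E) (row i E) = 0.
Proof.
move=> EE.
have sumr I (r : seq I) (F : I -> 'rV[R]_p) w : H w (\sum_(i <- r) F i) = \sum_(i <- r) H w (F i).
  by elim/big_rec2 : _ => [|i y x _ IH]; rewrite ?sym_bilinear0 // sym_bilinearD IH.
have T1 : \sum_i H (row i E *m J) (row i E *m J) = - \sum_i H (row i E) (row i E).
  by rewrite -sumrN; apply: eq_bigr => i _; rewrite sff_antiinvariant.
have T2 : \sum_i H (row i E *m J) (row i E *m J) = \sum_i H (row i E) (row i E).
  transitivity (\sum_i \sum_j bil B (row i E *m J) (row j E) *: H (row j E) (row i E *m J)).
    apply: eq_bigr => i _; rewrite {1}(onb_expand (row i E *m J) EE) HC sumr.
    by apply: eq_bigr => j _; rewrite sym_bilinearZ HC.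
  rewrite exchange_big; apply: eq_bigr => j _ /=.
  transitivity (- H (row j E) (row j E *m J *m J)).
    rewrite {1}(onb_expand (row j E *m J) EE) mulmx_suml sumr -sumrN; apply: eq_bigr => i _.
    by rewrite -scalemxAl sym_bilinearZ (skewJ (row i E)) (bilC (row i E)) // scaleNr.
  by rewrite JJ sym_bilinearD sym_bilinearN sym_bilinearZ sff_characteristic scaler0 addr0 opprK.
move: T1; rewrite T2; move: (\sum_i _) => s /rowP S.
by apply/rowP => i; have := S i; rewrite !mxE; lra.
Qed.

End TraceZero.

(** * The scalar curvature of a subspace *)

Section Tau.
Context {R : realType} {n : nat} {M : manifold R n} (aM : atlas M) {g : metric M} (rg : riemannian_metric g).

Lemma sum_lt_half k (s : 'I_k -> 'I_k -> R) : (forall i j, s i j = s j i) -> (forall i, s i i = 0) ->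
  \sum_(i < k) \sum_(j < k | (i < j)%N) s i j = 2^-1 * \sum_i \sum_j s i j.
Proof.
move=> sC s0.
have -> : \sum_i \sum_j s i j = \sum_(i < k) \sum_(j < k | (i < j)%N) s i j + \sum_(i < k) \sum_(j < k | (j < i)%N) s i j.
  rewrite -big_split; apply: eq_bigr => i _ /=.
  rewrite (bigID (fun j : 'I_k => (i < j)%N)) /=; congr (_ + _).
  rewrite [LHS]big_mkcond [RHS]big_mkcond; apply: eq_bigr => j _.
  rewrite -leqNgt leq_eqVlt; case: eqP => [/val_inj ->|_ //].
  by rewrite s0 ltnn.
have -> : \sum_(i < k) \sum_(j < k | (j < i)%N) s i j = \sum_(i < k) \sum_(j < k | (i < j)%N) s i j.
  rewrite (exchange_big_dep xpredT) //=; apply: eq_bigr => i _; apply: eq_bigr => j _.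
  exact: sC.
by field.
Qed.

Definition curv (x : M) (u v : 'rV[R]_n) : R :=
  bil (g x) (rie (metric_loc g x) (coord x) u v v) u.

Let mg x : metric_on (cimg (chart_at x)) (metric_loc g x).
Proof. exact: metric_on_loc. Qed.
Let gx x : metric_loc g x (coord x) = g x.
Proof. exact: metric_loc_coord. Qed.
Let Ux (x : M) : cimg (chart_at x) (coord x).
Proof. exact: coord_cimg. Qed.

Lemma curvC x u v : curv x u v = curv x v u.
Proof. by rewrite /curv -gx (riemann_pair (mg x)). Qed.

Lemma curv0 x u : curv x u u = 0.
Proof. by rewrite /curv -gx (riemann_skew (mg x)). Qed.

Lemma sum_curv_basis x l (V : 'M[R]_(l, n)) k (E E' : 'M[R]_(k, n)) :
  orthonormal_basis (g x) V E -> orthonormal_basis (g x) V E' ->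
  \sum_i \sum_j curv x (row i E') (row j E') = \sum_i \sum_j curv x (row i E) (row j E).
Proof.
move=> oE oE'.
have step w : \sum_i curv x (row i E') w = \sum_i curv x (row i E) w.
  apply: (@trace_invariant _ _ (g x) _ V _ E E'
    (fun u v => bil (g x) (rie (metric_loc g x) (coord x) u w w) v)) => //.
    by move=> a u v z; rewrite (riemann_linear1 (mg x)) // bilDl bilZl.
  by move=> a u v z; rewrite bilDr bilZr.
transitivity (\sum_i \sum_j curv x (row i E) (row j E')).
  by rewrite exchange_big [RHS]exchange_big; apply: eq_bigr => j _; exact: step.
apply: eq_bigr => i _.
under eq_bigr do rewrite curvC.
by rewrite step; apply: eq_bigr => j _; rewrite curvC.
Qed.

(** For orthonormal vectors the denominators of the sectional curvatures are 1, and
    the sum over pairs is half of a double trace, the same in all bases. *)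
Lemma tauE x l (V : 'M[R]_(l, n)) k (E : 'M[R]_(k, n)) : orthonormal_basis (g x) V E ->
  tau g x V = 2^-1 * \sum_i \sum_j curv x (row i E) (row j E).
Proof.
move=> oE; have [EE VE] := oE.
have rk : \rank V = k.
  apply/eqP; rewrite -VE eqn_leq rank_leq_row /=.
  have := mxrankM_maxl (E *m g x) E^T; rewrite EE mxrank1 => h.
  exact: leq_trans h (mxrankM_maxl _ _).
rewrite /tau rk; have oF := onb_orthonormal oE; have [FF _] := oF.
move: (onb (g x) V k) oF FF => F oF FF.
rewrite -(sum_curv_basis oE oF) -sum_lt_half; [|by move=> i j; exact: curvC|by move=> i; exact: curv0].
apply: eq_bigr => i _; apply: eq_bigr => j ij.
rewrite /sectional /curvature -rieE -/(curv x _ _) !(orthonormal_bil _ _ FF) !eqxx.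
have /negbTE -> : i != j by rewrite neq_ltn ij.
by rewrite mulr1 expr0n subr0 divr1.
Qed.

End Tau.

(** * The nearly trans-Sasakian identity at a point *)

Section NearlyTransSasakian.
Context {R : realType} {m : nat} {Mbar : manifold R (2 * m).+1}.
Context {phi : endo Mbar} {xi : vfield Mbar} {eta : form1 Mbar} {g : metric Mbar}.
Context {alpha beta : sfield Mbar}.
Context (nts : nearly_trans_sasakian phi xi eta g alpha beta).
Implicit Types (y : Mbar) (a b v w : 'rV[R]_(2 * m).+1).

Let acm : almost_contact_metric phi xi eta g. Proof. by case: nts. Qed.

Lemma ambient_atlas : atlas Mbar.
Proof. by apply: smooth_manifold_atlas; case: acm => -[]. Qed.

Lemma ambient_metric : riemannian_metric g.
Proof. by case: acm => -[]. Qed.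

Lemma phi_sqr y v : v *m phi y *m phi y = - v + (v *m eta y) 0 0 *: xi y.
Proof.
have [_ p2 _ _ _] := acm; rewrite -mulmxA p2 mulmxDr mulmxN mulmx1 mulmxA.
by rewrite [X in X *m xi y]mx11_scalar mul_scalar_mx.
Qed.

(** Compatibility of the metric with phi, applied to v and w phi. *)
Lemma phi_skew y v w : bil (g y) (v *m phi y) w = - bil (g y) v (w *m phi y).
Proof.
have [_ _ p0 eg pg] := acm.
have E := pg y v (w *m phi y); rewrite phi_sqr bilDr bilNr bilZr in E.
have e0 u : (u *m phi y *m eta y) 0 0 = 0 by rewrite -mulmxA (p0 y).2 mulmx0 mxE.
rewrite -(eg y).2 !e0 !mulr0 subr0 addr0 in E.
by rewrite -E opprK.
Qed.

Lemma nablaE (X Y : vfield Mbar) y : nabla g X Y y =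
  der (X y) (vfield_loc Y y) (coord y) + chr (metric_loc g y) (coord y) (X y) (Y y).
Proof. by rewrite derE chrE. Qed.

(** The identity is applied to the field with constant components [a], whose
    covariant derivative has no derivative term. Of its right-hand side only the
    membership in the span of xi, a and phi a matters below. *)
Lemma nearly_local y a : exists c1 c2 c3 : R,
  a *m der a (endo_loc phi y) (coord y) + chr (metric_loc g y) (coord y) a (a *m phi y)
  - chr (metric_loc g y) (coord y) a a *m phi y
  = c1 *: xi y + c2 *: a + c3 *: (a *m phi y).
Proof.
have aM := ambient_atlas; have [[_ _ sphi _ _] _ _ _ _] := acm.
have Iy : cimg (chart_at y) (coord y) by exact: coord_cimg.
have oI : open (cimg (chart_at y)) by exact: open_cimg.
pose X := const_field y a.
have Xy : X y = a by rewrite -(vfield_loc_coord aM X) const_field_loc.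
have [_ _ _ H] := nts.
have oD : open (cdom (chart_at y)) by have [[[]]] := aM.1 y.
have sX := const_field_smooth aM y a.
have := H (cdom (chart_at y)) X X oD sX sX y (cdom_self aM y).
set T : 'rV[R]_(2 * m).+1 := _ - _.
have -> : nabla_endo g phi X X y = T.
  rewrite /nabla_endo /app_endo !nablaE !Xy.
  have -> : der a (vfield_loc X y) (coord y) = 0.
    by rewrite (der_eq a oI Iy (fun u Iu => const_field_loc aM a Iu)) der_cst.
  have -> : der a (vfield_loc (fun x => X x *m phi x) y) (coord y) = a *m der a (endo_loc phi y) (coord y).
    rewrite (der_eq a oI Iy (fun u Iu => const_field_endo_loc aM phi a Iu)).
    by rewrite der_mulmxc //; exact: smooth_diff (sphi y) Iy.
  by rewrite add0r.
rewrite /app_endo /= Xy; set e := (a *m eta y) 0 0.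
set q := bil _ a a => E.
clearbody T q e.
exists (alpha y * q), (- (alpha y * e)), (- (beta y * e)).
move: E; move: (a *m phi y) => z /rowP E; apply/rowP => i; have := E i; rewrite !mxE.
move=> Ei; have -> : T 0 i = 2^-1 * (T 0 i + T 0 i) by field.
by rewrite Ei; field.
Qed.

End NearlyTransSasakian.

(** * The Laplacian in coordinates *)

Section Laplacian.
Context {R : realType} {n : nat} {N : manifold R n} (aN : atlas N) {g : metric N} {f : sfield N}.
Context (sf : smooth_fun f).

Lemma fun_loc_transition (x z : N) u : overlap z x u -> fun_loc f z u = fun_loc f x (transition z x u).
Proof. by move=> [Iu Du]; rewrite /fun_loc /transition /= (point_cfwd aN). Qed.

(** Y f in the chart around x, away from its centre: the definition of [vder] uses
    another chart at each point. *)
Lemma vder_loc (Y : vfield N) x u : cimg (chart_at x) u ->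
  fun_loc (vder Y f) x u = der (vfield_loc Y x u) (fun_loc f x) u.
Proof.
move=> Iu; rewrite {1}/fun_loc /vder; set z := point x u.
have zx : overlap z x (coord z) by exact: overlap_pointV.
have dt := smooth_diff (smooth_transition aN z x) zx.
have tE : transition z x (coord z) = u by exact: transition_point.
have df : differentiable (fun_loc f x) (transition z x (coord z)).
  by rewrite tE; exact: smooth_diff (sf x) Iu.
rewrite -derxE (der_eq (Y z) (@open_overlap _ _ _ aN z x) zx (fun q Dq => fun_loc_transition Dq)).
rewrite (der_comp _ dt df) tE (der_jac _ dt).
by rewrite vfield_locE.
Qed.

(** The derivatives of the frame enter both terms of the Laplacian and cancel,
    leaving minus the trace of the Hessian. *)
Lemma laplacianE (E : 'I_n -> vfield N) x : local_orthonormal_frame g x E ->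
  laplacian g E f x = \sum_i (der (chr (metric_loc g x) (coord x) (E i x) (E i x)) (fun_loc f x) (coord x)
     - der (E i x) (der (E i x) (fun_loc f x)) (coord x)).
Proof.
move=> [V [oV Vx sE _]]; apply: eq_bigr => i _.
have Ix : cimg (chart_at x) (coord x) by exact: coord_cimg.
have oI : open (cimg (chart_at x)) by exact: open_cimg.
set F := fun_loc f x; set e := E i x; set Y := vfield_loc (E i) x.
have oD := @open_preimage _ _ N x V aN oV.
have Dx : [set u | cimg (chart_at x) u /\ V (point x u)] (coord x).
  by split=> //; rewrite (point_coord aN).
have dF : differentiable F (coord x) by exact: smooth_diff (sf x) Ix.
have dY : differentiable Y (coord x) by exact: smooth_diff (sE i x) Dx.
have Ye : Y (coord x) = e by exact: vfield_loc_coord.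
have -> : vder (nabla g (E i) (E i)) f x =
    der (der e Y (coord x)) F (coord x) + der (chr (metric_loc g x) (coord x) e e) F (coord x).
  rewrite /vder -derxE -/F.
  have -> : nabla g (E i) (E i) x = der e Y (coord x) + chr (metric_loc g x) (coord x) e e.
    by rewrite derE chrE.
  by rewrite -{1}[der e Y _]scale1r der_linear // scale1r.
have dFj j : differentiable (der (delta_mx 0 j) F) (coord x).
  by apply: (smooth_diff _ Ix); apply: smooth_der; exact: (sf x).
have dYj j : differentiable (fun q => Y q 0 j) (coord x) by exact: (differentiable_mx Y _).1.
have -> : vder (E i) (vder (E i) f) x =
    der (der e Y (coord x)) F (coord x) + der e (der e F) (coord x).
  rewrite {1}/vder -derxE (der_eq _ oI Ix (fun u Iu => vder_loc (E i) Iu)) -/F -/Y -/e.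
  have H (Z : 'rV[R]_n -> 'rV[R]_n) : (forall j, differentiable (fun q => Z q 0 j) (coord x)) ->
      der e (fun q => der (Z q) F q) (coord x) =
      \sum_j der e (fun q => Z q 0 j) (coord x) * der (delta_mx 0 j) F (coord x)
      + \sum_j Z (coord x) 0 j * der e (der (delta_mx 0 j) F) (coord x).
    move=> dZ; rewrite (@der_eq _ _ _ _ _ (fun q => \sum_j Z q 0 j * der (delta_mx 0 j) F q) _ e oI Ix); last first.
      by move=> q Iq; apply: der_sum_delta; exact: smooth_diff (sf x) Iq.
    rewrite der_bigsum; last by move=> j _; exact: differentiableM.
    by rewrite -big_split; apply: eq_bigr => j _ /=; rewrite der_mul.
  rewrite (H Y) // (H (fun=> e)); last by move=> j; exact: differentiable_cst.
  rewrite [X in _ = _ + (X + _)]big1 ?add0r; last by move=> j _; rewrite der_cst mul0r.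
  rewrite Ye; congr (_ + _).
  rewrite (der_sum_delta _ dF); apply: eq_bigr => j _.
  by rewrite der_entry.
by rewrite opprD addrACA subrr add0r.
Qed.

End Laplacian.

(** * Leaves of a product *)

Section Leaf.
Context {R : realType} {n1 n2 N k : nat}.
Let n := (n1 + n2)%N.
Context {W : set 'rV[R]_N} {G : 'rV[R]_N -> 'M[R]_N} (mG : metric_on W G).
Context {U : set 'rV[R]_n} {g : 'rV[R]_n -> 'M[R]_n} (mg : metric_on U g).
Context {P : 'rV[R]_n -> 'rV[R]_N} (UW : forall u, U u -> W (P u)) (sP : smooth_on U P).
Context (K : 'M[R]_(k, n)) (b : 'rV[R]_n).
(* The leaves are parametrised by affine maps into the coordinates of M. *)
Let inc (u : 'rV[R]_k) := u *m K + b.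

Lemma differentiable_inc u : differentiable inc u.
Proof.
apply: differentiable_addfun; last exact: differentiable_cst.
apply: differentiable_mulmx; first by [].
exact: differentiable_cst.
Qed.

Lemma der_inc v u : der v inc u = v *m K.
Proof.
have dm : differentiable (fun u : 'rV[R]_k => u *m K) u.
  by apply: differentiable_mulmx; [by []|exact: differentiable_cst].
have dc : differentiable (fun _ : 'rV[R]_k => b) u by exact: differentiable_cst.
have dK : differentiable (fun _ : 'rV[R]_k => K) u by exact: differentiable_cst.
have di : differentiable (@id 'rV[R]_k) u by [].
by rewrite (der_addf v dm dc) der_cst addr0 (der_mulmx v di dK) der_id der_cst mulmx0 addr0.
Qed.

Lemma open_inc : open [set u | U (inc u)].
Proof.
apply: open_comp; last by case: mg.
by move=> u _; apply: differentiable_continuous; exact: differentiable_inc.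
Qed.

Lemma der_restrict (V : normedModType R) (f : 'rV[R]_n -> V) v u : smooth_on U f -> U (inc u) ->
  der v (fun q => f (inc q)) u = der (v *m K) f (inc u).
Proof.
move=> sf Uu; rewrite (der_comp v (differentiable_inc u) (smooth_diff sf Uu)).
by rewrite der_inc.
Qed.

Lemma der2_restrict v w u : U (inc u) ->
  der v (der w (fun q => P (inc q))) u = der (v *m K) (der (w *m K) P) (inc u).
Proof.
move=> Uu.
rewrite (der_eq v open_inc Uu (fun q Uq => der_restrict w sP Uq)).
by rewrite (der_restrict v (smooth_der _ sP)).
Qed.

Lemma jac_restrict u : U (inc u) -> jac (fun q => P (inc q)) u = K *m jac P (inc u).
Proof.
move=> Uu; have dP := smooth_diff sP Uu.
have d : differentiable (fun q => P (inc q)) u.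
  exact: (differentiable_comp (differentiable_inc u) dP).
apply/row_matrixP => i; rewrite !rowE mulmxA -(der_jac _ d) -(der_jac _ dP).
exact: der_restrict.
Qed.

(** The second fundamental forms of the leaf and of the whole differ by that of the
    leaf inside the source. *)
Lemma sff_restrict (g' : 'rV[R]_k -> 'M[R]_k) u v w : U (inc u) ->
  der v (der w (fun q => P (inc q))) u
  + chr G (P (inc u)) (v *m jac (fun q => P (inc q)) u) (w *m jac (fun q => P (inc q)) u)
  - chr g' u v w *m jac (fun q => P (inc q)) u
  = sff (G := G) (g := g) (P := P) (inc u) (v *m K) (w *m K)
    + (chr g (inc u) (v *m K) (w *m K) - chr g' u v w *m K) *m jac P (inc u).
Proof.
move=> Uu; have dP := smooth_diff sP Uu.
rewrite der2_restrict // jac_restrict // !mulmxA /sff /cov !(der_jac _ dP) mulmxBl.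
by rewrite [RHS]addrA subrK.
Qed.

End Leaf.

Lemma chr_scale (R : realType) n (U : set 'rV[R]_n) (g : 'rV[R]_n -> 'M[R]_n) (c : R) u v w :
  metric_on U g -> c != 0 -> U u -> chr (fun q => c *: g q) u v w = chr g u v w.
Proof.
move=> mg c0 Uu; have [oU sg symg ug] := mg.
have mcg : metric_on U (fun q => c *: g q).
  split=> // [|q Uq|q Uq].
  - by apply: smooth_scale => //; exact: smooth_cst.
  - by rewrite linearZ /= symg.
  - by rewrite unitmxZ ?unitfE // ug.
apply: (bil_inj mcg Uu) => z; rewrite (koszul mcg) // bil_scale (koszul mg) //.
by rewrite !(der_scalec c _ (smooth_diff sg Uu)) !bil_scale; ring.
Qed.

(** * Warped product semi-slant submanifolds *)

Lemma usubmx_block_mul (R : pzRingType) p q r s t (A : 'M[R]_(p, r)) (B : 'M[R]_(q, s)) (X : 'M[R]_(r + s, t)) :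
  usubmx (block_mx A 0 0 B *m X) = A *m usubmx X.
Proof. by rewrite -{1}[X]vsubmxK mul_block_col mul0mx addr0 col_mxKu. Qed.

Lemma psumr2_eq0 (R : realType) k (s : 'I_k -> 'I_k -> R) : (forall i j, 0 <= s i j) ->
  \sum_i \sum_j s i j = 0 -> forall i j, s i j = 0.
Proof.
move=> s0 e i j.
have /eqP := e; rewrite psumr_eq0; last by move=> h _; apply: sumr_ge0.
move=> /allP/(_ i (mem_index_enum _)) /=.
by rewrite psumr_eq0 // => /allP/(_ j (mem_index_enum _)) /eqP.
Qed.

Lemma sym_bilinear_eq0 (R : realType) k n (A B : 'M[R]_k) (H : 'rV[R]_k -> 'rV[R]_k -> 'rV[R]_n) :
  (forall a v v' z, H (a *: v + v') z = a *: H v z + H v' z) -> (forall v z, H v z = H z v) ->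
  B *m A *m B^T = 1%:M -> (forall i j, H (row i B) (row j B) = 0) -> forall v z, H v z = 0.
Proof.
move=> Hl HC BB H0.
have Hz z : H 0 z = 0 by have := Hl (-1) 0 0 z; rewrite scaler0 addr0 scaleN1r addNr.
have H1 z : (forall j, H (row j B) z = 0) -> forall v, H v z = 0.
  move=> Hj v; rewrite (onb_expand v BB).
  by elim/big_rec : _ => // i t _ IH; rewrite Hl Hj IH scaler0 addr0.
by move=> v z; apply: (H1 z) => j; rewrite HC; apply: H1 => i.
Qed.

(** The point (p, q) of M is fixed. P is the immersion in the charts around
    (p, q) and its image, G and g are the metrics there; the rows of JT and JS span
    the tangent spaces of the two factors; J is the matrix of phi on the tangent
    space of N_T and x0 the row of components of xi there. *)
Section SemiSlantPoint.
Context {R : realType} {m n1 n2 : nat} {Mbar : manifold R (2 * m).+1}.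
Context {phi : endo Mbar} {xi : vfield Mbar} {eta : form1 Mbar} {gbar : metric Mbar}.
Context {alpha beta : sfield Mbar} {NT : manifold R n1} {Nth : manifold R n2}.
Context {g1 : metric NT} {g2 : metric Nth} {f : sfield NT} {theta : R}.
Context {iota : prod_manifold NT Nth -> Mbar} {E : NT -> 'I_n1 -> vfield NT}.
Context (hMbar : nearly_trans_sasakian phi xi eta gbar alpha beta).
Context (hM : warped_product_semi_slant phi xi gbar iota g1 g2 f theta).
Context (hxi : forall x, (xi (iota x) <= TNT iota x)%MS).
Context (hE : forall p, local_orthonormal_frame g1 p (E p)).
Let M := prod_manifold NT Nth.
Implicit Types (u : 'rV[R]_(n1 + n2)) (v : 'rV[R]_n1) (w : 'rV[R]_n2).

Let aB : atlas Mbar := ambient_atlas hMbar.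
Let rB : riemannian_metric gbar := ambient_metric hMbar.
Let aT : atlas NT. Proof. by case: hM => -[/smooth_manifold_atlas]. Qed.
Let aS : atlas Nth. Proof. by case: hM => -[_ /smooth_manifold_atlas]. Qed.
Let aM : atlas M. Proof. exact: prod_atlas. Qed.
Let r1 : riemannian_metric g1. Proof. by case: hM => -[]. Qed.
Let r2 : riemannian_metric g2. Proof. by case: hM => -[]. Qed.
Let sf : smooth_fun f. Proof. by case: hM => _ []. Qed.
Let f0 p : 0 < f p. Proof. by case: hM => _ [_ +] _ _ _; apply. Qed.
Let si : smooth_map iota. Proof. by case: hM => _ _ [] . Qed.
Let gM := warped_metric f g1 g2.
Let gME x : gM x = pullback iota gbar x. Proof. by case: hM => _ _ [_ _ +] _ _; apply. Qed.
Let free x : row_free (mdiff iota x). Proof. by case: hM => _ _ [_ + _] _ _; apply. Qed.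

Variables (p : NT) (q : Nth).
Let x : M := (p, q).
Let P := map_loc iota x.
Let U := map_dom (F := iota) x.
Let W := cimg (chart_at (iota x)).
Let G := metric_loc gbar (iota x).
Let g := metric_loc gM x.
Let u0 := coord x.
Let U1 := cimg (chart_at x.1).
Let U2 := cimg (chart_at x.2).
Let G1 := metric_loc g1 x.1.
Let G2 := metric_loc g2 x.2.
Let F := fun_loc f x.1.

Let mG : metric_on W G. Proof. exact: metric_on_loc. Qed.
Let mg1 : metric_on U1 G1. Proof. exact: metric_on_loc. Qed.
Let mg2 : metric_on U2 G2. Proof. exact: metric_on_loc. Qed.
Let sF : smooth_on U1 F. Proof. exact: sf. Qed.
Let F0 t : U1 t -> F t != 0. Proof. by move=> _; rewrite gt_eqF // /F /fun_loc. Qed.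
Let UW u : U u -> W (P u). Proof. exact: map_loc_cimg. Qed.
Let sP : smooth_on U P. Proof. exact: smooth_map_loc. Qed.
Let oU : open U. Proof. exact: open_map_dom. Qed.
Let Uu0 : U u0. Proof. exact: map_dom_coord. Qed.
Let gE u : U u -> g u = jac P u *m G (P u) *m (jac P u)^T.
Proof. exact: metric_loc_pullback. Qed.
Let U12 u : U u -> U1 (lsubmx u) /\ U2 (rsubmx u). Proof. by case=> -[]. Qed.
Let GE u : U u -> g u = block_mx (G1 (lsubmx u)) 0 0 (F (lsubmx u) ^+ 2 *: G2 (rsubmx u)).
Proof. by move=> [Iu _]; exact: metric_loc_warped. Qed.

Let mg : metric_on U g.
Proof.
have [oW sG symG uG] := mG; have [_ _ sym1 un1] := mg1; have [_ _ sym2 un2] := mg2.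
have sJ := smooth_jac oU sP.
split=> // [|u Uu|u Uu].
- apply: (smooth_eq oU (fun u Uu => esym (gE Uu))).
  have sGP : smooth_on U (fun u => G (P u)) := smooth_comp oU oW UW sP sG.
  exact: (smooth_mulmx oU (smooth_mulmx oU sJ sGP) (smooth_trmx oU sJ)).
- have [U1u U2u] := U12 Uu.
  by rewrite GE // tr_block_mx !trmx0 sym1 // linearZ /= sym2.
- have [U1u U2u] := U12 Uu; rewrite GE // unitmxE det_ublock unitrM -!unitmxE un1 //=.
  by rewrite unitmxZ ?un2 // unitfE expf_neq0 ?F0.
Qed.

Let y := iota x.
Let JT := TNT iota x.
Let JS := TNth iota x.

Let P0 : P u0 = coord y. Proof. exact: map_loc_coord. Qed.
Let G0 : G (coord y) = gbar y. Proof. exact: metric_loc_coord. Qed.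
Let g0 : g u0 = gM x. Proof. exact: metric_loc_coord. Qed.
Let J0 : jac P u0 = TM iota x. Proof. by rewrite /TM jacE. Qed.
Let L0 : lsubmx u0 = coord x.1. Proof. exact: row_mxKl. Qed.
Let R0 : rsubmx u0 = coord x.2. Proof. exact: row_mxKr. Qed.
Let G20 : G2 (coord x.2) = g2 x.2. Proof. exact: metric_loc_coord. Qed.
Let F00 : F (coord x.1) = f x.1. Proof. by rewrite /F /fun_loc (point_coord aT). Qed.

Definition second_form (u v : 'rV[R]_(n1 + n2)) := sff (G := G) (g := g) (P := P) u0 u v.
Let S := second_form.

Lemma second_formE u u' : second_fundamental_form iota gM gbar x u u' = S u u'.
Proof.
have dP := smooth_diff sP Uu0.
by rewrite /S /second_form /sff /cov !(der_jac _ dP) J0 P0 !chrE derxE derE.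
Qed.

Let hJT v : row_mx v 0 *m TM iota x = v *m JT.
Proof. by rewrite -{1}[TM iota x]vsubmxK mul_row_col mul0mx addr0. Qed.
Let hJS w : row_mx 0 w *m TM iota x = w *m JS.
Proof. by rewrite -{1}[TM iota x]vsubmxK mul_row_col mul0mx add0r. Qed.

Let JT_inj v v' : v *m JT = v' *m JT -> v = v'.
Proof.
rewrite -!hJT => /(row_free_inj (free x)) /(congr1 lsubmx).
by rewrite !row_mxKl.
Qed.

Let bil_TM u u' : bil (gM x) u u' = bil (gbar y) (u *m TM iota x) (u' *m TM iota x).
Proof. by rewrite gME /pullback bil_mul. Qed.

Let bil_T v v' : bil (g1 x.1) v v' = bil (gbar y) (v *m JT) (v' *m JT).
Proof. by rewrite -!hJT -bil_TM /gM /warped_metric bil_block bil0l addr0. Qed.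

Let S_normal u u' z : bil (gbar y) (S u u') (z *m TM iota x) = 0.
Proof. by rewrite -G0 -P0 -J0; exact: (sff_normal mG mg UW sP gE _ _ _ Uu0). Qed.

Let Slin a u u' z : S (a *: u + u') z = a *: S u z + S u' z.
Proof. exact: (sff_linear_l mG mg UW sP _ _ _ _ Uu0). Qed.
Let SC u u' : S u u' = S u' u.
Proof. exact: (sffC mG mg UW sP _ _ Uu0). Qed.

Let Jphi : {J : 'M[R]_n1 | JT *m phi y = J *m JT}.
Proof. by apply: cid; apply/submxP; case: hM => _ _ _ _ [+ _]; apply. Qed.
Let J := sval Jphi.
Let JE : JT *m phi y = J *m JT. Proof. exact: svalP Jphi. Qed.
Let Xi : {x0 : 'rV[R]_n1 | xi y = x0 *m JT}.
Proof. by apply: cid; apply/submxP; exact: hxi. Qed.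
Let x0 := sval Xi.
Let x0E : xi y = x0 *m JT. Proof. exact: svalP Xi. Qed.

Lemma second_form_invariant v :
  S (row_mx v 0) (row_mx (v *m J) 0) = S (row_mx v 0) (row_mx v 0) *m phi y.
Proof.
have [_ _ sphi _ _] : [/\ smooth_manifold Mbar, riemannian_metric gbar, smooth_endo phi,
  smooth_vfield_on setT xi & smooth_form1 eta] by case: hMbar => -[].
have Q0 : endo_loc phi y (P u0) = phi y by rewrite P0 endo_loc_coord.
have JTE : usubmx (jac P u0) = JT by rewrite J0.
rewrite -Q0.
apply: (sff_invariant mG mg UW sP gE (sphi y)) => //.
- move=> u Uu; set z : M := point x u; have [Iu _] := Uu.
  have xz : overlap x z u by exact: (overlap_point aM).
  rewrite mul_usub_mx (jac_map_loc_endo aM aB si phi Uu) (jac_map_loc aM aB si Uu) -/z.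
  rewrite (jac_prod aT aS xz); move: (jac (transition (iota z) _) _) => B.
  rewrite -!(mul_usub_mx _ B) !usubmx_block_mul -mul_usub_mx.
  have /submxP[K KE] : (TNT iota z *m phi (iota z) <= TNT iota z)%MS by case: hM => _ _ _ _ [].
  rewrite -[usubmx (mdiff iota z)]/(TNT iota z) KE.
  have /overlap_prod[ov _] := xz.
  have /mulmx1_unit[A1 _] := jac_inv aT ov.
  move: (jac _ _) A1 => A A1.
  by apply/submxP; exists (A *m K *m invmx A); rewrite !mulmxA mulmxKV.
- move=> u Uu; rewrite GE // block_mxKul; have [U1u _] := U12 Uu.
  by case: mg1 => _ _ _; apply.
- move=> v' w; rewrite g0 /gM /warped_metric bil_block bil0l bil0r addr0 //.
- move=> v1 v2; exists (chr G1 (lsubmx u0) v1 v2).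
  exact: (chr_warped_hh mg1 mg2 sF mg U12 GE _ _ Uu0).
- move=> a b; rewrite Q0.
  rewrite P0.
  rewrite G0.
  exact: (phi_skew hMbar y a b).
- move=> v' a; rewrite Q0 P0.
  have [c1 [c2 [c3 ->]]] := nearly_local hMbar y a.
  exists (c1 *: x0 + c2 *: v' + c3 *: (v' *m J)).
  rewrite /a JTE x0E -(mulmxA v') JE !mulmxDl -!scalemxAl mulmxA //.
by rewrite JTE Q0 -(mulmxA v) JE mulmxA.
Qed.

Let hDl a v v' : row_mx (a *: v + v') 0 = a *: row_mx v 0 + row_mx v' 0 :> 'rV[R]_(n1 + n2).
Proof. by rewrite scale_row_mx add_row_mx scaler0 addr0. Qed.
Let hDr a w w' : row_mx 0 (a *: w + w') = a *: row_mx 0 w + row_mx 0 w' :> 'rV[R]_(n1 + n2).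
Proof. by rewrite scale_row_mx add_row_mx scaler0 addr0. Qed.

(** [trace_sff_zero] for the restriction of h to N_T. *)
Lemma second_form_trace (B : 'M[R]_n1) : B *m g1 p *m B^T = 1%:M ->
  \sum_i S (row_mx (row i B) 0) (row_mx (row i B) 0) = 0.
Proof.
have [_ _ p0 eg _] : almost_contact_metric phi xi eta gbar by case: hMbar.
have [s1 _ _] := r1.
apply: (@trace_sff_zero _ _ _ (g1 p) (fun v v' => S (row_mx v 0) (row_mx v' 0)) _ _
  (phi y) J x0 (fun v => (v *m JT *m eta y) 0 0)).
- by move=> a v v' v''; rewrite hDl Slin.
- by move=> v v'; exact: SC.
- exact: second_form_invariant.
- move=> v v'; rewrite (phi_sqr hMbar) (eg y).2 x0E -hJT S_normal scale0r addr0 //.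
- by apply: JT_inj; rewrite -mulmxA -JE mulmxA -x0E (p0 y).1 mul0mx.
- move=> v; apply: JT_inj; rewrite mulmxDl mulNmx -scalemxAl -x0E -(phi_sqr hMbar).
  by rewrite -(mulmxA v JT) JE mulmxA -(mulmxA _ JT) JE mulmxA.
- exact: s1.
- move=> v v'; rewrite !bil_T -!mulmxA -!JE !mulmxA; exact: (phi_skew hMbar).
Qed.

Definition hess v : R := der v (der v F) (coord p) - der (chr G1 (coord p) v v) F (coord p).

Lemma curv_mixed v w :
  curv (g := gbar) y (v *m JT) (w *m JS) = - f p * hess v * bil (g2 q) w w
  - bil (gbar y) (S (row_mx 0 w) (row_mx 0 w)) (S (row_mx v 0) (row_mx v 0))
  + bil (gbar y) (S (row_mx v 0) (row_mx 0 w)) (S (row_mx v 0) (row_mx 0 w)).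
Proof.
have := gauss mG mg UW sP gE (row_mx v 0) (row_mx 0 w) Uu0.
rewrite (curvature_warped mg1 mg2 sF F0 mg U12 GE v w Uu0).
rewrite -/(S _ _) -/(S _ _) -/(S _ _).
by rewrite J0 hJT hJS P0 G0 L0 R0 G20 F00.
Qed.

Definition sff_sqr (u u' : 'rV[R]_(n1 + n2)) := bil (gbar y) (S u u') (S u u').

Lemma sqnorm_basis (B : 'M[R]_(n1 + n2)) : B *m gM x *m B^T = 1%:M ->
  sqnorm_sff iota gM gbar x = \sum_i \sum_j sff_sqr (row i B) (row j B).
Proof.
move=> BB.
have oB : orthonormal_basis (gM x) (1%:M : 'M[R]_(n1 + n2)) B.
  split=> //; apply/eqmxP; rewrite submx1 sub1mx row_full_unit.
  exact: orthonormal_unit BB.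
rewrite /sqnorm_sff; have oC := onb_orthonormal oB; move: (onb _ _ _) oC => C oC.
have step z : \sum_i sff_sqr (row i C) z = \sum_i sff_sqr (row i B) z.
  apply: (@trace_invariant _ _ (gM x) _ 1%:M _ B C (fun u u' => bil (gbar y) (S u z) (S u' z))) => //.
    by move=> a u v w; rewrite Slin bilDl bilZl.
  by move=> a u v w; rewrite Slin bilDr bilZr.
have sqC u u' : sff_sqr u u' = sff_sqr u' u by rewrite /sff_sqr SC.
transitivity (\sum_i \sum_j sff_sqr (row i C) (row j C)).
  by apply: eq_bigr => i _; apply: eq_bigr => j _; rewrite !second_formE.
transitivity (\sum_i \sum_j sff_sqr (row i B) (row j C)).
  by rewrite exchange_big [RHS]exchange_big; apply: eq_bigr => j _; exact: step.
apply: eq_bigr => i _; under eq_bigr do rewrite sqC.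
by rewrite step; apply: eq_bigr => j _; rewrite sqC.
Qed.

Let B1 : 'M[R]_n1 := \matrix_(i, j) E p i p 0 j.
Let rowB1 i : row i B1 = E p i p.
Proof. by apply/rowP => j; rewrite !mxE. Qed.

Lemma bil_delta k (A : 'M[R]_k) i j : bil A (delta_mx 0 i) (delta_mx 0 j) = A i j.
Proof. by rewrite /bil -rowE trmx_delta -colE !mxE. Qed.

Let B11 : B1 *m g1 p *m B1^T = 1%:M.
Proof.
have [V [_ Vp _ HE]] := hE p.
apply/matrixP => i j; rewrite -bil_delta bil_mul -!rowE !rowB1 HE //.
by rewrite mxE.
Qed.

Let gS := f p ^+ 2 *: g2 q.

Lemma leaf_metric_sym : gS^T = gS.
Proof. by have [s2 _ _] := r2; rewrite linearZ /= s2. Qed.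

Lemma leaf_metric_pos w : w != 0 -> 0 < bil gS w w.
Proof. by have [_ p2 _] := r2; move=> w0; rewrite bil_scale mulr_gt0 ?exprn_gt0 ?p2. Qed.

Let nonneg a : 0 <= bil (gbar y) a a.
Proof.
have [_ pB _] := rB; have [->|/pB /ltW //] := eqVneq a 0; by rewrite bil0l.
Qed.

(** The mixed terms of |h|^2 and of the curvature cancel, the trace of h over N_T
    being zero. *)
Lemma gap_identity (B2 : 'M[R]_n2) : B2 *m gS *m B2^T = 1%:M ->
  2^-1 * sqnorm_sff iota gM gbar x
  - (tau gbar y (TM iota x) - tau gbar y (TNT iota x) - tau gbar y (TNth iota x)
     - n2%:R * laplacian g1 (E p) f p / f p)
  = 2^-1 * (\sum_i \sum_j sff_sqr (row_mx (row i B1) 0) (row_mx (row j B1) 0)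
          + \sum_a \sum_b sff_sqr (row_mx 0 (row a B2)) (row_mx 0 (row b B2))).
Proof.
move=> B22.
pose B := block_mx B1 0 0 B2.
have BB : B *m gM x *m B^T = 1%:M.
  rewrite /B /gM /warped_metric tr_block_mx !mulmx_block !trmx0 !(mulmx0, mul0mx) !addr0 !add0r.
  by rewrite !mul0mx B11 B22 -scalar_mx_block.
have rowl i : row (lshift n2 i) B = row_mx (row i B1) 0.
  by rewrite /B /block_mx rowKu row_row_mx row0.
have rowr a : row (rshift n1 a) B = row_mx 0 (row a B2).
  by rewrite /B /block_mx rowKd row_row_mx row0.
have oM : orthonormal_basis (gbar y) (TM iota x) (B *m TM iota x).
  split; first by rewrite trmx_mul -BB gME /pullback !mulmxA.
  by apply: eqmxMfull; rewrite row_full_unit; exact: orthonormal_unit BB.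
have oT : orthonormal_basis (gbar y) (TNT iota x) (B1 *m JT).
  split; last by apply: eqmxMfull; rewrite row_full_unit; exact: orthonormal_unit B11.
  apply/matrixP => i j; rewrite -[in RHS]B11 trmx_mul !mulmxA.
  rewrite -[B1 *m JT *m gbar y *m JT^T *m B1^T]mulmxA -trmx_mul -!bil_delta !bil_mul.
  by rewrite !mulmxA -bil_T.
have oS : orthonormal_basis (gbar y) (TNth iota x) (B2 *m JS).
  split; last by apply: eqmxMfull; rewrite row_full_unit; exact: orthonormal_unit B22.
  apply/matrixP => i j; rewrite -[in RHS]B22 trmx_mul !mulmxA.
  rewrite -[B2 *m JS *m gbar y *m JS^T *m B2^T]mulmxA -trmx_mul -!bil_delta !bil_mul.
  by rewrite !mulmxA -!hJS -bil_TM /gM /warped_metric bil_block bil0l add0r.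
rewrite (tauE aB rB oM) (tauE aB rB oT) (tauE aB rB oS) (sqnorm_basis BB).
have cC a b : curv (g := gbar) y a b = curv (g := gbar) y b a := curvC aB rB y a b.
rewrite !big_split_ord /=.
have sTT : \sum_i \sum_j curv (g := gbar) y (row (lshift n2 i) (B *m TM iota x)) (row j (B *m TM iota x))
   = \sum_i \sum_j curv (g := gbar) y (row i (B1 *m JT)) (row j (B1 *m JT))
   + \sum_i \sum_a curv (g := gbar) y (row i B1 *m JT) (row a B2 *m JS).
  rewrite -big_split; apply: eq_bigr => i _; rewrite big_split_ord /=.
  by congr (_ + _); apply: eq_bigr => j _; rewrite !row_mul rowl ?rowr ?rowl !hJT ?hJS.
have sSS : \sum_a \sum_j curv (g := gbar) y (row (rshift n1 a) (B *m TM iota x)) (row j (B *m TM iota x))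
   = \sum_i \sum_a curv (g := gbar) y (row i B1 *m JT) (row a B2 *m JS)
   + \sum_i \sum_j curv (g := gbar) y (row i (B2 *m JS)) (row j (B2 *m JS)).
  rewrite [X in _ = X + _]exchange_big -big_split; apply: eq_bigr => a _; rewrite big_split_ord /=.
  by congr (_ + _); apply: eq_bigr => j _; rewrite !row_mul rowr ?rowl ?rowr !hJS ?hJT // cC.
rewrite sTT sSS.
have nTT : \sum_i \sum_j sff_sqr (row (lshift n2 i) B) (row j B)
   = \sum_i \sum_j sff_sqr (row_mx (row i B1) 0) (row_mx (row j B1) 0)
   + \sum_i \sum_a sff_sqr (row_mx (row i B1) 0) (row_mx 0 (row a B2)).
  rewrite -big_split; apply: eq_bigr => i _; rewrite big_split_ord /=.
  by congr (_ + _); apply: eq_bigr => j _; rewrite rowl ?rowr ?rowl.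
have nSS : \sum_a \sum_j sff_sqr (row (rshift n1 a) B) (row j B)
   = \sum_i \sum_a sff_sqr (row_mx (row i B1) 0) (row_mx 0 (row a B2))
   + \sum_i \sum_j sff_sqr (row_mx 0 (row i B2)) (row_mx 0 (row j B2)).
  rewrite [X in _ = X + _]exchange_big -big_split; apply: eq_bigr => a _; rewrite big_split_ord /=.
  by congr (_ + _); apply: eq_bigr => j _; rewrite rowr ?rowl ?rowr // /sff_sqr SC.
rewrite nTT nSS.
have fN0 : f p != 0 by rewrite gt_eqF.
have mixed : \sum_i \sum_a curv (g := gbar) y (row i B1 *m JT) (row a B2 *m JS) =
    n2%:R * laplacian g1 (E p) f p / f p
    + \sum_i \sum_a sff_sqr (row_mx (row i B1) 0) (row_mx 0 (row a B2)).
  have -> : \sum_i \sum_a curv (g := gbar) y (row i B1 *m JT) (row a B2 *m JS) =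
    \sum_i \sum_(a < n2) (- hess (row i B1) / f p)
    - \sum_i \sum_a bil (gbar y) (S (row_mx 0 (row a B2)) (row_mx 0 (row a B2))) (S (row_mx (row i B1) 0) (row_mx (row i B1) 0))
    + \sum_i \sum_a sff_sqr (row_mx (row i B1) 0) (row_mx 0 (row a B2)).
    rewrite -sumrB -big_split; apply: eq_bigr => i _ /=.
    rewrite -sumrB -big_split; apply: eq_bigr => a _ /=.
    rewrite curv_mixed; congr (_ - _ + _).
    have := orthonormal_bil a a B22; rewrite eqxx bil_scale => ba.
    have -> : bil (g2 q) (row a B2) (row a B2) = (f p ^+ 2)^-1.
      by apply: (mulfI (expf_neq0 2 fN0)); rewrite ba mulfV // expf_neq0.
    by field.
  have -> : \sum_i \sum_a bil (gbar y) (S (row_mx 0 (row a B2)) (row_mx 0 (row a B2))) (S (row_mx (row i B1) 0) (row_mx (row i B1) 0)) = 0.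
    rewrite exchange_big big1 // => a _ /=.
    by rewrite -bil_sumr (second_form_trace B11) bil0r.
  rewrite subr0; congr (_ + _).
  rewrite (laplacianE aT sf (hE p)) mulr_sumr mulr_suml; apply: eq_bigr => i _.
  rewrite sumr_const card_ord -/F -/G1 -rowB1 -[_ *+ n2]mulr_natl /hess; by field.
rewrite mixed.
by move: (n2%:R * _ / _) => L; field.
Qed.

Let sqr_eq0 a : bil (gbar y) a a = 0 -> a = 0.
Proof.
have [_ pB _] := rB; move=> a0; apply/eqP; apply: contraT => /(pB y).
by rewrite a0 ltxx.
Qed.

Lemma mixed_tau_le_sqnorm :
  tau gbar y (TM iota x) - tau gbar y (TNT iota x) - tau gbar y (TNth iota x)
  - n2%:R * laplacian g1 (E p) f p / f p <= 2^-1 * sqnorm_sff iota gM gbar x.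
Proof.
have [B2 B22] := orthonormal_exists leaf_metric_sym leaf_metric_pos.
rewrite -subr_ge0 (gap_identity B22) mulr_ge0 // ?invr_ge0 // addr_ge0 //;
  by apply: sumr_ge0 => i _; apply: sumr_ge0 => j _; exact: nonneg.
Qed.

Lemma sff_eq0_of_equality :
  2^-1 * sqnorm_sff iota gM gbar x =
    tau gbar y (TM iota x) - tau gbar y (TNT iota x) - tau gbar y (TNth iota x)
    - n2%:R * laplacian g1 (E p) f p / f p ->
  (forall v v', S (row_mx v 0) (row_mx v' 0) = 0) /\
  (forall w w', S (row_mx 0 w) (row_mx 0 w') = 0).
Proof.
have [B2 B22] := orthonormal_exists leaf_metric_sym leaf_metric_pos.
move=> /eqP; rewrite -subr_eq0 (gap_identity B22) mulf_eq0 invr_eq0 pnatr_eq0 /=.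
have ge1 k (h : 'I_k -> 'rV[R]_(n1 + n2)) : 0 <= \sum_i \sum_j sff_sqr (h i) (h j).
  by apply: sumr_ge0 => i _; apply: sumr_ge0 => j _; exact: nonneg.
rewrite paddr_eq0 ?ge1 // => /andP[/eqP T0 /eqP S0].
split.
- apply: (sym_bilinear_eq0 (B := B1) (A := g1 p)) => //.
  + by move=> a v v' z; rewrite hDl Slin.
  + by move=> i j; apply: sqr_eq0; apply: (psumr2_eq0 _ T0) => a b; exact: nonneg.
- apply: (sym_bilinear_eq0 (B := B2) (A := gS)) => //.
  + by move=> a v v' z; rewrite hDr Slin.
  + by move=> i j; apply: sqr_eq0; apply: (psumr2_eq0 _ S0) => a b; exact: nonneg.
Qed.

Section LeafForm.
Context {k : nat} {N' : manifold R k} (L : N' -> Mbar) (r : N') (K : 'M[R]_(k, n1 + n2)) (b : 'rV[R]_(n1 + n2)).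
Context (Lr : L r = y) (Lloc : map_loc L r = fun t => P (t *m K + b)) (Lc : coord r *m K + b = u0).

Lemma leaf_mdiff : mdiff L r = K *m TM iota x.
Proof.
rewrite mdiffE Lloc (@jac_restrict _ _ _ _ _ U P sP K b) Lc ?J0 //.
Qed.

Lemma leaf_second_form (g' : metric N') s t :
  second_fundamental_form L g' gbar r s t = S (s *m K) (t *m K)
  + (chr g u0 (s *m K) (t *m K) - chr (metric_loc g' r) (coord r) s t *m K) *m TM iota x.
Proof.
have Uc : U (coord r *m K + b) by rewrite Lc.
have := @sff_restrict _ _ _ _ _ G U g mg P sP K b (metric_loc g' r) (coord r) s t Uc.
rewrite -Lloc Lc J0 -/(S _ _) => <-.
by rewrite derxE derE !chrE jacE /second_fundamental_form Lr P0 /mdiff.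
Qed.

Lemma leaf_pullback : pullback L gbar r = K *m gM x *m K^T.
Proof. by rewrite /pullback leaf_mdiff Lr gME /pullback trmx_mul !mulmxA. Qed.

End LeafForm.

Let KT : 'M[R]_(n1, n1 + n2) := row_mx 1%:M 0.
Let KS : 'M[R]_(n2, n1 + n2) := row_mx 0 1%:M.
Let mulKT v : v *m KT = row_mx v 0. Proof. by rewrite mul_mx_row mulmx1 mulmx0. Qed.
Let mulKS w : w *m KS = row_mx 0 w. Proof. by rewrite mul_mx_row mulmx1 mulmx0. Qed.

Let leafT_loc : map_loc (leafT iota q) p = fun t => P (t *m KT + row_mx 0 (coord q)).
Proof.
have E' t : Defs.point x (row_mx t (coord q)) = (Defs.point p t, q).
  by rewrite /Defs.point /= row_mxKl row_mxKr [cinv _ (coord q)](point_coord aS).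
by apply/funext => t; rewrite mulKT -row_mx_split /P /map_loc /= E'.
Qed.
Let leafT_coord : coord p *m KT + row_mx 0 (coord q) = u0.
Proof. by rewrite mulKT -row_mx_split. Qed.

Let leafth_loc : map_loc (leafth iota p) q = fun t => P (t *m KS + row_mx (coord p) 0).
Proof.
have E' t : Defs.point x (row_mx (coord p) t) = (p, Defs.point q t).
  by rewrite /Defs.point /= row_mxKl row_mxKr [cinv _ (coord p)](point_coord aT).
by apply/funext => t; rewrite mulKS addrC -row_mx_split /P /map_loc /= E'.
Qed.
Let leafth_coord : coord q *m KS + row_mx (coord p) 0 = u0.
Proof. by rewrite mulKS addrC -row_mx_split. Qed.

Lemma leafT_pullback : pullback (leafT iota q) gbar p = g1 p.
Proof.
rewrite (leaf_pullback (K := KT) erefl leafT_loc leafT_coord) /gM /warped_metric.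
by rewrite mul_row_block tr_row_mx mul_row_col !mul1mx !mul0mx addr0 trmx1 mulmx1 trmx0 mulmx0 !addr0.
Qed.

Lemma leafth_pullback : pullback (leafth iota p) gbar q = f p ^+ 2 *: g2 q.
Proof.
rewrite (leaf_pullback (K := KS) erefl leafth_loc leafth_coord) /gM /warped_metric.
by rewrite mul_row_block tr_row_mx mul_row_col !mul1mx !mul0mx !add0r trmx1 mulmx1 trmx0 mulmx0 !add0r.
Qed.

Lemma leafT_second_form v v' :
  second_fundamental_form (leafT iota q) g1 gbar p v v' = S (row_mx v 0) (row_mx v' 0).
Proof.
rewrite (leaf_second_form (K := KT) erefl leafT_loc leafT_coord) !mulKT.
by rewrite (chr_warped_hh mg1 mg2 sF mg U12 GE _ _ Uu0) L0 subrr mul0mx addr0.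
Qed.

(** The Christoffel symbols of M have, on vertical vectors, a horizontal part
    proportional to grad f: the leaf of N_theta is umbilical in M. *)
Lemma leafth_second_form : exists h : 'rV[R]_(2 * m).+1, forall w w',
  second_fundamental_form (leafth iota p) (fun t => f p ^+ 2 *: g2 t) gbar q w w' =
  S (row_mx 0 w) (row_mx 0 w') + bil (f p ^+ 2 *: g2 q) w w' *: h.
Proof.
have fN0 : f p != 0 by rewrite gt_eqF.
exists ((- (f p)^-1) *: (grad (g1 := G1) (F := F) (coord p) *m JT)) => w w'.
rewrite (leaf_second_form (K := KS) erefl leafth_loc leafth_coord) !mulKS; congr (_ + _).
have -> : metric_loc (fun t => f p ^+ 2 *: g2 t) q = fun t => f p ^+ 2 *: G2 t.
  by apply/funext => t; rewrite /G2 !metric_locE -scalemxAr -scalemxAl.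
rewrite (chr_scale _ _ mg2) ?expf_neq0 //; last exact: coord_cimg.
rewrite (chr_warped_vv mg1 mg2 sF mg U12 GE _ _ Uu0) L0 R0 G20 F00.
rewrite opp_row_mx add_row_mx subrr oppr0 addr0 hJT -scalemxAl scalerA bil_scale.
by congr (_ *: _); field.
Qed.

End SemiSlantPoint.

(** The factor h is then the mean curvature vector, as seen by taking the trace; in
    dimension 0 the mean curvature is 0 by convention and both sides vanish. *)
Lemma umbilical_of_proportional (R : realType) k n (N : manifold R k) (M : manifold R n) (L : N -> M) (gM : metric M) :
  (forall q, (pullback L gM q)^T = pullback L gM q) ->
  (forall q v, v != 0 -> 0 < bil (pullback L gM q) v v) ->
  (forall q, exists h, forall v w, second_fundamental_form L (pullback L gM) gM q v w =
     bil (pullback L gM q) v w *: h) ->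
  totally_umbilical L gM.
Proof.
move=> sG pG H gN q v w; rewrite /gN {gN}; have [h hE] := H q; rewrite hE /mean_curvature.
have [B BB] := orthonormal_exists (sG q) (pG q).
have oB : orthonormal_basis (pullback L gM q) (1%:M : 'M[R]_k) B.
  split=> //; apply/eqmxP; rewrite submx1 sub1mx row_full_unit.
  exact: orthonormal_unit BB.
have [CC _] := onb_orthonormal oB; move: (onb _ _ _) CC => C CC.
rewrite (eq_bigr (fun=> h)); last first.
  by move=> i _; rewrite hE (orthonormal_bil _ _ CC) eqxx scale1r.
rewrite sumr_const card_ord -[h *+ k]scaler_nat (scalerA _ k%:R).
have [k0|kN0] := eqVneq k 0%N.
  have -> : v = 0 by apply/rowP => i; have := ltn_ord i; rewrite {2}k0.
  by rewrite bil0l !scale0r.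
by rewrite mulVf ?pnatr_eq0 // scale1r.
Qed.

Theorem theorem5p1 (R : realType) (m n1 n2 : nat)
  (Mbar : manifold R (2 * m).+1)
  (phi : endo Mbar) (xi : vfield Mbar) (eta : form1 Mbar) (gbar : metric Mbar)
  (alpha beta : sfield Mbar)
  (NT : manifold R n1) (Nth : manifold R n2)
  (g1 : metric NT) (g2 : metric Nth) (f : sfield NT) (theta : R)
  (iota : prod_manifold NT Nth -> Mbar)
  (E : NT -> 'I_n1 -> vfield NT)
  (hMbar : nearly_trans_sasakian phi xi eta gbar alpha beta)
  (hM : warped_product_semi_slant phi xi gbar iota g1 g2 f theta)
  (hxi : forall x, (xi (iota x) <= TNT iota x)%MS)
  (hE : forall p, local_orthonormal_frame g1 p (E p)) :
  let lhs x := 2^-1 * sqnorm_sff iota (warped_metric f g1 g2) gbar x in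
  let rhs x :=
    tau gbar (iota x) (TM iota x) - tau gbar (iota x) (TNT iota x)
    - tau gbar (iota x) (TNth iota x)
    - n2%:R * laplacian g1 (E x.1) f x.1 / f x.1 in
  (forall x, lhs x >= rhs x) /\
  ((forall x, lhs x = rhs x) ->
   (forall q, totally_geodesic (leafT iota q) gbar) /\
   (forall p, totally_umbilical (leafth iota p) gbar)).
Proof.
move=> lhs rhs; split=> [[p q]|lr]; first exact: (mixed_tau_le_sqnorm hMbar hM hxi hE).
have eqS p q := sff_eq0_of_equality hMbar hM hxi hE (lr (p, q)).
split=> [q p v v'|p].
  have -> : pullback (leafT iota q) gbar = g1.
    by apply/funext => p'; exact: (leafT_pullback hMbar hM).
  by rewrite (leafT_second_form hMbar hM) (eqS p q).1.
have gE : pullback (leafth iota p) gbar = fun q => f p ^+ 2 *: g2 q.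
  by apply/funext => q; exact: (leafth_pullback hMbar hM).
apply: umbilical_of_proportional; rewrite gE => q.
- exact: (leaf_metric_sym hM).
- exact: (leaf_metric_pos hM).
- have [h hh] := leafth_second_form hMbar hM p q.
  by exists h => v w; rewrite hh (eqS p q).2 add0r.
Qed.
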